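(* Let $A=(a_1,\ldots,a_n)\in\mathbb N^n$ (positive integers) with $a_1<a_2<\cdots<a_n$. Then $\mathrm{sh}_A$ is a smooth $n$-dimensional complex manifold.
   Context: Fusion products. Let $e,h,f$ be the standard basis of $\mathfrak{sl}_2(\mathbb C)$ and write $x_j=x\otimes t^j$. For positive integers $A=(a_1,\ldots,a_n)$ choose pairwise distinct $z_1,\ldots,z_n\in\mathbb C$, let $\mathbb C^{a}$ be the $a$-dimensional irreducible $\mathfrak{sl}_2$-module, and $\mathbb C^{a_i}(z_i)$ the $\mathfrak{sl}_2\otimes\mathbb C[t]$-module on which $x_j$ acts as $z_i^jx$. Let $\overline{v_A}\in\bigotimes_i\mathbb C^{a_i}(z_i)$ be the tensor product of lowest weight vectors and $F_s$ the span of all $x^{(1)}_{i_1}\cdots x^{(k)}_{i_k}\overline{v_A}$ with $x^{(j)}\in\mathfrak{sl}_2$, $i_1+\cdots+i_k\le s$. The fusion product is the associated graded $\mathfrak{sl}_2\otimes\mathbb C[t]$-module $M^A=\bigoplus_sF_s/F_{s-1}$, with $v_A$ the image of $\overline{v_A}$. Known facts: $\mathfrak{sl}_2\otimes t^j$ acts by $0$ for $j\ge n$; $M^A=\mathbb C[e_0,\ldots,e_{n-1}]v_A\simeq\mathbb C[e_0,\ldots,e_{n-1}]/I_A$ with $I_A$ generated by $\sum_{i_1+\cdots+i_k=s}e_{n-1-i_1}\cdots e_{n-1-i_k}$ for $k\ge1$, $s<\sum_{j=1}^n\max(k+1-a_j,0)$ (so $M^A$ does not depend on the $z_i$); $\dim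 M^A=\prod a_i$. Schubert variety. $\mathrm G=SL_2(\mathbb C[t]/t^n)$ acts on $M^A$ and on $\mathbb P(M^A)$; $[v]$ denotes the line $\mathbb Cv$; $\mathrm{sh}_A=\overline{\mathrm G\cdot[v_A]}\subset\mathbb P(M^A)$.
   Formalization: The case a_1 = 1 is excluded (all a_i ≥ 2 is assumed): there the claim is false, since the factor C^{a_1} is trivial and sh_A has dimension n-1 (for A = (1) it is a point). *)

(* Defs.v *)
From HB Require Import structures.
From mathcomp Require Import all_boot all_order all_algebra.
From mathcomp Require Import qpoly ring.
From mathcomp Require Import all_classical all_reals all_analysis.
From mathcomp Require Export complex.
Import numFieldNormedType.Exports.

Set Implicit Arguments.
Unset Strict Implicit.
Unset Printing Implicit Defensive.

Import Order.TTheory GRing.Theory Num.Theory.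
Local Open Scope classical_set_scope.
Local Open Scope ring_scope.

Section LinearAlgebra.
Variables (K : fieldType) (V : vectType K).
Implicit Types (S : set V) (U W : {vspace V}) (F : nat -> {vspace V}).

(* The linear span of a possibly infinite set, as the least subspace
   containing it; existence is [vspan_least]. *)
Definition is_vspan S U :=
  (forall w, S w -> w \in U) /\
  (forall W, (forall w, S w -> w \in W) -> (U <= W)%VS).

Definition vspan S : {vspace V} := xget 0%VS [set U | is_vspan S U].

Lemma vspan_least S : is_vspan S (vspan S).
Proof.
suff [U HU] : exists U, is_vspan S U by rewrite /vspan; case: xgetP => [? -> //|/(_ U)].
pose P d := `[< exists X : seq V, {in X, forall w, S w} /\ \dim <<X>>%VS = d >].
have exP : exists d, P d.
  by exists (\dim <<[::] : seq V>>%VS); apply/asboolP; exists [::].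
have ubP d : P d -> (d <= \dim {:V})%N.
  by move=> /asboolP[X [_ <-]]; rewrite dimvS // subvf.
case: (ex_maxnP exP ubP) => d /asboolP[X [XS Xd]] dmax.
exists <<X>>%VS; split=> [w Sw|W SW]; last first.
  by apply/span_subvP => w wX; apply: SW; apply: XS.
have sub : (<<X>> <= <<w :: X>>)%VS by rewrite span_cons addvSr.
have le : (\dim <<w :: X>>%VS <= d)%N.
  by apply: dmax; apply/asboolP; exists (w :: X); split=> // u; rewrite inE => /orP[/eqP ->|/XS].
have /eqP -> : <<X>>%VS == <<w :: X>>%VS by rewrite eqEdim sub Xd.
by rewrite memv_span ?mem_head.
Qed.

Lemma mem_vspan_closed S w :
  S 0 -> (forall c u v, S u -> S v -> S (c *: u + v)) -> (w \in vspan S) <-> S w.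
Proof.
move=> S0 SD; have [Sin Smin] := vspan_least S; split; last exact: Sin.
pose P d := `[< exists W, (forall u, u \in W -> S u) /\ \dim W = d >].
have exP : exists d, P d.
  by exists 0%N; apply/asboolP; exists 0%VS; split=> [u|]; rewrite ?dimv0 // memv0 => /eqP ->.
have ubP d : P d -> (d <= \dim {:V})%N.
  by move=> /asboolP[X [_ <-]]; rewrite dimvS // subvf.
case: (ex_maxnP exP ubP) => d /asboolP[W [WS Wd]] dmax.
suff /Smin /subvP sW : forall u, S u -> u \in W by move=> /sW /WS.
move=> u Su.
have sub : (W <= <[u]> + W)%VS by rewrite addvSr.
have le : (\dim (<[u]> + W)%VS <= d)%N.
  apply: dmax; apply/asboolP; exists (<[u]> + W)%VS; split=> // v.
  by move=> /memv_addP[_ /vlineP[c ->] [y yW ->]]; apply: SD => //; apply: WS.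
have /eqP -> : W == (<[u]> + W)%VS by rewrite eqEdim sub Wd.
by rewrite memvE addvSl.
Qed.

(* U / (U :&: W).  The quotient is carried by the complement [U :\: W] of
   [U :&: W] in U; [quotv_pi] is the canonical projection on U
   ([quotv_pi_eq0], [quotv_pi_val]). *)
Definition quotv U W : vectType K := subvs_of (U :\: W)%VS.

Definition quotv_pi U W (w : V) : quotv U W :=
  vsproj (U :\: W)%VS (daddv_pi (U :\: W) W w).

Lemma quotv_piB U W u v : quotv_pi U W (u - v) = quotv_pi U W u - quotv_pi U W v.
Proof. by rewrite /quotv_pi !linearB. Qed.

Lemma quotv_pi_val U W (m : quotv U W) :
  vsval m \in U /\ quotv_pi U W (vsval m) = m.
Proof.
split; first by rewrite (subvP (diffvSl U W)) // subvsP.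
by rewrite /quotv_pi (daddv_pi_id (capv_diff U W) (subvsP m)) vsvalK.
Qed.

Lemma quotv_pi_eq0 U W w : w \in U -> (quotv_pi U W w == 0) = (w \in W).
Proof.
move=> wU; have dUW : ((U :\: W) :&: W = 0)%VS by exact: capv_diff.
have wUW : w \in (U :\: W + W)%VS.
  by rewrite addv_diff (subvP (addvSl U W)).
have E := daddv_pi_add dUW wUW.
apply/eqP/idP => [q0|wW].
  have : vsval (quotv_pi U W w) = 0 by rewrite q0.
  rewrite /quotv_pi vsprojK ?memv_pi // => p0.
  by rewrite -E p0 add0r memv_pi.
rewrite /quotv_pi; suff -> : daddv_pi (U :\: W) W w = 0 by rewrite linear0.
have dWU : (W :&: (U :\: W) = 0)%VS by rewrite capvC.
move: E; rewrite (daddv_pi_id dWU) // => /eqP.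
by rewrite -subr_eq0 addrK => /eqP.
Qed.

(* Index from which an increasing filtration of V by subspaces is constant. *)
Definition gr_len F := xget 0%N [set N | forall s, (N <= s)%N -> F s = F N].

Lemma gr_lenP F : (forall s, (F s <= F s.+1)%VS) ->
  forall s, (gr_len F <= s)%N -> F s = F (gr_len F).
Proof.
move=> Fmono.
suff [N HN] : exists N, forall s, (N <= s)%N -> F s = F N.
  by rewrite /gr_len; case: xgetP => [? -> //|/(_ N)].
have mono i j : (i <= j)%N -> (F i <= F j)%VS.
  by move=> /subnK <-; elim: (j - i)%N => // k IH; rewrite addSn (subv_trans IH).
pose P d := `[< exists s, \dim (F s) = d >].
have exP : exists d, P d by exists (\dim (F 0%N)); apply/asboolP; exists 0%N.
have ubP d : P d -> (d <= \dim {:V})%N.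
  by move=> /asboolP[s <-]; rewrite dimvS // subvf.
case: (ex_maxnP exP ubP) => d /asboolP[N Nd] dmax; exists N => s Ns.
apply/esym/eqP; rewrite eqEdim mono //= Nd; apply: dmax.
by apply/asboolP; exists s.
Qed.

End LinearAlgebra.

(* Families whose s-th member lies in G s. *)
Definition prodv (K : fieldType) (V : vectType K) N (G : 'I_N -> {vspace V}) :
    {vspace {ffun 'I_N -> V}} :=
  vspan [set w : {ffun 'I_N -> V} | forall s, w s \in G s].

Lemma mem_prodv (K : fieldType) (V : vectType K) N (G : 'I_N -> {vspace V})
    (w : {ffun 'I_N -> V}) :
  (w \in prodv G) <-> (forall s, w s \in G s).
Proof.
apply: mem_vspan_closed => [s|c u v Su Sv s]; first by rewrite ffunE mem0v.
by rewrite !ffunE memvD ?memvZ.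
Qed.

Section AssociatedGraded.
Variables (K : fieldType) (V : vectType K) (F : nat -> {vspace V}).

Definition gr_seq := {ffun 'I_(gr_len F).+1 -> V}.

(* The associated graded space
     \bigoplus_s F_s / F_{s-1} = (\bigoplus_s F_s) / (\bigoplus_s F_{s-1}),
   where F_{-1} = 0; the summands with s > gr_len F vanish. *)
Definition gr_num : {vspace gr_seq} := prodv (fun s : 'I_(gr_len F).+1 => F s).

Definition gr_den : {vspace gr_seq} :=
  prodv (fun s : 'I_(gr_len F).+1 =>
           if nat_of_ord s is s'.+1 then F s' else 0%VS).

Definition gr : vectType K := quotv gr_num gr_den.

Definition gr_pi (w : gr_seq) : gr := quotv_pi gr_num gr_den w.

(* The operator of degree d induced on the associated graded space by a linear
   map X with X F_s \subset F_{s+d}, computed on a representative; [gr_op_pi]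
   shows independence of the representative. *)
Definition gr_shift (d : nat) (X : V -> V) (w : gr_seq) : gr_seq :=
  [ffun s : 'I_(gr_len F).+1 => if (d <= s)%N then X (w (inord (s - d))) else 0].

Definition gr_op (d : nat) (X : V -> V) (m : gr) : gr :=
  gr_pi (gr_shift d X (vsval m)).

Lemma gr_op_pi (d : nat) (X : {linear V -> V}) (w : gr_seq) :
  (forall s v, v \in F s -> X v \in F (d + s)%N) -> w \in gr_num ->
  gr_op d X (gr_pi w) = gr_pi (gr_shift d X w).
Proof.
move=> XF wN; pose m := gr_pi w.
have [mN mE] := quotv_pi_val (m : quotv gr_num gr_den).
have /mem_prodv D : vsval m - w \in gr_den.
  rewrite -(@quotv_pi_eq0 _ _ gr_num) ?memvB //.
  by rewrite quotv_piB mE subrr.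
have inordE (s : 'I_(gr_len F).+1) : (inord (s - d) : 'I_(gr_len F).+1) = (s - d)%N :> nat.
  rewrite inordK //; exact: leq_ltn_trans (leq_subr _ _) (ltn_ord s).
apply/eqP; rewrite -subr_eq0; apply/eqP.
have -> : gr_op d X m - gr_pi (gr_shift d X w) =
    quotv_pi gr_num gr_den (gr_shift d X (vsval m) - gr_shift d X w).
  by rewrite quotv_piB.
have shN u : u \in gr_num -> gr_shift d X u \in gr_num.
  move=> /mem_prodv uN; apply/mem_prodv => s; rewrite ffunE.
  case: leqP => [ds|_]; last exact: mem0v.
  by have := XF _ _ (uN (inord (s - d))); rewrite inordE subnKC.
apply/eqP; rewrite quotv_pi_eq0; last by rewrite memvB ?shN.
apply/mem_prodv => s.
rewrite !ffunE; case: leqP => [ds|_]; last by rewrite subrr; case: (nat_of_ord s) => *; exact: mem0v.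
have := D (inord (s - d)); rewrite !ffunE inordE -linearB.
case sd: (s - d)%N => [|k]; first by rewrite memv0 => /eqP ->; rewrite linear0; case: (nat_of_ord s) => *; exact: mem0v.
by move=> /XF; rewrite -(subnKC ds) sd addnS.
Qed.

(* The class in F_0 of a vector of F_0. *)
Definition gr_class0 (v : V) : gr :=
  gr_pi [ffun s : 'I_(gr_len F).+1 => if s == ord0 then v else 0].

End AssociatedGraded.

Lemma det_mx2 (A : comNzRingType) (g : 'M[A]_2) :
  \det g = g 0 0 * g 1 1 - g 0 1 * g 1 0.
Proof.
rewrite (expand_det_row _ 0) !big_ord_recl big_ord0 /cofactor !det_mx11 !mxE /=.
rewrite addr0 expr0 mul1r expr1 mulN1r mulrN.
by congr (_ * g _ _ - g _ _ * g _ _); apply: val_inj.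
Qed.

Lemma mx2P (A : nzRingType) (g g' : 'M[A]_2) :
  [/\ g 0 0 = g' 0 0, g 0 1 = g' 0 1, g 1 0 = g' 1 0 & g 1 1 = g' 1 1] -> g = g'.
Proof.
case=> *; apply/matrixP => i j.
have E (k : 'I_2) : k = 0 \/ k = 1.
  by case: k => -[|[|//]] ?; [left|right]; apply: val_inj.
by case: (E i) => ->; case: (E j) => ->.
Qed.

Lemma transvE (A : comNzRingType) (p : A) (g : 'M[A]_2) (i j : 'I_2) k l :
  ((1%:M + p *: delta_mx i j) *m g) k l = g k l + (k == i)%:R * (p * g j l).
Proof.
rewrite mulmxDl mul1mx -scalemxAl !mxE (bigD1 j) //= big1 => [|m /negPf mj].
  by rewrite !mxE eqxx andbT addr0; case: eqP => _; rewrite ?(mul1r, mul0r, mulr0).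
by rewrite !mxE mj andbF mul0r.
Qed.

Lemma det_transv (A : comNzRingType) (p : A) (i j : 'I_2) : i != j ->
  \det (1%:M + p *: delta_mx i j) = 1.
Proof.
move=> ij; rewrite det_mx2 !mxE /=; move: ij.
have E (k : 'I_2) : k = 0 \/ k = 1.
  by case: k => -[|[|//]] ?; [left|right]; apply: val_inj.
by case: (E i) => ->; case: (E j) => -> //= _; ring.
Qed.

Lemma transv_factor (A : comNzRingType) (h : 'M[A]_2) (q : A) :
  h 1 0 * q = 1 -> \det h = 1 ->
  h = (1%:M + ((h 0 0 - 1) * q) *: delta_mx 0 1) *m
                ((1%:M + h 1 0 *: delta_mx 1 0) *m
                ((1%:M + ((h 1 1 - 1) * q) *: delta_mx 0 1) *m 1%:M)).
Proof.
rewrite det_mx2 => hq dh.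
have e : h 0 1 = q * (h 0 0 * h 1 1 - 1).
  by rewrite -{}dh opprB addrC subrK mulrCA [q * _]mulrC hq mulr1.
have hq' x : h 1 0 * (x * q) = x by rewrite mulrCA hq mulr1.
have hq2 x : (x * q) * h 1 0 = x by rewrite mulrC hq'.
apply: mx2P; rewrite !transvE !mxE /= !(mul0r, mul1r, mulr0, addr0, add0r, mulr1).
split; rewrite ?mulrDr ?mulr1 ?hq2 ?hq' //.
- by rewrite addrC subrK.
- rewrite e; ring.
- by rewrite addrC subrK.
Qed.

Lemma transv_cancel (A : comNzRingType) (g : 'M[A]_2) :
  g = (1%:M + (-1) *: delta_mx 1 0) *m ((1%:M + 1 *: delta_mx 1 0) *m g).
Proof. by apply: mx2P; rewrite !transvE /=; split; ring. Qed.

Section Fusion.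
Variable K : fieldType.

(* The Lie algebra sl_2 consists of the 2 x 2 matrices of trace zero. *)
Definition sl2_e : 'M[K]_2 := delta_mx 0 1.
Definition sl2_f : 'M[K]_2 := delta_mx 1 0.

(* The a-dimensional irreducible module, in the basis u_0, ..., u_(a-1) with
     e u_k = u_(k+1),  h u_k = (2k - a + 1) u_k,  f u_k = k (a - k) u_(k-1);
   the lowest weight vector is u_0.  Matrices act on column vectors. *)
Definition irr_e a : 'M[K]_a := \matrix_(k, l) (k == l.+1 :> nat)%:R.
Definition irr_h a : 'M[K]_a :=
  \matrix_(k, l) (((2 * l + 1)%:R - a%:R) *+ (k == l)).
Definition irr_f a : 'M[K]_a :=
  \matrix_(k, l) ((l * (a - l))%:R *+ (k.+1 == l :> nat)).

Definition irr a (x : 'M[K]_2) : 'M[K]_a :=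
  x 0 1 *: irr_e a + x 0 0 *: irr_h a + x 1 0 *: irr_f a.

Lemma sum_ord_eq a (F : nat -> K) j :
  \sum_(m < a) F m *+ (m == j :> nat) = F j *+ (j < a).
Proof.
case: ltnP => [ja|aj].
  rewrite (bigD1 (Ordinal ja)) //= eqxx big1 ?addr0 // => i /eqP ij.
  by case: eqP => // E; case: ij; apply: val_inj.
rewrite big1 ?mulr0n // => i _; case: eqP => // ij.
by have := ltn_ord i; rewrite ij ltnNge aj.
Qed.

Lemma irr_ef a : irr_e a *m irr_f a - irr_f a *m irr_e a = irr_h a.
Proof.
apply/matrixP => k l; rewrite !mxE.
under eq_bigr => m _ do rewrite !mxE.
under [X in _ - X]eq_bigr => m _ do rewrite !mxE mulr_natr.
rewrite [X in _ - X](_ : _ = (l.+1 * (a - l.+1))%:R *+ (k == l)); last first.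
  pose F (m : nat) : K := (m * (a - m))%:R *+ (k.+1 == m).
  rewrite (@sum_ord_eq a F l.+1) /F eqSS.
  by case: ltnP => [//|la]; rewrite (eqP la) muln0 mul0rn.
rewrite (_ : \sum_(m < a) _ = (l * (a - l))%:R *+ (k == l)); last first.
  case: (posnP k) => [k0|kp].
    rewrite big1 => [|m _]; last by rewrite k0 mul0r.
    case: eqP => // kl; by rewrite -kl k0 mul0n.
  pose F (m : nat) : K := (l * (a - l))%:R *+ (m.+1 == l).
  rewrite (eq_bigr (fun m : 'I_a => F m *+ (m == k.-1 :> nat))); last first.
    move=> m _; rewrite /F mulrC mulr_natr; congr (_ *+ nat_of_bool _).
    by rewrite -{1}(prednK kp) eqSS eq_sym.
  by rewrite sum_ord_eq /F prednK // (ltnW (ltn_ord k)).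
case: eqP => [_|_]; last by rewrite !mulr0n subr0.
rewrite !mulr1n.
have la := ltn_ord l.
rewrite [(2 * l + 1)%:R]natrD !natrM !natrB ?(ltnW la) // -[l.+1%:R]natr1; ring.
Qed.

Lemma irr_he a : irr_h a *m irr_e a - irr_e a *m irr_h a = 2 *: irr_e a.
Proof.
apply/matrixP => k l; rewrite !mxE.
under eq_bigr => m _ do rewrite !mxE.
under [X in _ - X]eq_bigr => m _ do rewrite !mxE.
rewrite (bigD1 k) //= big1 => [|m /negPf mk]; last by rewrite eq_sym mk mul0r.
rewrite (bigD1 l) //= big1 => [|m /negPf mk]; last by rewrite mk mulr0.
rewrite !eqxx !mulr1n !addr0; case: eqP => [->|_]; last by rewrite !(mulr0, mul0r) subr0.
by rewrite !natrD !natrM -[l.+1%:R]natr1; ring.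
Qed.

Lemma irr_hf a : irr_h a *m irr_f a - irr_f a *m irr_h a = - 2 *: irr_f a.
Proof.
apply/matrixP => k l; rewrite !mxE.
under eq_bigr => m _ do rewrite !mxE.
under [X in _ - X]eq_bigr => m _ do rewrite !mxE.
rewrite (bigD1 k) //= big1 => [|m /negPf mk]; last by rewrite eq_sym mk mul0r.
rewrite (bigD1 l) //= big1 => [|m /negPf mk]; last by rewrite mk mulr0.
rewrite !eqxx !mulr1n !addr0; case: eqP => [<-|_]; last by rewrite !(mulr0, mul0r) subr0.
by rewrite !natrD !natrM -[k.+1%:R]natr1; ring.
Qed.

Lemma irr_bracket a (x y : 'M[K]_2) : \tr x = 0 -> \tr y = 0 ->
  irr a (x *m y - y *m x) = irr a x *m irr a y - irr a y *m irr a x.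
Proof.
rewrite /mxtrace !big_ord_recl !big_ord0 !addr0 => /eqP + /eqP.
have -> : lift ord0 ord0 = 1 :> 'I_2 by apply: val_inj.
rewrite addrC addr_eq0 => /eqP x1; rewrite addrC addr_eq0 => /eqP y1.
rewrite /irr !mxE !big_ord_recl !big_ord0 !addr0.
have -> : lift ord0 ord0 = 1 :> 'I_2 by apply: val_inj.
rewrite x1 y1.
have E1 := irr_ef a; have E2 := irr_he a; have E3 := irr_hf a.
move: E1 E2 E3.
set e := irr_e a; set f := irr_f a; set h := irr_h a => /esym E1 E2 E3.
rewrite !(mulmxDl, mulmxDr) -!(scalemxAl, scalemxAr) !scalerA.
apply/matrixP => k l.
have {E1} F1 : h k l = (e *m f) k l - (f *m e) k l by rewrite {1}E1 !mxE.
have {E2} F2 : (h *m e) k l = (e *m h) k l + 2 * e k l.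
  by have /matrixP/(_ k l) := E2; rewrite !mxE => <-; ring.
have {E3} F3 : (h *m f) k l = (f *m h) k l - 2 * f k l.
  by have /matrixP/(_ k l) := E3; rewrite !mxE => H; rewrite mulNr in H; move/eqP: H; rewrite subr_eq => /eqP ->; ring.
have AE (A B : 'M[K]_a) : (A + B) k l = A k l + B k l by rewrite mxE.
have NE (A : 'M[K]_a) : (- A) k l = - A k l by rewrite mxE.
have SE c (A : 'M[K]_a) : (c *: A) k l = c * A k l by rewrite mxE.
rewrite !(AE, NE, SE) (_ : ord0 = 0) //.
rewrite F1 F2 F3; ring.
Qed.

Variables (n : nat) (a : 'I_n -> nat) (z : 'I_n -> K).

(* The tensor product of the C^{a_i}: coordinates in the basis
   u_{m_1} \otimes ... \otimes u_{m_n}. *)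
Definition tidx : finType := {dffun forall i : 'I_n, 'I_(a i)}.
Definition tens : vectType K := {ffun tidx -> K^o}.

(* B acting on the i-th tensor factor. *)
Definition tens_op (i : 'I_n) (B : 'M[K]_(a i)) (w : tens) : tens :=
  [ffun m : tidx => \sum_l B (m i) l * w (finfun (dfwith m i l) : tidx)].

(* x_j = x \otimes t^j on \bigotimes_i C^{a_i}(z_i) *)
Definition tens_act (x : 'M[K]_2) (j : nat) (w : tens) : tens :=
  \sum_i z i ^+ j *: tens_op (irr (a i) x) w.

(* u_0 \otimes ... \otimes u_0 *)
Definition tens_low : tens := [ffun m : tidx => [forall i, m i == 0%N :> nat]%:R].

Definition filt (s : nat) : {vspace tens} :=
  vspan [set w | exists2 l : seq ('M[K]_2 * nat),
           (forall xi, xi \in l -> \tr xi.1 = 0) /\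
           (\sum_(xi <- l) xi.2 <= s)%N
         & w = foldr (fun xi => tens_act xi.1 xi.2) tens_low l].

Lemma filt_mono s : (filt s <= filt s.+1)%VS.
Proof.
have [_] := vspan_least [set w | exists2 l : seq ('M[K]_2 * nat),
           (forall xi, xi \in l -> \tr xi.1 = 0) /\
           (\sum_(xi <- l) xi.2 <= s)%N
         & w = foldr (fun xi => tens_act xi.1 xi.2) tens_low l].
apply=> w [l [ltr ls] ->].
have [+ _] := vspan_least [set w | exists2 l : seq ('M[K]_2 * nat),
           (forall xi, xi \in l -> \tr xi.1 = 0) /\
           (\sum_(xi <- l) xi.2 <= s.+1)%N
         & w = foldr (fun xi => tens_act xi.1 xi.2) tens_low l].
by apply; exists l => //; split=> //; apply: leqW.
Qed.

Definition fusion : vectType K := gr filt.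

Definition fusion_low : fusion := gr_class0 filt tens_low.

Definition fusion_act (x : 'M[K]_2) (j : nat) : fusion -> fusion :=
  gr_op (F := filt) j (tens_act x j).

(* x \otimes p, for p in K[t]/t^n *)
Definition fusion_cur (x : 'M[K]_2) (p : {poly %/ 'X^n : {poly K}})
    (m : fusion) : fusion :=
  \sum_(j < n) (p : {poly K})`_j *: fusion_act x j m.

(* The exponential of a nilpotent endomorphism. *)
Definition exp_nilp (W : vectType K) (X : W -> W) (w : W) : W :=
  \sum_(k < (\dim {:W}).+1) (k`!%:R)^-1 *: iter k X w.

(* The graph of the action of SL_2(K[t]/t^n) on the fusion product: the
   elementary matrices exp(e \otimes p) = 1 + p E_{01} and
   exp(f \otimes p) = 1 + p E_{10}, which generate the group
   ([SL2_act_det], [SL2_act_total]), act by the exponentials of the (nilpotent)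
   operators e \otimes p and f \otimes p.  For n = 0 the library reads
   {poly %/ 'X^0} as K; all these operators are then 0. *)
Inductive SL2_act :
    'M[{poly %/ 'X^n : {poly K}}]_2 -> (fusion -> fusion) -> Prop :=
| SL2_act1 : SL2_act 1%:M id
| SL2_actE p g T : SL2_act g T ->
    SL2_act ((1%:M + p *: delta_mx 0 1) *m g)
            (exp_nilp (fusion_cur sl2_e p) \o T)
| SL2_actF p g T : SL2_act g T ->
    SL2_act ((1%:M + p *: delta_mx 1 0) *m g)
            (exp_nilp (fusion_cur sl2_f p) \o T).

Lemma SL2_act_det g T : SL2_act g T -> \det g = 1.
Proof.
elim=> {g T} [|p g T _ gd|p g T _ gd]; first by rewrite det1.
  by rewrite det_mulmx gd mulr1 det_transv.
by rewrite det_mulmx gd mulr1 det_transv.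
Qed.

Lemma trunc_unit (p : {poly %/ 'X^n : {poly K}}) : ~~ root (p : {poly K}) 0 -> exists q : {poly %/ 'X^n : {poly K}}, p * q = 1.
Proof.
have cop (r : {poly K}) : ~~ root r 0 -> coprimep (mk_monic 'X^n) r.
  by rewrite mk_monic_Xn coprimep_pexpl // coprimep_sym coprimepX.
by move=> /cop p0; exists (qpoly_inv p); rewrite mulrC; apply: qpoly_mulVz.
Qed.

Lemma trunc_horner0M (p q : {poly %/ 'X^n : {poly K}}) :
  ((p * q : {poly %/ 'X^n : {poly K}}) : {poly K}).[0] = (p : {poly K}).[0] * (q : {poly K}).[0].
Proof.
rewrite poly_of_qpolyM -hornerM [in RHS](divp_eq (_ * _) (mk_monic 'X^n)).
have h0 : (mk_monic 'X^n : {poly K}).[0] = 0 by rewrite mk_monic_Xn hornerXn expr0n.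
by rewrite hornerD hornerM h0 mulr0 add0r Pdiv.IdomainMonic.modpE ?monic_mk_monic.
Qed.

Lemma SL2_act_total (g : 'M[{poly %/ 'X^n : {poly K}}]_2) : \det g = 1 ->
  exists T, SL2_act g T.
Proof.
have EE p h : (exists T, SL2_act h T) ->
    exists T, SL2_act ((1%:M + p *: delta_mx 0 1) *m h) T.
  by case=> T hT; exists (exp_nilp (fusion_cur sl2_e p) \o T); exact: SL2_actE.
have EF p h : (exists T, SL2_act h T) ->
    exists T, SL2_act ((1%:M + p *: delta_mx 1 0) *m h) T.
  by case=> T hT; exists (exp_nilp (fusion_cur sl2_f p) \o T); exact: SL2_actF.
have E1 : exists T, SL2_act 1%:M T by exists id; exact: SL2_act1.
have unit_case (h : 'M[{poly %/ 'X^n : {poly K}}]_2) : ~~ root (h 1 0 : {poly K}) 0 -> \det h = 1 ->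
    exists T, SL2_act h T.
  move=> /trunc_unit[q hq] dh.
  rewrite (transv_factor hq dh).
  by apply/EE/EF/EE.
move=> dg; case: (boolP (root (g 1 0 : {poly K}) 0)) => [r10|]; last first.
  by move/unit_case; apply.
have r00 : ~~ root (g 0 0 : {poly K}) 0.
  apply/negP => r00; move: dg; rewrite det_mx2 => /(congr1 (fun p : {poly %/ 'X^n : {poly K}} => (p : {poly K}).[0])).
  rewrite poly_of_qpolyD hornerD trunc_horner0M (eqP r00) mul0r add0r.
  rewrite -mulNr trunc_horner0M mulrC (eqP r10) mul0r /= hornerC => /eqP.
  by rewrite eq_sym oner_eq0.
suff H : exists T, SL2_act ((1%:M + 1 *: delta_mx 1 0) *m g) T.
  have H2 := EF (-1) _ H.
  rewrite (transv_cancel g).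
  exact: H2.
apply: unit_case.
  rewrite transvE eqxx !mul1r; move: r10; rewrite /root poly_of_qpolyD hornerD => /eqP ->.
  by rewrite add0r.
by rewrite det_mulmx dg mulr1 det_transv.
Qed.

End Fusion.

Section ProjectiveSpace.
Variables (K : numFieldType) (V : vectType K).

(* P(V), the set of lines of V. *)
Definition proj := {L : {vspace V} | \dim L == 1%N}.

HB.instance Definition _ := Choice.on proj.

(* The vector with given coordinates in a fixed basis of V. *)
Definition vec (x : 'rV[K]_(\dim {:V})) : V := passmx.vecof (vbasis {:V}) x.

(* The nonzero vectors, in coordinates, on the lines of O. *)
Definition cone (O : set proj) : set 'rV[K]_(\dim {:V}) :=
  [set x | x != 0 /\ exists2 L, O L & val L = <[vec x]>%VS].

(* The quotient topology from V \ {0}. *)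
Definition proj_open (O : set proj) := open (cone O).

Lemma vec_neq0 (x : 'rV[K]_(\dim {:V})) : x != 0 -> vec x != 0.
Proof.
move=> x0; apply: contra_neq x0 => vx0.
rewrite -(passmx.vecofK (vbasisP {:V}) x) -/(vec x) vx0.
by apply/rowP => i; rewrite !mxE linear0.
Qed.

Lemma proj_openT : proj_open setT.
Proof.
rewrite /proj_open (_ : cone _ = ~` [set 0]).
  exact/closed_openC/accessible_closed_set1/hausdorff_accessible/norm_hausdorff.
apply/seteqP; split=> x /=; first by case=> /eqP.
move=> /eqP x0; split=> //.
have dx : \dim <[vec x]> == 1%N by rewrite dim_vline vec_neq0.
by exists (exist (fun L : {vspace V} => is_true (\dim L == 1%N)) _ dx).
Qed.

Lemma proj_openI : setI_closed proj_open.
Proof.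
move=> A B oA oB; rewrite /proj_open (_ : cone _ = cone A `&` cone B).
  exact: openI.
apply/seteqP; split=> x /=.
  by case=> x0 [L [AL BL] Lx]; split; split=> //; exists L.
case=> -[x0 [L AL Lx]] [_ [M BM Mx]]; split=> //; exists L => //; split=> //.
by rewrite (_ : L = M) //; apply: val_inj; rewrite /= Lx Mx.
Qed.

Lemma proj_open_bigU (J : Type) (f : J -> set proj) :
  (forall i, proj_open (f i)) -> proj_open (\bigcup_i f i).
Proof.
move=> fo; rewrite /proj_open (_ : cone _ = \bigcup_i cone (f i)).
  by apply: bigcup_open => i _; exact: fo.
apply/seteqP; split=> x /=.
  case=> x0 [L [i _ fL] Lx]; exists i => //.
  split; first exact: x0.
  by exists L.
by case=> i _ [x0 [L fL Lx]]; split=> //; exists L => //; exists i.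
Qed.

HB.instance Definition _ :=
  isOpenTopological.Build proj proj_openT proj_openI proj_open_bigU.

(* The image of D under u |-> [phi u], phi being given in coordinates. *)
Definition proj_img d (phi : 'rV[K]_d -> 'rV[K]_(\dim {:V})) (D : set 'rV[K]_d) :
    set proj :=
  [set L | exists2 u, D u & val L = <[vec (phi u)]>%VS].

(* X is an embedded submanifold of P(V) of dimension d over K (a complex
   submanifold when K is the field of complex numbers): near each of its points
   it is parametrized by a map u |-> [phi u], with phi holomorphic and without
   zeros on an open subset D of K^d, which is an immersion (the tangent map of
   v |-> [v] at phi u has kernel the line of phi u) and a homeomorphism onto an
   open subset of X. *)
Definition submanifold (d : nat) (X : set proj) : Prop :=
  forall L, X L ->
  exists (D : set 'rV[K]_d) (phi : 'rV[K]_d -> 'rV[K]_(\dim {:V})),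
    [/\ open D /\ proj_img phi D L,
        forall u, D u -> phi u != 0 /\ differentiable phi u,
        forall u h, D u -> 'd phi u h \in <[phi u]>%VS -> h = 0,
        forall u v, D u -> D v -> <[phi u]>%VS = <[phi v]>%VS -> u = v
      & forall D', open D' -> D' `<=` D ->
          exists2 O : set proj, open O & proj_img phi D' = X `&` O].

End ProjectiveSpace.

(* The closure of the orbit of [v_A], in the topology of P(M^A) coming from K;
   over the complex numbers it is also the Zariski closure, the orbit being
   constructible. *)
Definition sh (K : numFieldType) n (a : 'I_n -> nat) (z : 'I_n -> K) :
    set (proj (fusion a z)) :=
  closure [set L : proj (fusion a z) | exists g T, SL2_act g T /\
                     val L = <[T (fusion_low a z)]>%VS].

Arguments sh {K n} a z.

(* Main.v *)
Require Import Defs.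
From HB Require Import structures.
From mathcomp Require Import all_boot all_order all_fingroup all_algebra.
From mathcomp Require Import qpoly ring lra zify.
From mathcomp Require Import all_classical all_reals all_analysis.
Import numFieldNormedType.Exports.

(* For x = x_0 + x_1 t + ..., which only matters modulo t^n, the lines of the
   vectors exp(x_0 e_0 + x_1 e_1 + ...) v_A form a dense cell of the orbit
   closure.  The element x can be coded by u in K^n in 2^n ways: either
   x = u_0 + t x' or x = - 1 / (u_0 + t x'), and x' is coded in the same way
   modulo t^(n - 1).  Since x' |-> t x' extends to a linear embedding of
   the fusion product of (a_1, ..., a_(n-1)) into that of A, and - 1 / x is the
   action of the Weyl group element, each code gives, up to a scalar, a
   polynomial map from K^n to M^A.  Every x has a code with all |u_i| <= 1, so by
   compactness of the unit disc the 2^n maps cover the orbit closure.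
   As the a_i are distinct and greater than 1, for each m <= n there is an r such
   that exactly m of the a_i exceed r + 1.  A Vandermonde determinant on those
   factors shows that the product over r of the minors of size
   #{i : a_i > r + 1} of the coefficients of p_(r,i)(x), where
   p_(r,i)(x) = r_(r,i) - x q_(r,i), is a linear functional on M^A.  Choosing the
   polynomials dual to u yields functionals in which u_0, u_1, ... can be read off
   successively; so the maps are immersions and homeomorphisms onto open subsets. *)

Set Implicit Arguments.
Unset Strict Implicit.
Unset Printing Implicit Defensive.

Import Order.TTheory GRing.Theory Num.Theory.
Local Open Scope ring_scope.

(** The obstacle is that M^A is an associated graded space, so a linear map out of it must respect
    relations that are hard to handle. All computations therefore take place in the tensor product
    over K[s], with t acting on the i-th factor as s z_i. The sums of w_d s^d with w_d in F_d form
    the Rees module, whose quotient by s is M^A, and there exponentials are products of formulas for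
    the single factors. Maps are found by duality: a functional on the tensor product, polynomial in
    s, whose values on all exponential vectors are divisible by s^d induces a functional on M^A. The
    embedding and the minors both arise in this way. An index i belongs to the set of those with a_i
    > r + 1 for exactly a_i - 1 values of r, and a_i - 1 is the highest power of the i-th variable
    among the coordinates; so the product of minors just fits. The same count matches the scalars
    acquired at each passage to - 1 / x. The charts are polynomial in u, but x exists only where the
    expressions to be inverted are units; identities are proved for u without zero coordinates and
    extended by continuity. *)

Lemma deriv_prod_seq (R : comNzRingType) (I : eqType) (r : seq I) (G : I -> {poly R}) :
  uniq r ->
  (\prod_(i <- r) G i)^`() = \sum_(i <- r) (G i)^`() * \prod_(j <- r | j != i) G j.
Proof.
elim: r => [|x r IH] /=; first by rewrite !big_nil derivC.
case/andP=> xr /IH {}IH; rewrite !big_cons eqxx /= derivM IH; congr (_ * _ + _).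
  rewrite [in RHS]big_seq_cond [in LHS]big_seq_cond; apply: eq_bigl => j.
  by case jr: (j \in r) => //=; case: eqP jr => // ->; rewrite (negPf xr).
rewrite mulr_sumr; apply: eq_big_seq => i ir.
rewrite big_cons; case: eqP => [xi|_]; first by rewrite xi ir in xr.
by rewrite mulrCA.
Qed.

Lemma deriv_prod (R : comNzRingType) (I : finType) (G : I -> {poly R}) :
  (\prod_i G i)^`() = \sum_i (G i)^`() * \prod_(j | j != i) G j.
Proof. by rewrite deriv_prod_seq // index_enum_uniq. Qed.

(** * Exponentials of raising and lowering operators *)

Section TensorUpdate.
Variables (n : nat) (a : 'I_n -> nat).

Definition upd (m : tidx a) i (l : 'I_(a i)) : tidx a := finfun (dfwith m i l).

Lemma upd_in (m : tidx a) i (l : 'I_(a i)) : upd m l i = l.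
Proof. by rewrite ffunE dfwithin. Qed.

Lemma upd_out (m : tidx a) i (l : 'I_(a i)) j : j != i -> upd m l j = m j.
Proof. by move=> ij; rewrite ffunE dfwithout // eq_sym. Qed.

Lemma prod_upd (R : comNzRingType) (G : forall i, 'I_(a i) -> R) (m : tidx a) i
    (l : 'I_(a i)) :
  \prod_j G j (upd m l j) = G i l * \prod_(j | j != i) G j (m j).
Proof.
rewrite (bigD1 i) //= upd_in; congr (_ * _).
by apply: eq_bigr => j /(upd_out m l) ->.
Qed.

End TensorUpdate.

Section PolyTensor.
Variables (K : fieldType) (n : nat) (a : 'I_n -> nat).
Implicit Types (x : 'M[K]_2) (X Y : 'I_n -> {poly K}) (w : tidx a -> {poly K}).

(* \sum_i Y_i x^(i) on the tensor product, with scalars extended to K[s]. *)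
Definition pact x Y w : tidx a -> {poly K} :=
  fun m => \sum_i Y i * \sum_l (irr (a i) x (m i) l)%:P * w (upd m l).

(* A generating function W of t satisfying W' = Y.W is exp(t Y) W(0). *)
Lemma iter_pact_deriv x Y (W : tidx a -> {poly {poly K}}) :
  (forall m, (W m)^`() =
     \sum_i (Y i)%:P * \sum_l (irr (a i) x (m i) l)%:P%:P * W (upd m l)) ->
  forall k m, iter k (pact x Y) (fun m => (W m)`_0) m = (W m)`_k *+ k`!.
Proof.
move=> dW; elim=> [|k IH] m //=.
have -> : (W m)`_k.+1 *+ (k.+1)`! = ((W m)^`())`_k *+ k`!.
  by rewrite coef_deriv -mulrnA factS.
rewrite dW coef_sum -sumrMnl; apply: eq_bigr => i _.
rewrite coefCM -mulrnAr; congr (_ * _); rewrite coef_sum -sumrMnl; apply: eq_bigr => l _.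
by rewrite coefCM IH mulrnAr.
Qed.

(** By the Leibniz rule a product of solutions, one for each tensor factor, solves the differential
    equation on the tensor product; what remains is a computation in a single C^a. *)
Lemma iter_pact_prod x Y w (G : forall i, 'I_(a i) -> {poly {poly K}}) :
  (forall i k, (G i k)^`() = (Y i)%:P * \sum_l (irr (a i) x k l)%:P%:P * G i l) ->
  (forall m, w m = (\prod_i G i (m i))`_0) ->
  forall k m, iter k (pact x Y) w m = (\prod_i G i (m i))`_k *+ k`!.
Proof.
move=> dG w0 k m; have -> : w = fun m => (\prod_i G i (m i))`_0 by apply/funext.
apply: (@iter_pact_deriv _ _ (fun m => \prod_i G i (m i))) => {}m.
rewrite deriv_prod; apply: eq_bigr => i _; rewrite dG -mulrA; congr (_ * _).
by rewrite mulr_suml; apply: eq_bigr => l _; rewrite (prod_upd G) mulrA.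
Qed.

Lemma irr_sl2_e b : irr b (sl2_e K) = irr_e K b.
Proof. by rewrite /irr !mxE /= scale1r !scale0r !addr0. Qed.

Lemma irr_sl2_f b : irr b (sl2_f K) = irr_f K b.
Proof. by rewrite /irr !mxE /= scale1r !scale0r !add0r. Qed.

Lemma sum_irr_e (R : comNzRingType) (c : {rmorphism K -> R}) b (k : 'I_b) (F : 'I_b -> R) (v : R) :
  (forall l : 'I_b, k = l.+1 :> nat -> F l = v) -> (k = 0%N :> nat -> v = 0) ->
  \sum_l c (irr_e K b k l) * F l = v.
Proof.
move=> Fv v0; case: (posnP k) => [k0|kp].
  rewrite v0 // big1 // => l _; rewrite mxE k0 rmorph0 mul0r //.
have kb : (k.-1 < b)%N by rewrite (leq_ltn_trans (leq_pred _)).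
rewrite (bigD1 (Ordinal kb)) //= big1 => [|l /eqP lk].
  by rewrite mxE /= prednK // eqxx rmorph1 mul1r addr0 Fv //= prednK.
rewrite mxE; case: eqP => [kl|]; last by rewrite ?mulr0n rmorph0 mul0r.
by case: lk; apply: val_inj; rewrite /= kl.
Qed.

Lemma sum_irr_f (R : comNzRingType) (c : {rmorphism K -> R}) b (k : 'I_b) (F : 'I_b -> R) (v : R) :
  (forall l : 'I_b, l = k.+1 :> nat -> (l * (b - l))%:R * F l = v) ->
  (k.+1 = b :> nat -> v = 0) ->
  \sum_l c (irr_f K b k l) * F l = v.
Proof.
move=> Fv v0; have := ltn_ord k; rewrite leq_eqVlt => /orP[/eqP kb|kb].
  rewrite v0 // big1 // => l _; rewrite mxE; case: eqP => [kl|]; last by rewrite ?mulr0n rmorph0 mul0r.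
  by have := ltn_ord l; rewrite -kl kb ltnn.
rewrite (bigD1 (Ordinal kb)) //= big1 => [|l /eqP lk].
  by rewrite mxE /= eqxx mulr1n rmorph_nat addr0 (Fv (Ordinal kb)).
rewrite mxE; case: eqP => [kl|]; last by rewrite mulr0n rmorph0 mul0r.
by case: lk; apply: val_inj; rewrite /= kl.
Qed.

End PolyTensor.

Section Eh.
Variables (K : numFieldType) (n : nat) (a : 'I_n -> nat).
Implicit Types (X Y P : 'I_n -> {poly K}).

(* Coordinates of exp(\sum_i X_i e^(i)) v, with e^(i) acting on the i-th factor
   and v the tensor product of lowest weight vectors. *)
Definition Eh X : tidx a -> {poly K} :=
  fun m => \prod_i ((m i)`!%:R^-1)%:P * \prod_i X i ^+ m i.

Lemma invfactS k : (k.+1`!%:R^-1 : K) *+ k.+1 = k`!%:R^-1.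
Proof.
rewrite -[LHS]mulr_natr factS natrM invfM mulrAC mulVf ?mul1r //.
Qed.

(* The coefficient of t^k in exp(X + t Y). *)
Lemma iter_pact_e X Y k m :
  iter k (pact (sl2_e K) Y) (Eh X) m =
  (\prod_i ((m i)`!%:R^-1)%:P%:P * \prod_i ((X i)%:P + (Y i)%:P * 'X) ^+ m i)`_k *+ k`!.
Proof.
pose G i (k : 'I_(a i)) : {poly {poly K}} :=
  ((k`!%:R^-1)%:P)%:P * ((X i)%:P + (Y i)%:P * 'X) ^+ k.
rewrite (@iter_pact_prod _ _ _ (sl2_e K) Y _ G); first by rewrite /G big_split.
  move=> i l; rewrite irr_sl2_e {1}/G.
  set Z := (X i)%:P + _.
  have dZ : Z^`() = (Y i)%:P.
    by rewrite derivD derivC add0r derivM derivC derivX mul0r add0r mulr1.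
  rewrite (@sum_irr_e _ _ (polyC \o polyC) _ l _ (((l`!%:R^-1)%:P)%:P * Z ^+ l.-1 *+ l)).
  - rewrite derivM derivC mul0r add0r deriv_exp dZ.
    by rewrite -!mulrnAr mulrCA.
  - by move=> l' ->; rewrite /G /= -/Z -mulrnAl -invfactS !polyCMn.
  - by move->; rewrite mulr0n.
move=> m'; rewrite /Eh /G -big_split coef0_prod /=; apply: eq_bigr => i _.
by rewrite coef0M coefC -!horner_coef0 horner_exp !hornerE.
Qed.

(* The coefficient of t^k in exp(t f_P) exp(e_X), from
   exp(f) exp(x e) u_0 = (1 + x)^(a - 1) exp(x / (1 + x) e) u_0. *)
Lemma iter_pact_f X P k m :
  iter k (pact (sl2_f K) P) (Eh X) m =
  (\prod_i (((m i)`!%:R^-1)%:P%:P * (X i)%:P ^+ m i) *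
   \prod_i (1 + (P i * X i)%:P * 'X) ^+ (a i - 1 - m i))`_k *+ k`!.
Proof.
pose G i (k : 'I_(a i)) : {poly {poly K}} :=
  ((k`!%:R^-1)%:P)%:P * (X i)%:P ^+ k * (1 + (P i * X i)%:P * 'X) ^+ (a i - 1 - k).
rewrite (@iter_pact_prod _ _ _ (sl2_f K) P _ G); first by rewrite /G big_split.
  move=> i l; rewrite irr_sl2_f {1}/G.
  set Z := 1 + _.
  have dZ : Z^`() = (P i * X i)%:P.
    by rewrite derivD derivC add0r derivM derivC derivX mul0r add0r mulr1.
  rewrite (@sum_irr_f _ _ (polyC \o polyC) _ l _
     (((l`!%:R^-1)%:P)%:P * (X i)%:P ^+ l * (X i)%:P * (Z ^+ (a i - 1 - l).-1 *+ (a i - 1 - l)))).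
  - rewrite derivM -polyC_exp -polyCM derivC mul0r add0r deriv_exp dZ polyCM polyC_exp.
    rewrite polyCM -!mulrnAr; ring.
  - move=> l' El; rewrite /G /= -/Z El -[in RHS]invfactS exprS.
    have -> : (a i - 1 - l = a i - l.+1)%N by rewrite -subnDA.
    have -> : (a i - 1 - l.+1 = (a i - l.+1).-1)%N by rewrite subnS -subnDA.
    by rewrite -[_ *+ l.+1]mulr_natr -[_ *+ (a i - _)]mulr_natr natrM !polyCM !rmorph_nat; ring.
  - by move=> E; rewrite (_ : a i - 1 - l = 0)%N ?mulr0n ?mulr0 //; lia.
move=> m'; rewrite /Eh /G -big_split coef0_prod /=; apply: eq_bigr => i _.
by rewrite !coef0M coefC -!horner_coef0 !horner_exp !hornerE expr1n mulr1.
Qed.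

End Eh.

(** * The Rees module of the filtration and its reduction modulo s *)

Section Filtration.
Variables (K : fieldType) (n : nat) (a : 'I_n -> nat) (z : 'I_n -> K).

Lemma tens_op_linear i B : linear (@tens_op K n a i B).
Proof.
move=> c u v; apply/ffunP => m; rewrite !ffunE scaler_sumr -big_split /=.
by apply: eq_bigr => l _; rewrite !ffunE mulrDr !mulrA /= [_ * c]mulrC /GRing.scale /= !mulrA.
Qed.

Lemma tens_act_linear x j : linear (@tens_act K n a z x j).
Proof.
move=> c u v; rewrite /tens_act scaler_sumr -big_split /=; apply: eq_bigr => i _.
by rewrite tens_op_linear scalerDr !scalerA mulrC.
Qed.

HB.instance Definition _ x j :=
  GRing.isLinear.Build K (tens K a) (tens K a) *:%R (@tens_act K n a z x j)
    (tens_act_linear x j).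

Lemma filt_le s s' : (s <= s')%N -> (filt a z s <= filt a z s')%VS.
Proof.
move=> /subnK <-; elim: (s' - s)%N => // k IH.
by rewrite addSn; apply: subv_trans IH (filt_mono _ _ _).
Qed.

Lemma filt_ind s (V : vectType K) (f : {linear tens K a -> V}) (U : {vspace V}) :
  (forall l : seq ('M[K]_2 * nat), (forall xi, xi \in l -> \tr xi.1 = 0) ->
     (\sum_(xi <- l) xi.2 <= s)%N ->
     f (foldr (fun xi => tens_act z xi.1 xi.2) (tens_low K a) l) \in U) ->
  forall w, w \in filt a z s -> f w \in U.
Proof.
move=> fU w ws.
suff /subvP/(_ _ ws) : (filt a z s <= linfun f @^-1: U)%VS.
  by rewrite -memv_preim lfunE.
apply: (vspan_least _).2 => _ [l [ltr ls] ->].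
by rewrite -memv_preim lfunE; apply: fU.
Qed.

Lemma tens_act_filt x j s w : \tr x = 0 ->
  w \in filt a z s -> tens_act z x j w \in filt a z (j + s).
Proof.
move=> trx; move: w; apply: filt_ind => l ltr ls.
apply: (vspan_least _).1; exists ((x, j) :: l); last by [].
by split=> [xi|]; [rewrite inE => /orP[/eqP -> //|/ltr] | rewrite big_cons leq_add2l].
Qed.

Lemma tens_low_filt s : tens_low K a \in filt a z s.
Proof. by apply: (vspan_least _).1; exists [::]; rewrite ?big_nil. Qed.

Definition cf (W : tidx a -> {poly K}) (d : nat) : tens K a := [ffun m => (W m)`_d].

(* Membership in the Rees module \bigoplus_d F_d s^d of the filtration. *)
Definition rees (W : tidx a -> {poly K}) := forall d, cf W d \in filt a z d.

(* 'X is the Rees parameter s: rescaling the z_i to s z_i makes the product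
   homogeneous for the filtration. *)
Definition Xv (x : {poly {poly K}}) : 'I_n -> {poly K} := fun i => x.[z i *: 'X].

Lemma reesD W W' : rees W -> rees W' -> rees (fun m => W m + W' m).
Proof.
move=> rW rW' d; rewrite (_ : cf _ _ = cf W d + cf W' d) ?memvD //.
by apply/ffunP => m; rewrite !ffunE coefD.
Qed.

Lemma rees0 : rees (fun=> 0).
Proof.
by move=> d; rewrite (_ : cf _ _ = 0) ?mem0v //; apply/ffunP => m; rewrite !ffunE coef0.
Qed.

Lemma rees_sum I (r : seq I) (P : pred I) (W : I -> tidx a -> {poly K}) :
  (forall i, P i -> rees (W i)) -> rees (fun m => \sum_(i <- r | P i) W i m).
Proof.
move=> rW; elim: r => [|i r IH].
  by under eq_fun do rewrite big_nil; apply: rees0.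
under eq_fun do rewrite big_cons.
by case Pi: (P i) => //; apply: reesD => //; apply: rW.
Qed.

Lemma reesM (s : {poly K}) W : rees W -> rees (fun m => s * W m).
Proof.
move=> rW d.
rewrite (_ : cf _ d = \sum_(j < d.+1) s`_j *: cf W (d - j)); last first.
  apply/ffunP => m; rewrite !ffunE sum_ffunE coefM; apply: eq_bigr => j _.
  by rewrite !ffunE.
apply: memv_suml => j _; apply: memvZ; apply: (subvP (filt_le (leq_subr _ _))) (rW _).
Qed.

(** Since t is evaluated at z_i s, the action of x_j raises the power of s by j: powers of s keep
    track of the filtration degree. *)
Lemma cf_pactXn x j W d :
  cf (pact x (Xv 'X^j) W) d = if (j <= d)%N then tens_act z x j (cf W (d - j)) else 0.
Proof.
apply/ffunP => m; rewrite ffunE /pact coef_sum.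
under eq_bigr => i _.
  rewrite /Xv hornerXn exprZn -scalerAl coefZ coefXnM.
  over.
case: ltnP => jd; first by rewrite ffunE big1 // => i _; rewrite mulr0.
rewrite /tens_act sum_ffunE; apply: eq_bigr => i _.
rewrite !ffunE /GRing.scale /=; congr (_ * _).
rewrite coef_sum; apply: eq_bigr => l _.
by rewrite coefCM !ffunE.
Qed.

Lemma XvE (p : {poly {poly K}}) i : Xv p i = \sum_(j < size p) p`_j * Xv 'X^j i.
Proof. by rewrite /Xv horner_coef; apply: eq_bigr => j _; rewrite hornerXn. Qed.

Lemma pact_Xv x p (W : tidx a -> {poly K}) m :
  pact x (Xv p) W m = \sum_(j < size p) p`_j * pact x (Xv 'X^j) W m.
Proof.
rewrite /pact; under [RHS]eq_bigr do rewrite mulr_sumr.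
rewrite exchange_big /=; apply: eq_bigr => i _.
by rewrite XvE mulr_suml; apply: eq_bigr => j _; rewrite mulrA.
Qed.

Lemma rees_pact x p W : \tr x = 0 -> rees W -> rees (pact x (Xv p) W).
Proof.
move=> trx rW; rewrite (_ : pact x (Xv p) W = fun m => \sum_(j < size p) p`_j * pact x (Xv 'X^j) W m).
  apply: rees_sum => j _; apply: reesM => d; rewrite cf_pactXn.
  case: leqP => [jd|_]; last exact: mem0v.
  by rewrite -{2}(subnKC jd) tens_act_filt.
by apply/funext => m; apply: pact_Xv.
Qed.

Lemma tr_sl2_e : \tr (sl2_e K) = 0.
Proof. by rewrite /mxtrace !big_ord_recl big_ord0 !mxE /= !addr0. Qed.

Lemma tr_sl2_f : \tr (sl2_f K) = 0.
Proof. by rewrite /mxtrace !big_ord_recl big_ord0 !mxE /= !addr0. Qed.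

Local Notation F := (filt a z).

(** Reduction of the Rees module modulo s: the coefficient of s^d is read in F_d / F_(d-1). For d >
    [gr_len F] this quotient is zero, so no information is lost on the Rees module. *)
Definition cls (W : tidx a -> {poly K}) : fusion a z :=
  gr_pi (F := F) [ffun s : 'I_(gr_len F).+1 => cf W s].

Lemma quotv_pi_linear (V : vectType K) (U W : {vspace V}) : linear (@quotv_pi K V U W).
Proof. by move=> c u v; rewrite /quotv_pi !linearP. Qed.

Lemma gr_pi_linear : linear (@gr_pi K (tens K a) F).
Proof. exact: quotv_pi_linear. Qed.

HB.instance Definition _ :=
  GRing.isLinear.Build K (gr_seq F) (gr F) *:%R (@gr_pi K (tens K a) F) gr_pi_linear.

Lemma gr_pi_eq0 (w : gr_seq F) :
  (forall s : 'I_(gr_len F).+1, w s \in if nat_of_ord s is s'.+1 then F s' else 0%VS) -> gr_pi w = 0.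
Proof.
move=> wd; apply/eqP; rewrite /gr_pi quotv_pi_eq0; first by apply/mem_prodv => s; have := wd s; case: (nat_of_ord s).
apply/mem_prodv => s; have := wd s; case: (nat_of_ord s) => [|s'] /=.
  by rewrite memv0 => /eqP ->; rewrite mem0v.
by apply/subvP; exact: filt_mono.
Qed.

Lemma clsD W W' : cls (fun m => W m + W' m) = cls W + cls W'.
Proof.
rewrite -linearD; congr gr_pi; apply/ffunP => s; rewrite !ffunE.
by apply/ffunP => m; rewrite !ffunE coefD.
Qed.

Lemma clsZ c W : cls (fun m => c%:P * W m) = c *: cls W.
Proof.
rewrite -linearZ; congr gr_pi; apply/ffunP => s; rewrite !ffunE.
by apply/ffunP => m; rewrite !ffunE coefCM.
Qed.

Lemma cls0 : cls (fun=> 0) = 0.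
Proof.
rewrite -(linear0 (@gr_pi K (tens K a) F)); congr gr_pi; apply/ffunP => s; rewrite !ffunE.
by apply/ffunP => m; rewrite !ffunE coef0.
Qed.

Lemma cls_sum I (r : seq I) (P : pred I) (W : I -> tidx a -> {poly K}) :
  cls (fun m => \sum_(i <- r | P i) W i m) = \sum_(i <- r | P i) cls (W i).
Proof.
elim: r => [|i r IH].
  by rewrite big_nil -cls0; congr cls; apply/funext => m; rewrite big_nil.
rewrite big_cons -IH; case Pi: (P i).
  by rewrite -clsD; congr cls; apply/funext => m; rewrite big_cons Pi.
by congr cls; apply/funext => m; rewrite big_cons Pi.
Qed.

Lemma cls_mulX W : rees W -> cls (fun m => 'X * W m) = 0.
Proof.
move=> rW; apply: gr_pi_eq0 => s; rewrite ffunE.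
case: (nat_of_ord s) => [|s'] /=.
  by rewrite memv0; apply/eqP/ffunP => m; rewrite !ffunE coefXM.
by rewrite (_ : cf _ _ = cf W s') //; apply/ffunP => m; rewrite !ffunE coefXM.
Qed.

Lemma clsM s W : rees W -> cls (fun m => s * W m) = s`_0 *: cls W.
Proof.
move=> rW; rewrite -clsZ; have [q sE] : exists q, s = (s`_0)%:P + 'X * q.
  have r0 : root (s - (s`_0)%:P) 0 by rewrite /root !hornerE horner_coef0 subrr.
  have /factor_theorem[q /eqP] := r0.
  by rewrite subr_eq subr0 => /eqP E; exists q; rewrite {1}E addrC mulrC.
rewrite {1}sE -[RHS]addr0 -(cls_mulX (reesM q rW)) -clsD.
by congr cls; apply/funext => m; rewrite mulrDl mulrA.
Qed.

Lemma fusion_act_cls x j W : \tr x = 0 -> rees W ->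
  fusion_act x j (cls W) = cls (pact x (Xv 'X^j) W).
Proof.
move=> trx rW; rewrite /fusion_act gr_op_pi.
- congr gr_pi; apply/ffunP => s; rewrite !ffunE cf_pactXn; case: leqP => // js.
  by rewrite inordK // (leq_ltn_trans (leq_subr _ _)).
- by move=> s v; apply: tens_act_filt.
- by apply/mem_prodv => s; rewrite ffunE.
Qed.

(** The truncation changes nothing for n > 0. For n = 0 an element of the quotient ring is a
    constant, possibly nonzero, while the sum defining [fusion_cur] is empty. *)
Lemma fusion_cur_cls x p W : \tr x = 0 -> rees W ->
  fusion_cur x p (cls W) = cls (pact x (Xv (take_poly n (p : {poly K}))^:P) W).
Proof.
move=> trx rW; rewrite /fusion_cur.
under eq_bigr do rewrite fusion_act_cls // -clsZ.
rewrite -(cls_sum _ _ (fun (j : 'I_n) m => ((p : {poly K})`_j)%:P * pact x (Xv 'X^j) W m)).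
congr cls; apply/funext => m; rewrite /pact.
under [LHS]eq_bigr do rewrite mulr_sumr.
rewrite exchange_big; apply: eq_bigr => i _ /=.
under eq_bigr do rewrite mulrA.
rewrite -mulr_suml; congr (_ * _); rewrite /Xv.
have sz : (size (take_poly n (p : {poly K}))^:P <= n)%N.
  by rewrite (leq_trans (size_poly _ _)) // size_take_poly.
rewrite (horner_coef_wide _ sz); apply: eq_bigr => j _.
by rewrite hornerXn coef_map coef_take_poly ltn_ord.
Qed.

End Filtration.

Section Nilpotent.
Variables (K : fieldType) (V : vectType K) (T : {linear V -> V}).

Lemma iter_linear k : linear (iter k T).
Proof. by elim: k => [|k IH] c u v //=; rewrite IH linearP. Qed.

HB.instance Definition _ k := GRing.isLinear.Build K V V *:%R (iter k T) (iter_linear k).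

(** The kernels of the powers of [T] increase, become stationary at some k at most dim V, and stay
    constant from there on. *)
Lemma iter_nilp N w : iter N T w = 0 -> iter (\dim {:V}) T w = 0.
Proof.
pose Ker k := lker (linfun (iter k T)).
have inK k v : (v \in Ker k) = (iter k T v == 0) by rewrite memv_ker lfunE.
have Kle k : (Ker k <= Ker k.+1)%VS.
  by apply/subvP => v; rewrite !inK iterS => /eqP ->; rewrite linear0.
have [k kd EK] : exists2 k, (k <= \dim {:V})%N & Ker k = Ker k.+1.
  case: (pselect (exists2 k, (k <= \dim {:V})%N & Ker k = Ker k.+1)) => // nex.
  have dK k : (k <= (\dim {:V}).+1)%N -> (k <= \dim (Ker k))%N.
    elim: k => // k IH kd; have := dimv_leqif_eq (Kle k).
    case=> le1 eq1; rewrite (leq_ltn_trans (IH (ltnW kd))) // ltn_neqAle le1 andbT eq1.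
    by apply/negP => /eqP E; apply: nex; exists k.
  by have := dK _ (leqnn _); rewrite leqNgt ltnS dimvS // subvf.
have stab j : Ker (j + k)%N = Ker k.
  elim: j => // j IH; apply/vspaceP => v; rewrite addSn inK iterSr -inK IH.
  by rewrite inK -iterSr -inK -EK.
move=> /eqP wN; have : w \in Ker (N + k)%N.
  by rewrite inK addnC iterD (eqP wN) linear0.
rewrite stab inK => /eqP w0.
by rewrite -(subnK kd) iterD w0 linear0.
Qed.

(** Allows the exponential to be cut at the degree bound known in the tensor product instead of at
    the dimension of M^A. *)
Lemma exp_nilpE N w : iter N T w = 0 ->
  exp_nilp T w = \sum_(k < N) (k`!%:R^-1) *: iter k T w.
Proof.
move=> wN; have wd := iter_nilp wN; rewrite /exp_nilp.
have wide M M' : (M <= M')%N -> iter M T w = 0 ->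
    \sum_(k < M') (k`!%:R^-1) *: iter k T w = \sum_(k < M) (k`!%:R^-1) *: iter k T w.
  move=> MM' wM; rewrite -!(big_mkord xpredT (fun k => (k`!%:R^-1) *: iter k T w)).
  rewrite (big_cat_nat (leq0n M) MM') /= [X in _ + X]big_nat_cond [X in _ + X]big1 ?addr0 //.
  move=> k; rewrite andbT => /andP[Mk _].
  by rewrite -(subnK Mk) iterD wM linear0 scaler0.
case: (leqP N (\dim {:V}).+1) => h; first exact: wide.
by symmetry; apply: wide (ltnW h) _; rewrite iterS wd linear0.
Qed.

End Nilpotent.

Section Scale.
Variables (K : fieldType) (n : nat) (a : 'I_n -> nat) (z : 'I_n -> K).

Lemma gr_op_linear (V : vectType K) (F : nat -> {vspace V}) d (X : {linear V -> V}) :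
  linear (@gr_op K V F d X).
Proof.
move=> c u v; rewrite /gr_op /gr_pi -(quotv_pi_linear _ _); congr quotv_pi.
apply/ffunP => s; rewrite linearP !ffunE; case: leqP => _; rewrite ?scaler0 ?addr0 //.
by rewrite linearP.
Qed.

Lemma fusion_cur_linear x p : linear (@fusion_cur K n a z x p).
Proof.
move=> c u v; rewrite /fusion_cur scaler_sumr -big_split; apply: eq_bigr => j _ /=.
by rewrite /fusion_act gr_op_linear scalerDr !scalerA mulrC.
Qed.

HB.instance Definition _ x p :=
  GRing.isLinear.Build K (fusion a z) (fusion a z) *:%R (@fusion_cur K n a z x p)
    (fusion_cur_linear x p).

Lemma iter_pactZ x s Y (W : tidx a -> {poly K}) k m :
  iter k (pact x (fun i => s * Y i)) W m = s ^+ k * iter k (pact x Y) W m.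
Proof.
elim: k m => [|k IH] m; first by rewrite mul1r.
rewrite !iterS /pact mulr_sumr; apply: eq_bigr => i _.
rewrite exprS -!mulrA; congr (_ * _); rewrite mulrCA; congr (_ * _).
by rewrite mulr_sumr; apply: eq_bigr => l _; rewrite IH mulrCA.
Qed.

Lemma rees_iter x p W k : \tr x = 0 -> rees z W -> rees z (iter k (pact (a := a) x (Xv z p)) W).
Proof. by move=> trx rW; elim: k => //= k IH; apply: rees_pact. Qed.

Lemma iter_fusion_cur x p W k : \tr x = 0 -> rees z W ->
  iter k (fusion_cur (z := z) x p) (cls z W) =
  cls z (iter k (pact (a := a) x (Xv z (take_poly n (p : {poly K}))^:P)) W).
Proof.
move=> trx rW; elim: k => //= k ->.
by rewrite fusion_cur_cls //; apply: rees_iter.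
Qed.

End Scale.

(** * Exponential vectors and their dependence on x *)

Section ExpVector.
Variables (K : numFieldType) (n : nat) (a : 'I_n -> nat) (z : 'I_n -> K).
Implicit Types (X Y : 'I_n -> {poly K}) (x y w : {poly {poly K}}).

(** Exceeds the degree in the exponential parameter, to which the i-th factor contributes at most
    a_i. *)
Let N := (\sum_i a i).+1.

Let sizeprod (R : idomainType) (c : R) (F : 'I_n -> {poly R}) (e : 'I_n -> nat) :
  (forall i, (size (F i) <= 2)%N) -> (forall i, (e i <= a i)%N) ->
  (size (c%:P * \prod_i F i ^+ e i)%R <= N)%N.
Proof.
move=> F2 ea; rewrite mul_polyC (leq_trans (size_scale_leq _ _)) //.
rewrite (leq_trans (size_poly_prod_leq _ _)) // leq_subLR addnS ltnS.
rewrite -sum1_card -big_split /=; apply: leq_sum => i _.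
rewrite (leq_trans (size_poly_exp_leq _ _)) // add1n ltnS.
case: (size (F i)) (F2 i) => [|[|[|//]]] //= _; rewrite ?mul0n ?mul1n //.
Qed.

(** Both sides are the value at 1 of the polynomial whose coefficients are given by
    [iter_pact_e]. *)
Lemma Eh_add X Y m :
  @Eh K n a (fun i => X i + Y i) m =
  \sum_(k < N) (k`!%:R^-1)%:P * iter k (pact (sl2_e K) Y) (Eh X) m.
Proof.
pose W := \prod_i ((m i)`!%:R^-1)%:P%:P * \prod_i ((X i)%:P + (Y i)%:P * 'X) ^+ m i : {poly {poly K}}.
have sW : (size W <= N)%N.
  rewrite /W -rmorph_prod; apply: sizeprod => i; last exact: ltnW.
  by rewrite addrC size_MXaddC; case: ifP => // _; rewrite ltnS size_polyC leq_b1.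
transitivity W.[1].
  rewrite /W /Eh hornerM !horner_prod; congr (_ * _); apply: eq_bigr => i _.
    by rewrite hornerC.
  by rewrite !hornerE.
rewrite (horner_coef_wide _ sW); apply: eq_bigr => k _.
rewrite expr1n mulr1 iter_pact_e -/W -[X in _ = _ * X]mulr_natl mulrA -polyC_natr -polyCM mulVf ?mul1r // pnatr_eq0 -lt0n fact_gt0.
Qed.

Lemma iter_e_vanish X Y m : iter N (pact (sl2_e K) Y) (@Eh K n a X) m = 0.
Proof.
rewrite iter_pact_e [X in X *+ _]nth_default ?mul0rn //.
rewrite -rmorph_prod; apply: sizeprod => i; last exact: ltnW.
by rewrite addrC size_MXaddC; case: ifP => // _; rewrite ltnS size_polyC leq_b1.
Qed.

Lemma exp_f_Eh X P m :
  \sum_(k < N) (k`!%:R^-1)%:P * iter k (pact (sl2_f K) P) (@Eh K n a X) m =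
  \prod_i (((m i)`!%:R^-1)%:P * X i ^+ m i) * \prod_i (1 + P i * X i) ^+ (a i - 1 - m i).
Proof.
pose W := \prod_i (((m i)`!%:R^-1)%:P%:P * (X i)%:P ^+ m i) *
   \prod_i (1 + (P i * X i)%:P * 'X) ^+ (a i - 1 - m i) : {poly {poly K}}.
have sW : (size W <= N)%N.
  rewrite /W; under eq_bigr do rewrite -polyC_exp -polyCM.
  rewrite -rmorph_prod; apply: sizeprod => i; last by rewrite -subnDA leq_subr.
  by rewrite addrC size_MXaddC; case: ifP => // _; rewrite ltnS size_polyC leq_b1.
transitivity W.[1]; last first.
  rewrite /W hornerM !horner_prod; congr (_ * _); apply: eq_bigr => i _.
    by rewrite !hornerE.
  by rewrite !hornerE.
rewrite (horner_coef_wide _ sW); apply: eq_bigr => k _.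
rewrite expr1n mulr1 iter_pact_f -/W -[X in _ * X = _]mulr_natl mulrA -polyC_natr -polyCM mulVf ?mul1r // pnatr_eq0 -lt0n fact_gt0.
Qed.

Lemma iter_f_vanish X Y m : iter N (pact (sl2_f K) Y) (@Eh K n a X) m = 0.
Proof.
rewrite iter_pact_f [X in X *+ _]nth_default ?mul0rn //.
under eq_bigr do rewrite -polyC_exp -polyCM.
rewrite -rmorph_prod; apply: sizeprod => i; last by rewrite -subnDA leq_subr.
by rewrite addrC size_MXaddC; case: ifP => // _; rewrite ltnS size_polyC leq_b1.
Qed.

Lemma Eh0 m : @Eh K n a (fun=> 0) m = ([forall i, m i == 0%N :> nat]%:R)%:P.
Proof.
rewrite /Eh; case: forallP => [m0|/forallP]; last first.
  rewrite negb_forall => /existsP[i mi].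
  by rewrite [X in _ * X](bigD1 i) //= expr0n (negPf mi) mul0r mulr0.
rewrite !big1 ?mulr1 // => i _; rewrite (eqP (m0 i)) //.
by rewrite fact0 invr1.
Qed.

Lemma rees_Eh0 : rees z (@Eh K n a (fun=> 0)).
Proof.
move=> d; rewrite (_ : cf _ _ = if d == 0%N then tens_low K a else 0).
  by case: eqP => _; rewrite ?mem0v ?tens_low_filt.
by apply/ffunP => m; rewrite ffunE Eh0 coefC; case: eqP; rewrite !ffunE.
Qed.

Lemma XvD x y i : Xv z (x + y) i = Xv z x i + Xv z y i.
Proof. exact: hornerD. Qed.

Lemma XvM x y i : Xv z (x * y) i = Xv z x i * Xv z y i.
Proof. exact: hornerM. Qed.

Lemma rees_Eh x : rees z (Eh (a := a) (Xv z x)).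
Proof.
rewrite (_ : Eh _ = fun m => \sum_(k < N) (k`!%:R^-1)%:P *
    iter k (pact (sl2_e K) (Xv z x)) (@Eh K n a (fun=> 0)) m).
  apply: rees_sum => k _; apply: reesM; apply: rees_iter; first exact: tr_sl2_e.
  exact: rees_Eh0.
apply/funext => m; rewrite -Eh_add; congr (Eh _ m); apply/funext => i.
by rewrite add0r.
Qed.

(** In the expansion of exp(s w) the k-th term carries s^k; one s is split off from every term with
    k > 0, and what is left stays in the Rees module. *)
Lemma Eh_mod_s x w : exists2 R, rees z R &
  forall m, Eh (a := a) (Xv z (x + 'X%:P * w)) m = Eh (Xv z x) m + 'X * R m.
Proof.
exists (fun m => \sum_(k < N.-1) ((k.+1)`!%:R^-1)%:P *
    ('X ^+ k * iter k.+1 (pact (sl2_e K) (Xv z w)) (@Eh K n a (Xv z x)) m)).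
  apply: rees_sum => k _; apply: reesM; apply: reesM; apply: rees_iter; first exact: tr_sl2_e.
  exact: rees_Eh.
move=> m; have -> : Xv z (x + 'X%:P * w) = fun i => Xv z x i + 'X * Xv z w i.
  by apply/funext => i; rewrite XvD XvM /Xv hornerC.
rewrite Eh_add /N big_ord_recl /= fact0 invr1 mul1r; congr (_ + _).
rewrite mulr_sumr; apply: eq_bigr => k _.
have := iter_pactZ (sl2_e K) 'X (Xv z w) (Eh (Xv z x)) k.+1 m.
by rewrite iterS => ->; rewrite exprS -!mulrA !(mulrCA 'X) /= .
Qed.

Definition expv x : fusion a z := cls z (Eh (Xv z x)).

Lemma expv_mod_s x w : expv (x + 'X%:P * w) = expv x.
Proof.
have [R rR E] := Eh_mod_s x w.
by rewrite /expv (funext E) clsD cls_mulX ?addr0.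
Qed.

Lemma poly_s_dvd w : (forall j, w`_j`_0 = 0) -> exists q, w = 'X%:P * q.
Proof.
move=> w0; exists (\poly_(j < size w) drop_poly 1 w`_j).
apply/polyP => j; rewrite coefCM coef_poly; case: ltnP => jw; last first.
  by rewrite mulr0 nth_default.
rewrite -{1}(poly_take_drop 1 w`_j) mulrC -[RHS]add0r; congr (_ + _).
by apply/polyP => i; rewrite coef0 coef_take_poly; case: i => // ; rewrite w0.
Qed.

(** This contains the vanishing of t^n on M^A. The polynomial P, the product of the t - z_i s, is
    zero at every t = z_i s and reduces to t^n modulo s. Adding multiples of P or of s to x does not
    change the vector, and together they allow truncation at t^n. *)
Lemma expv_congr x y :
  (forall j, (j < n)%N -> x`_j`_0 = y`_j`_0) -> expv x = expv y.
Proof.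
move=> xy.
have cong (u v : {poly {poly K}}) : (forall j, u`_j`_0 = v`_j`_0) -> expv u = expv v.
  move=> uv; have [j|q E] := @poly_s_dvd (u - v).
    by rewrite !coefB uv subrr.
  by rewrite -(expv_mod_s v q) -E addrC subrK.
pose P := \prod_i ('X - (z i *: 'X)%:P) : {poly {poly K}}.
have P0 j : P`_j`_0 = (j == n)%:R.
  have : map_poly (horner_eval 0) P = 'X^n.
    rewrite rmorph_prod /= (eq_bigr (fun=> 'X)) ?prodr_const ?card_ord // => i _.
    by rewrite rmorphB /= map_polyX map_polyC /= /horner_eval !hornerE subr0.
  move=> /(congr1 (fun p : {poly K} => p`_j)); rewrite coef_map coefXn /= /horner_eval.
  by rewrite horner_coef0.
have mulP u w : expv (u + P * w) = expv u.
  rewrite /expv (_ : Xv z (u + P * w) = Xv z u) //; apply/funext => i.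
  rewrite XvD XvM [Xv z P i](_ : _ = 0) ?mul0r ?addr0 //.
  by rewrite /Xv horner_prod (bigD1 i) //= !hornerE subrr mul0r.
have tn u : expv u = expv (take_poly n u).
  rewrite -{1}(poly_take_drop n u) -(mulP (take_poly n u) (drop_poly n u)).
  apply: cong => j; rewrite !coefD; congr (_ + _); rewrite coefMXn coefM coef_sum.
  under eq_bigr do rewrite coef0M P0.
  case: ltnP => jn; first by rewrite coef0 big1 // => i _; rewrite ltn_eqF ?mul0r // (leq_ltn_trans _ jn) // -ltnS.
  have nj : (n < j.+1)%N by [].
  rewrite (bigD1 (Ordinal nj)) //= eqxx mul1r big1 ?addr0 // => i /eqP ij.
  by case: eqP => [E|]; rewrite ?mul0r //; case: ij; apply: val_inj.
rewrite (tn x) (tn y); apply: cong => j; rewrite !coef_take_poly.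
by case: ltnP => // /xy.
Qed.

End ExpVector.

Section Congruence.
Variable K : fieldType.
Implicit Types p q r : {poly K}.

Definition eqlt k p q := forall j, (j < k)%N -> p`_j = q`_j.

Lemma eqlt_sym k p q : eqlt k p q -> eqlt k q p.
Proof. by move=> pq j /pq. Qed.

Lemma eqlt_trans k p q r : eqlt k p q -> eqlt k q r -> eqlt k p r.
Proof. by move=> pq qr j jk; rewrite pq ?qr. Qed.

Lemma eqlt_le k k' p q : (k <= k')%N -> eqlt k' p q -> eqlt k p q.
Proof. by move=> kk pq j jk; rewrite pq // (leq_trans jk). Qed.

Lemma eqltD k p p' q q' : eqlt k p p' -> eqlt k q q' -> eqlt k (p + q) (p' + q').
Proof. by move=> pp qq j jk; rewrite !coefD pp ?qq. Qed.

Lemma eqltN k p p' : eqlt k p p' -> eqlt k (- p) (- p').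
Proof. by move=> pp j jk; rewrite !coefN pp. Qed.

Lemma eqltM k p p' q q' : eqlt k p p' -> eqlt k q q' -> eqlt k (p * q) (p' * q').
Proof.
move=> pp qq j jk; rewrite !coefM; apply: eq_bigr => i _.
by rewrite pp ?qq // (leq_ltn_trans _ jk) ?leq_subr // -ltnS.
Qed.

Lemma eqltX k p p' e : eqlt k p p' -> eqlt k (p ^+ e) (p' ^+ e).
Proof. by move=> pp; elim: e => // e IH; rewrite !exprS; apply: eqltM. Qed.

Lemma eqlt_prod k (I : Type) (r : seq I) (P : pred I) (F F' : I -> {poly K}) :
  (forall i, P i -> eqlt k (F i) (F' i)) ->
  eqlt k (\prod_(i <- r | P i) F i) (\prod_(i <- r | P i) F' i).
Proof.
by move=> FF; apply: (big_ind2 (eqlt k)) => // *; apply: eqltM.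
Qed.

Lemma eqltI k p q r : r`_0 != 0 -> eqlt k (p * r) (q * r) -> eqlt k p q.
Proof.
move=> r0 E j; have [m] := ubnP j; elim: m => // m IH in j *.
rewrite ltnS => jm jk; have := E j jk; rewrite !coefM !big_ord_recr /= subnn.
rewrite (eq_bigr (fun i : 'I_j => q`_i * r`_(j - i))) => [|i _].
  by move/addrI/(mulIf r0).
by rewrite IH // (leq_trans (ltn_ord i) _) // ltnW.
Qed.

Lemma eqlt_inv k p r : r`_0 != 0 -> exists q, eqlt k (q * r) p.
Proof.
move=> r0; have : coprimep 'X^k r.
  by rewrite coprimep_sym; apply: coprimep_expr; rewrite coprimepX /root horner_coef0.
case/Bezout_eq1_coprimepP => -[u v] /= E; exists (p * v) => j jk.
rewrite -mulrA (_ : v * r = 1 - u * 'X^k); last by rewrite -E [_ + v * r]addrC addrK.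
by rewrite mulrBr mulr1 coefB mulrA coefMXn jk subr0.
Qed.

End Congruence.

Section ExpAction.
Variables (K : numFieldType) (n : nat) (a : 'I_n -> nat) (z : 'I_n -> K).
Implicit Types (x y : {poly K}).

Let N := (\sum_i a i).+1.

(* exp(\sum_j x_j e_j) v_A *)
Definition ev x : fusion a z := expv a z x^:P.

Lemma ev_congr x y : eqlt n x y -> ev x = ev y.
Proof. by move=> xy; apply: expv_congr => j jn; rewrite !coef_map /= xy. Qed.

Lemma coef_Xv x i d : (Xv z x^:P i)`_d = x`_d * z i ^+ d.
Proof.
have -> : Xv z x^:P i = \poly_(j < size x) (x`_j * z i ^+ j).
  rewrite /Xv horner_coef size_map_polyC poly_def; apply: eq_bigr => j _.
  by rewrite coef_map /= exprZn mul_polyC scalerA.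
by rewrite coef_poly; case: ltnP => // h; rewrite nth_default // mul0r.
Qed.

Lemma eqlt_Xv D x y i : eqlt D x y -> eqlt D (Xv z x^:P i) (Xv z y^:P i).
Proof. by move=> xy d dD; rewrite !coef_Xv xy. Qed.

Lemma cls_eqlt (W W' : tidx a -> {poly K}) D : (gr_len (filt a z) < D)%N ->
  (forall m, eqlt D (W m) (W' m)) -> cls z W = cls z W'.
Proof.
move=> lD WW'; congr gr_pi; apply/ffunP => s; rewrite !ffunE.
by apply/ffunP => m; rewrite !ffunE WW' // (leq_trans (ltn_ord s)).
Qed.

Lemma exp_nilp_cls (x : 'M[K]_2) (p : {poly %/ ('X^n : {poly K})}) (W : tidx a -> {poly K}) M : \tr x = 0 -> rees z W ->
  (forall m, iter M (pact x (Xv z (take_poly n (p : {poly K}))^:P)) W m = 0) ->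
  exp_nilp (fusion_cur (z := z) x p) (cls z W) =
  cls z (fun m => \sum_(k < M) (k`!%:R^-1)%:P *
      iter k (pact x (Xv z (take_poly n (p : {poly K}))^:P)) W m).
Proof.
move=> trx rW WM; rewrite (@exp_nilpE _ _ _ M); last first.
  by rewrite iter_fusion_cur // (_ : iter _ _ _ = fun=> 0) ?cls0 //; apply/funext.
rewrite (@cls_sum _ _ _ z _ _ _ (fun (k : 'I_M) m => (k`!%:R^-1)%:P *
      iter k (pact x (Xv z (take_poly n (p : {poly K}))^:P)) W m)).
by apply: eq_bigr => k _; rewrite clsZ iter_fusion_cur.
Qed.

Lemma exp_e_ev (p : {poly %/ ('X^n : {poly K})}) x :
  exp_nilp (fusion_cur (z := z) (sl2_e K) p) (ev x) = ev (x + (p : {poly K})).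
Proof.
have -> : ev (x + (p : {poly K})) = ev (x + take_poly n (p : {poly K})).
  by apply: ev_congr => j jn; rewrite !coefD coef_take_poly jn.
rewrite /ev /expv (@exp_nilp_cls _ _ _ N); first last.
- by move=> m; apply: iter_e_vanish.
- exact: rees_Eh.
- exact: tr_sl2_e.
congr cls; apply/funext => m; rewrite -Eh_add; congr (Eh _ m).
by apply/funext => i; rewrite rmorphD /= XvD.
Qed.

(** The group element acts on x by the fractional linear map x / (1 + p x). In the i-th factor it
    produces the scalar (1 + p x)^(a_i - 1) evaluated at t = z_i s, of which only the constant term
    survives modulo s. *)
Lemma exp_f_ev (p : {poly %/ ('X^n : {poly K})}) x y (k := 1 + take_poly n (p : {poly K}) * x) :
  k`_0 != 0 -> eqlt n (y * k) x ->
  exp_nilp (fusion_cur (z := z) (sl2_f K) p) (ev x) =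
  k`_0 ^+ (\sum_i (a i).-1) *: ev y.
Proof.
(* The quotient is needed modulo a power of t above [gr_len], since coefficients of s are compared
   up to that degree. As D also exceeds n, replacing y by the more precise y' does not affect
   [ev]. *)
move=> k0 yk; pose D := (gr_len (filt a z) + n).+1.
have [y' y'k] := eqlt_inv D x k0.
have -> : ev y = ev y'.
  apply/ev_congr/(eqltI k0); apply: eqlt_trans yk _; apply: eqlt_sym.
  by apply: eqlt_le y'k; rewrite /D ltnW // ltnS leq_addl.
rewrite /ev /expv (@exp_nilp_cls _ _ _ N); first last.
- by move=> m; apply: iter_f_vanish.
- exact: rees_Eh.
- exact: tr_sl2_f.
pose s := \prod_i (Xv z k^:P i) ^+ (a i).-1.
have s0 : s`_0 = k`_0 ^+ (\sum_i (a i).-1).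
  rewrite coef0_prod -prodrXr; apply: eq_bigr => i _.
  by rewrite -horner_coef0 horner_exp horner_coef0 coef_Xv expr0 mulr1.
rewrite -s0 -clsM; last exact: rees_Eh.
apply: (@cls_eqlt _ _ D); first by rewrite /D ltnS leq_addr.
move=> m; rewrite exp_f_Eh big_split /Eh mulrCA -mulrA; apply: eqltM => //.
rewrite -!big_split /=; apply: eqlt_prod => i _.
have -> : 1 + Xv z (take_poly n (p : {poly K}))^:P i * Xv z x^:P i = Xv z k^:P i.
  by rewrite /k rmorphD rmorphM rmorph1 XvD XvM /Xv hornerC.
have -> : ((a i).-1 = m i + (a i - 1 - m i))%N by have := ltn_ord (m i); lia.
rewrite exprD mulrAC; apply: eqltM => //; rewrite -exprMn mulrC.
apply: eqltX; apply: eqlt_sym; rewrite -XvM -rmorphM; exact: eqlt_Xv.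
Qed.

End ExpAction.

Lemma poly_eq0_eval (K : numFieldType) (p : {poly K}) :
  (forall c, c != 0 -> p.[c] = 0) -> p = 0.
Proof.
move=> p0; apply/eqP; apply: contraT => pn0.
have := max_poly_roots (rs := [seq i.+1%:R | i <- iota 0 (size p)]) pn0.
rewrite size_map size_iota ltnn; apply.
  by apply/allP => _ /mapP[i _ ->]; rewrite /root p0 // pnatr_eq0.
by rewrite map_inj_uniq ?iota_uniq // => i j /eqP; rewrite eqr_nat => /eqP[].
Qed.

(** * Linear functionals on the fusion product *)

Section Kill.
Variables (K : numFieldType) (n : nat) (a : 'I_n -> nat) (z : 'I_n -> K).
Implicit Types (x y : {poly K}) (X Y : 'I_n -> {poly K}).

Let N := (\sum_i a i).+1.

(** Together with [pact_f_shift] this is the realization of sl_2 by first-order operators: on exp(X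
    e) v, f acts as (a - 1) X - X^2 e and h as 2 X e - (a - 1). Hence f and h can be expressed
    through e and multiplications. *)
Lemma pact_e_shift X Y m :
  pact (a := a) (sl2_e K) (fun i => Y i * X i) (Eh X) m =
  \sum_i Y i * (m i)%:R * Eh X m.
Proof.
apply: eq_bigr => i _; rewrite irr_sl2_e -!mulrA; congr (_ * _).
pose G (i : 'I_n) (k : 'I_(a i)) := ((k`!%:R^-1)%:P) * X i ^+ k.
have EG m' : Eh X m' = \prod_i G i (m' i) by rewrite /Eh -big_split.
rewrite mulr_sumr.
under eq_bigr => l _ do rewrite EG (prod_upd G) mulrCA [X i * _]mulrA.
rewrite (@sum_irr_e _ _ polyC _ (m i) _
  ((m i)%:R * Eh X m)) // => [l E|->]; last by rewrite mul0r.
rewrite EG [in RHS](bigD1 i) //= [in RHS]mulrA; congr (_ * _).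
by rewrite /G E exprS -(invfactS K l) -[_^-1 *+ l.+1]mulr_natl polyCM polyC_natr; ring.
Qed.

Lemma pact_f_shift X Y m :
  pact (a := a) (sl2_f K) Y (Eh X) m =
  \sum_i Y i * X i * (a i - 1 - m i)%:R * Eh X m.
Proof.
apply: eq_bigr => i _; rewrite irr_sl2_f -!mulrA; congr (_ * _).
pose G (i : 'I_n) (k : 'I_(a i)) := ((k`!%:R^-1)%:P) * X i ^+ k.
have EG m' : Eh X m' = \prod_i G i (m' i) by rewrite /Eh -big_split.
under eq_bigr => l _ do rewrite EG (prod_upd G).
rewrite (@sum_irr_f _ _ polyC _ (m i) _
  (X i * ((a i - 1 - m i)%:R * Eh X m))) // => [l E|E]; last first.
  by rewrite (_ : a i - 1 - m i = 0)%N ?mul0r ?mulr0 //; lia.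
rewrite EG [in RHS](bigD1 i) //= !mulrA; congr (_ * _).
rewrite /G E exprS natrM -(invfactS K (m i)) -[_^-1 *+ (m i).+1]mulr_natl polyCM polyC_natr.
have -> : (a i - 1 - m i = a i - (m i).+1)%N by lia.
by ring.
Qed.

Definition kills (s : nat) (mu : tens K a -> K^o) :=
  forall j, (j <= s)%N -> forall x, mu (cf (Eh (Xv z x^:P)) j) = 0.

(** Vanishing on the exponential vectors of all y + c t^j is a polynomial identity in c; its linear
    coefficient is the action of e_j. *)
Lemma kills_e s (mu : {linear tens K a -> K^o}) i j y : kills s mu -> (i + j <= s)%N ->
  mu (tens_act z (sl2_e K) j (cf (Eh (Xv z y^:P)) i)) = 0.
Proof.
move=> ks ijs.
pose W k := iter k (pact (sl2_e K) (Xv z 'X^j)) (@Eh K n a (Xv z y^:P)).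
pose Q := \poly_(k < N) (k`!%:R^-1 * mu (cf (W k) (i + j))).
have Q0 : Q = 0.
  apply: poly_eq0_eval => c _; rewrite horner_poly.
  rewrite -[RHS](ks (i + j)%N ijs (y + c *: 'X^j)).
  transitivity (mu (\sum_(k < N) (k`!%:R^-1 * c ^+ k) *: cf (W k) (i + j))).
    rewrite linear_sum; apply: eq_bigr => k _.
    by rewrite linearZ /= mulrAC.
  congr (mu _); apply/ffunP => m; rewrite ffunE sum_ffunE.
  rewrite (_ : Xv z _ = fun i => Xv z y^:P i + c%:P * Xv z 'X^j i); last first.
    apply/funext => l; rewrite rmorphD /= XvD; congr (_ + _).
    by rewrite map_polyZ map_polyXn /Xv hornerZ.
  rewrite Eh_add coef_sum; apply: eq_bigr => k _.
  by rewrite iter_pactZ -rmorphXn mulrA -polyCM coefCM !ffunE.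
have : Q`_1 = 0 by rewrite Q0 coef0.
rewrite coef_poly; case: ltnP => [_|N1 _].
  rewrite factS fact0 mul1n invr1 mul1r cf_pactXn leq_addl addnK //.
have -> : tens_act z (sl2_e K) j (cf (Eh (Xv z y^:P)) i) = cf (W 1%N) (i + j).
  by rewrite cf_pactXn leq_addl addnK.
rewrite (_ : cf _ _ = 0) ?linear0 //; apply/ffunP => m; rewrite !ffunE.
have := @iter_e_vanish K n a (Xv z y^:P) (Xv z 'X^j) m.
have -> : (\sum_i a i).+1 = 1%N by apply/eqP; rewrite eqn_leq N1.
by rewrite /W => ->; rewrite coef0.
Qed.

Lemma cf_sum I (r : seq I) (P : pred I) (W : I -> tidx a -> {poly K}) d :
  cf (fun m => \sum_(i <- r | P i) W i m) d = \sum_(i <- r | P i) cf (W i) d.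
Proof.
apply/ffunP => m; rewrite ffunE sum_ffunE coef_sum.
by apply: eq_bigr => i _; rewrite ffunE.
Qed.

Lemma cfM (s : {poly K}) (W : tidx a -> {poly K}) d :
  cf (fun m => s * W m) d = \sum_(j < d.+1) s`_j *: cf W (d - j).
Proof.
by apply/ffunP => m; rewrite !ffunE sum_ffunE coefM; apply: eq_bigr => j _; rewrite !ffunE.
Qed.

Lemma kills_eX s (mu : {linear tens K a -> K^o}) i j x y : kills s mu -> (i + j <= s)%N ->
  mu (cf (pact (sl2_e K) (Xv z ('X^j * x^:P)) (Eh (Xv z y^:P))) (i + j)) = 0.
Proof.
move=> ks ijs; set E := Eh _.
have -> : pact (sl2_e K) (Xv z ('X^j * x^:P)) E =
    fun m => \sum_(l < size x) (x`_l)%:P * pact (sl2_e K) (Xv z 'X^(j + l)) E m.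
  apply/funext => m; rewrite /pact; under [RHS]eq_bigr do rewrite mulr_sumr.
  rewrite exchange_big /=; apply: eq_bigr => k _.
  under [RHS]eq_bigr do rewrite mulrA.
  rewrite -mulr_suml; congr (_ * _).
  rewrite XvM {2}/Xv horner_coef size_map_polyC mulr_sumr; apply: eq_bigr => l _.
  by rewrite coef_map /= mulrCA -hornerXn /Xv -hornerM -exprD.
rewrite cf_sum linear_sum big1 // => l _; rewrite cfM linear_sum big1 // => k _.
rewrite linearZ /= coefC; case: eqP => [->|]; last by rewrite scale0r.
rewrite subn0 cf_pactXn; case: leqP; last by rewrite linear0 scaler0.
by move=> h; rewrite (kills_e _ ks) ?scaler0 // subnK.
Qed.

Lemma kills_act s (mu : {linear tens K a -> K^o}) (x : 'M[K]_2) i j y : kills s mu -> (i + j <= s)%N ->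
  mu (tens_act z x j (cf (Eh (Xv z y^:P)) i)) = 0.
Proof.
move=> ks ijs; set v := cf _ i.
(* [irr] takes the entry 0 0 as the coefficient of h and does not read the entry 1 1; so
   [delta_mx 0 0] stands for h here, although its trace is 1. *)
have -> : tens_act z x j v = x 0 1 *: tens_act z (sl2_e K) j v +
    x 0 0 *: tens_act z (delta_mx 0 0) j v + x 1 0 *: tens_act z (sl2_f K) j v.
  rewrite /tens_act !scaler_sumr -!big_split /=; apply: eq_bigr => l _.
  rewrite !scalerA ![_ * z l ^+ j]mulrC -!scalerA -!scalerDr; congr (_ *: _).
  apply/ffunP => m; rewrite !ffunE /GRing.scale /= !mulr_sumr -!big_split /=.
  by apply: eq_bigr => k _; rewrite /irr !mxE /=; ring.
rewrite !linearD !linearZ /= (kills_e _ ks ijs) scaler0 add0r.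
have cfE (x' : 'M[K]_2) : tens_act z x' j v = cf (pact x' (Xv z 'X^j) (Eh (Xv z y^:P))) (i + j).
  by rewrite cf_pactXn leq_addl addnK.
have killM (s' : {poly K}) : mu (cf (fun m => ('X^j * s') * Eh (Xv z y^:P) m) (i + j)) = 0.
  rewrite (_ : cf _ _ = cf (fun m => s' * Eh (Xv z y^:P) m) i); last first.
    apply/ffunP => m; rewrite !ffunE -mulrA coefXnM ifF ?addnK //.
    by rewrite ltnNge leq_addl.
  rewrite cfM linear_sum big1 // => l _; rewrite linearZ /= ks ?scaler0 //.
  by rewrite (leq_trans (leq_subr _ _)) // (leq_trans _ ijs) // leq_addr.
have XvX l : Xv z 'X^j l = 'X^j * (z l ^+ j)%:P.
  by rewrite /Xv hornerXn exprZn mulrC mul_polyC.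
have cfD d W W' : cf (a := a) (K := K) (fun m => W m + W' m) d = cf W d + cf W' d.
  by apply/ffunP => m; rewrite !ffunE coefD.
have -> : mu (tens_act z (delta_mx 0 0) j v) = 0.
  rewrite cfE.
  have -> : pact (delta_mx 0 0) (Xv z 'X^j) (Eh (Xv z y^:P)) =
     fun m : tidx a => pact (sl2_e K) (Xv z ('X^j * (2 *: y)^:P)) (Eh (Xv z y^:P)) m
       + (- \sum_l (Xv z 'X^j l) * ((a l)%:R - 1)) * Eh (Xv z y^:P) m.
    apply/funext => m.
    have -> : Xv z ('X^j * (2 *: y)^:P) = fun l => (Xv z 'X^j l * 2) * Xv z y^:P l.
      apply/funext => l; rewrite XvM map_polyZ /Xv hornerZ /=; rewrite -mulrA; congr (_ * (_ * _)).
      by rewrite polyC_natr.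
    rewrite pact_e_shift -sumrN mulr_suml -big_split /=; apply: eq_bigr => l _.
    rewrite (bigD1 (m l)) //= big1 => [|k /negPf km]; last first.
      by rewrite /irr !mxE /= [m l == k]eq_sym km mulr0n ?(mul0r, mulr0, addr0, add0r).
    rewrite /irr !mxE /= eqxx mulr1n ?(mul0r, mul1r, addr0, add0r).
    have -> : upd m (m l) = m.
      apply/ffunP => k; case: (eqVneq k l) => [->|kl]; last by rewrite upd_out.
      by rewrite upd_in.
    by rewrite rmorphB !rmorph_nat natrD natrM; ring.
  rewrite cfD linearD (kills_eX _ _ ks ijs) add0r -sumrN.
  by under eq_bigr => l _ do rewrite XvX -mulrA -mulrN; rewrite -mulr_sumr killM.
have -> : mu (tens_act z (sl2_f K) j v) = 0.
  rewrite cfE.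
  have -> : pact (sl2_f K) (Xv z 'X^j) (Eh (Xv z y^:P)) =
     fun m : tidx a => pact (sl2_e K) (Xv z ('X^j * (- (y ^+ 2))^:P)) (Eh (Xv z y^:P)) m
       + (\sum_l (Xv z 'X^j l) * (Xv z y^:P l * (a l - 1)%:R)) * Eh (Xv z y^:P) m.
    apply/funext => m.
    have -> : Xv z ('X^j * (- (y ^+ 2))^:P) = fun l => (- Xv z 'X^j l * Xv z y^:P l) * Xv z y^:P l.
      apply/funext => l; rewrite XvM rmorphN rmorphXn /= {2}/Xv hornerN horner_exp -/(Xv z y^:P l).
      by ring.
    rewrite pact_e_shift pact_f_shift mulr_suml -big_split /=; apply: eq_bigr => l _.
    rewrite (natrB _ (_ : (m l <= a l - 1)%N)); first by ring.
    by have := ltn_ord (m l); lia.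
  rewrite cfD linearD (kills_eX _ _ ks ijs) add0r.
  by under eq_bigr => l _ do rewrite XvX -mulrA; rewrite -mulr_sumr killM.
by rewrite !scaler0 addr0.
Qed.

(** So F_s is spanned by the coefficients of s^j, j at most s, of the exponential vectors. The
    induction absorbs the leftmost operator x_j of a monomial into the functional, at the cost of
    lowering s by j. *)
Lemma kills_filt s (mu : {linear tens K a -> K^o}) : kills s mu ->
  forall w, w \in filt a z s -> mu w = 0.
Proof.
move=> ks w ws; apply/eqP; rewrite -memv0; move: w ws; apply: filt_ind => l ltr ls.
rewrite memv0; apply/eqP; elim: l s mu ks ltr ls => [|[x j] l IH] s mu ks ltr ls /=.
  rewrite -(ks 0%N isT 0); congr (mu _); apply/ffunP => m; rewrite !ffunE.
  rewrite (_ : Xv _ _ = fun=> 0) ?Eh0 ?coefC //.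
  by apply/funext => i; rewrite rmorph0 /Xv horner0.
move: ls; rewrite big_cons /= => ls.
apply: (IH (s - j)%N (mu \o tens_act z x j)).
- by move=> i ij y /=; apply: (kills_act x y ks); move: ij ls; set S := \sum_(_ <- _) _; lia.
- by move=> xi xil; apply: ltr; rewrite inE xil orbT.
- by rewrite leq_subRL // (leq_trans _ ls) // leq_addr.
Qed.

(* A functional mu_0 + mu_1 s + ... of the tensor product, whose value on all
   exp(e_x) v is divisible by s^d, induces a functional on the associated
   graded space; replacing x(t) by x(c t) separates the mu_k. *)
Lemma fusion_functional (mu : tidx a -> {poly K}) d :
  (forall x, eqlt d (\sum_m mu m * Eh (Xv z x^:P) m) 0) ->
  exists lam : {linear fusion a z -> K^o},
    forall x, lam (ev a z x) = (\sum_m mu m * Eh (Xv z x^:P) m)`_d.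
Proof.
move=> mu0.
pose M k (w : tens K a) : K^o := \sum_m (mu m)`_k * w m.
have Mlin k : linear (M k).
  move=> c u v; rewrite /M scaler_sumr -big_split /=; apply: eq_bigr => m _.
  by rewrite !ffunE mulrDr /GRing.scale /= mulrCA.
pose Mb k := GRing.isLinear.Build K (tens K a) K^o *:%R (M k) (Mlin k).
pose Ml k : {linear tens K a -> K^o} := HB.pack (M k) (Mb k).
have M0 k : M k 0 = 0 by exact: (linear0 (Ml k)).
have MZ k c w : M k (c *: w) = c * M k w by rewrite -[c *: w]addr0 Mlin M0 addr0.
have coefE x j : (\sum_m mu m * Eh (Xv z x^:P) m)`_j =
    \sum_(k < j.+1) M k (cf (Eh (Xv z x^:P)) (j - k)).
  rewrite coef_sum exchange_big /=; apply: eq_bigr => m _; rewrite coefM.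
  by apply: eq_bigr => k _; rewrite ffunE.
have cfscale c x i : cf (Eh (Xv z (x \Po (c *: 'X))^:P)) i = c ^+ i *: cf (@Eh K n a (Xv z x^:P)) i.
  apply/ffunP => m; rewrite !ffunE /GRing.scale /=.
  have compX l : Xv z (x \Po (c *: 'X))^:P l = Xv z x^:P l \Po (c *: 'X).
    apply/polyP => k; rewrite coef_Xv.
    have coefS (p : {poly K}) j : (p \Po (c *: 'X))`_j = c ^+ j * p`_j.
      rewrite comp_polyE coef_sum; under eq_bigr do rewrite exprZn !coefZ coefXn.
      case: (ltnP j (size p)) => jp.
        rewrite (bigD1 (Ordinal jp)) //= eqxx mulr1 mulrC big1 ?addr0 // => k' /eqP kj.
        by case: eqP => [E|]; rewrite ?mulr0 //; case: kj; apply: val_inj.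
      rewrite nth_default // mulr0 big1 // => k' _.
      by rewrite gtn_eqF ?mulr0 // (leq_trans (ltn_ord k')).
    by rewrite !coefS coef_Xv mulrA.
  have -> : Eh (Xv z (x \Po (c *: 'X))^:P) m = Eh (Xv z x^:P) m \Po (c *: 'X).
    rewrite /Eh rmorphM !rmorph_prod; congr (_ * _); apply: eq_bigr => l _.
      by rewrite /= comp_polyC.
    by rewrite rmorphXn /= compX.
  rewrite comp_polyE coef_sum; under eq_bigr do rewrite exprZn !coefZ coefXn.
  set p := Eh _ m; case: (ltnP i (size p)) => jp.
    rewrite (bigD1 (Ordinal jp)) //= eqxx mulr1 mulrC big1 ?addr0 // => k' /eqP kj.
    by case: eqP => [E|]; rewrite ?mulr0 //; case: kj; apply: val_inj.
  rewrite nth_default // mulr0 big1 // => k' _.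
  by rewrite gtn_eqF ?mulr0 // (leq_trans (ltn_ord k')).
have Mkill k i x : (i + k < d)%N -> M k (cf (Eh (Xv z x^:P)) i) = 0.
  move=> ikd.
  pose Q : {poly K} := \poly_(l < (i + k).+1) M (i + k - l)%N (cf (Eh (Xv z x^:P)) l).
  have Q0 : Q = 0.
    apply: poly_eq0_eval => c _; rewrite horner_poly.
    rewrite -[RHS](coef0 K (i + k)) -(mu0 (x \Po (c *: 'X)) _ ikd) coefE.
    rewrite (reindex_inj rev_ord_inj) /=; apply: eq_bigr => l _.
    rewrite cfscale MZ mulrC subSS; congr (_ * M _ _).
    by rewrite subKn // -ltnS.
  have : Q`_i = 0 by rewrite Q0 coef0.
  by rewrite coef_poly ltnS leq_addr addnC addnK.
have Mfilt k i w : (i + k < d)%N -> w \in filt a z i -> M k w = 0.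
  move=> ikd; apply: (kills_filt (mu := Ml k)) => j ji x; apply: Mkill.
  by rewrite (leq_ltn_trans _ ikd) // leq_add2r.
pose F := filt a z.
pose rep (m : fusion a z) : gr_seq F := vsval m.
(* The coefficient mu_k is applied in degree d - k, where it vanishes on the previous filtration
   step. Degrees above [gr_len] give 0, in accordance with a filtration that is constant there. *)
pose L (m : fusion a z) : K^o := \sum_(k < d.+1)
   (if insub (d - k)%N is Some s then M k (rep m s) else 0).
have Llin : linear L.
  move=> c u v; rewrite /L scaler_sumr -big_split /=; apply: eq_bigr => k _.
  case: insub => [s|]; last by rewrite scaler0 addr0.
  by rewrite !ffunE (Mlin k).
pose Lb := GRing.isLinear.Build K (fusion a z) K^o *:%R L Llin.
exists (HB.pack L Lb : {linear fusion a z -> K^o}) => x /=.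
rewrite coefE /L; apply: eq_bigr => k _.
set w : gr_seq F := [ffun s : 'I_(gr_len F).+1 => cf (Eh (Xv z x^:P)) s].
have wN : w \in gr_num F by apply/mem_prodv => s; rewrite ffunE; apply: rees_Eh.
have /mem_prodv D : rep (ev a z x) - w \in gr_den F.
  have [mN mE] := quotv_pi_val (ev a z x : quotv (gr_num F) (gr_den F)).
  rewrite -(@quotv_pi_eq0 _ _ (gr_num F)) ?memvB //.
  by rewrite quotv_piB mE subrr.
have kd : (k <= d)%N by rewrite -ltnS.
case: insubP => [s _ sE|]; last first.
  rewrite -leqNgt => ld; symmetry; case dk : (d - k)%N ld => [//|d'] ld.
  apply: (@Mfilt k d'); first by lia.
  have := @rees_Eh K n a z x^:P d'.+1; rewrite /F in ld.
  rewrite (gr_lenP (@filt_mono K n a z) (leqW (ld : (_ <= d')%N))).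
  by rewrite -(gr_lenP (@filt_mono K n a z) ld).
have /eqP := Mlin k (-1) (w s) (rep (ev a z x) s).
rewrite (_ : M k (_ + _) = 0); last first.
  have := D s; rewrite !ffunE scaleN1r addrC.
  case sd : (nat_of_ord s) => [|s']; first by rewrite memv0 => /eqP ->; rewrite M0.
  by move=> /Mfilt -> //; move: sE; rewrite /= sd; lia.
by rewrite scaleN1r addrC eq_sym subr_eq0 => /eqP ->; rewrite ffunE sE.
Qed.

End Kill.

Lemma prod_sum_dffun (R : comNzRingType) (I : finType) (T_ : I -> finType)
    (G : forall i, T_ i -> R) :
  \prod_i \sum_j G i j = \sum_(m : {dffun forall i, T_ i}) \prod_i G i (m i).
Proof.
rewrite (reindex (@dffun_of_fprod _ T_)) /=; last exact/onW_bij/dffun_of_fprod_bij.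
transitivity (\sum_(t : fprod T_) \prod_i [ffun j => G i j] (t i)); last first.
  by apply: eq_bigr => t _; apply: eq_bigr => i _; rewrite !ffunE.
pose P_ i : {ffun T_ i -> R} := [ffun j => G i j].
transitivity (\prod_i \sum_(j in tagged_with T_ i) untag 0 (P_ i) j).
  apply: eq_bigr => i _; rewrite -(big_tag (fun i => P_ i)).
  by apply: eq_bigr => j _; rewrite ffunE.
rewrite bigA_distr_big_dep; symmetry; exact: (big_fprod 1 +%R P_).
Qed.

(** Builds a linear map from its transpose, one coordinate at a time; this replaces a check that
    every linear relation among the vectors [g t] is respected by [h]. *)
Lemma linear_of_functionals (K : fieldType) (V V' : vectType K) T (g : T -> V') (h : T -> V) :
  (forall lam : {linear V -> K^o}, exists lam' : {linear V' -> K^o},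
     forall t, lam' (g t) = lam (h t)) ->
  exists iota : {linear V' -> V}, forall t, iota (g t) = h t.
Proof.
move=> H; pose b := vbasis {:V}.
pose L (i : 'I_(\dim {:V})) := coord b i : V -> K^o.
have [lam lamE] := choice (fun i => H (L i)).
pose f (v : V') := \sum_i lam i v *: b`_i.
have flin : linear f.
  move=> c u v; rewrite /f scaler_sumr -big_split /=; apply: eq_bigr => i _.
  by rewrite linearP scalerDl scalerA.
pose fb := GRing.isLinear.Build K V' V *:%R f flin.
exists (HB.pack f fb : {linear V' -> V}) => t /=.
rewrite /f [RHS](coord_vbasis (memvf (h t))); apply: eq_bigr => i _.
by rewrite lamE.
Qed.

Section ProductFunctional.
Variables (K : numFieldType) (n : nat) (a : 'I_n -> nat) (z : 'I_n -> K).

(** The coordinates of an exponential vector are, up to factorials, all monomials of degree less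
    than a_i in each X_i; hence any polynomial within these bounds is a linear function of the
    vector. *)
Lemma fusion_functional_prod (I : finType) (c : I -> {poly K})
    (h : I -> 'I_n -> {poly {poly K}}) d
    (f := fun x : {poly K} => \sum_l c l * \prod_i (h l i).[Xv z x^:P i]) :
  (forall l i, (size (h l i) <= a i)%N) ->
  (forall x, eqlt d (f x) 0) ->
  exists lam : {linear fusion a z -> K^o}, forall x, lam (ev a z x) = (f x)`_d.
Proof.
move=> sz fd.
pose mu (m : tidx a) := \sum_l c l * \prod_i (((m i)`!%:R)%:P * (h l i)`_(m i)).
have muE x : \sum_m mu m * Eh (Xv z x^:P) m = f x.
  rewrite /mu /f; under eq_bigr do rewrite mulr_suml.
  rewrite exchange_big /=; apply: eq_bigr => l _.
  under eq_bigr do rewrite -mulrA.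
  rewrite -mulr_sumr; congr (_ * _).
  under [RHS]eq_bigr => i _ do rewrite (horner_coef_wide _ (sz l i)).
  rewrite (prod_sum_dffun (fun i (j : 'I_(a i)) => (h l i)`_j * Xv z x^:P i ^+ j)).
  apply: eq_bigr => m _; rewrite /Eh -!big_split /=; apply: eq_bigr => i _.
  rewrite mulrACA -polyCM mulfV ?mul1r // pnatr_eq0 -lt0n fact_gt0 //.
have [|lam lamE] := @fusion_functional K n a z mu d; first by move=> x; rewrite muE.
by exists lam => x; rewrite lamE muE.
Qed.

End ProductFunctional.

(** * The linear maps from which the charts are composed: embedding, translation, reflection *)

Section Embedding.
Variables (K : numFieldType) (n : nat) (a : 'I_n.+1 -> nat) (z : 'I_n.+1 -> K).

Definition init (T : Type) (f : 'I_n.+1 -> T) : 'I_n -> T :=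
  fun i => f (widen_ord (leqnSn n) i).

(* e (x) (t - z_n) g acts on the first n factors only; up to rescaling these
   factors and to lower order terms it is e (x) t g. *)
Lemma fusion_embedding :
  exists iota : {linear fusion (init a) (init z) -> fusion a z},
    forall x, iota (ev (init a) (init z) x) = ev a z ('X * x).
Proof.
apply: linear_of_functionals => lam.
pose F := filt a z.
pose dl (s : 'I_(gr_len F).+1) (w : tens K a) : gr_seq F := [ffun s' => if s' == s then w else 0].
pose mu s w : K^o := lam (gr_pi (F := F) (dl s w)).
have dlin s : linear (dl s).
  by move=> c u v; apply/ffunP => s'; rewrite !ffunE; case: eqP; rewrite ?scaler0 ?addr0.
have mulin s : linear (mu s).
  by move=> c u v; rewrite /mu dlin gr_pi_linear linearP.
pose mub s := GRing.isLinear.Build K (tens K a) K^o *:%R (mu s) (mulin s).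
pose mul s : {linear tens K a -> K^o} := HB.pack (mu s) (mub s).
have mu_0 s : mu s 0 = 0 by exact: (linear0 (mul s)).
have muZ s c w : mu s (c *: w) = c * mu s w by rewrite -[c *: w]addr0 mulin mu_0 addr0.
have muD s w w' : mu s (w + w') = mu s w + mu s w' by exact: (linearD (mul s)).
have mu_sum s (G : tidx a -> tens K a) : mu s (\sum_l G l) = \sum_l mu s (G l).
  exact: (linear_sum (mul s)).
have muF (s : 'I_(gr_len F).+1) j w : (j < s)%N -> w \in F j -> mu s w = 0.
  move=> js wj; rewrite /mu gr_pi_eq0 ?linear0 // => s'; rewrite ffunE.
  case: eqP => [->|_]; last by case: (nat_of_ord s') => *; rewrite mem0v.
  case: (nat_of_ord s) js => [//|s''] js.
  by apply: (subvP _) wj; apply: filt_le.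
have lamE x : lam (ev a z ('X * x)) = \sum_s mu s (cf (Eh (Xv z ('X * x)^:P)) s).
  rewrite /mu -!linear_sum; congr (lam (gr_pi _)); apply/ffunP => s.
  rewrite sum_ffunE ffunE (bigD1 s) //= ffunE eqxx big1 ?addr0 // => s' /negPf ss'.
  by rewrite ffunE eq_sym ss'.
pose zn := z ord_max.
pose y x : {poly {poly K}} := ('X * x)^:P + 'X%:P * (- zn *: x)^:P.
have step s : exists lam' : {linear fusion (init a) (init z) -> K^o},
    forall x, lam' (ev (init a) (init z) x) = mu s (cf (Eh (Xv z ('X * x)^:P)) s).
  (* The power of 0 retains the coordinates with the lowest weight vector in the last factor, where
     (t - z_n s) x vanishes; in the other factors this element is (z_i - z_n) s times x, which
     accounts for the rescaling. *)
  pose c (l : tidx a) : {poly K} := (mu s [ffun m => (m == l)%:R])%:P *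
     (\prod_i ((l i)`!%:R^-1)%:P * ((\prod_i ((init z i - zn) *: 'X) ^+ l (widen_ord (leqnSn n) i)) * 0 ^+ l ord_max)).
  pose h (l : tidx a) i : {poly {poly K}} := 'X^(l (widen_ord (leqnSn n) i)).
  have Xy x i : Xv z (y x) (widen_ord (leqnSn n) i) = ((init z i - zn) *: 'X) * Xv (init z) x^:P i.
    rewrite /y XvD XvM [Xv z 'X%:P _]hornerC rmorphM /= XvM map_polyX {1}/Xv hornerX.
    rewrite map_polyZ /= /Xv hornerZ /= -/(init z i) -[in LHS]/(z _) /= mulrA -mulrDl; congr (_ * _).
    by rewrite mulrC mul_polyC -scalerDl.
  have Xyn x : Xv z (y x) ord_max = 0.
    rewrite /y XvD XvM [Xv z 'X%:P _]hornerC rmorphM /= XvM map_polyX {1}/Xv hornerX.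
    rewrite map_polyZ /= /Xv hornerZ /= mulrA -mulrDl -/zn.
    by rewrite ['X * _]mulrC mul_polyC -scalerDl subrr scale0r mul0r.
  have EhE x l : c l * \prod_i (h l i).[Xv (init z) x^:P i] =
      (mu s [ffun m => (m == l)%:R])%:P * Eh (Xv z (y x)) l.
    rewrite /c /Eh -!mulrA; congr (_ * (_ * _)).
    rewrite [RHS]big_ord_recr /= Xyn mulrCA [RHS]mulrC; congr (_ * _).
    rewrite -big_split; apply: eq_bigr => i _.
    by rewrite /h hornerXn Xy exprMn.
  have fE x j : (\sum_l c l * \prod_i (h l i).[Xv (init z) x^:P i])`_j =
      mu s (cf (Eh (Xv z (y x))) j).
    rewrite coef_sum (_ : cf _ j = \sum_l ((Eh (Xv z (y x)) l)`_j : K) *: [ffun m : tidx a => (m == l)%:R : K^o]).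
      rewrite mu_sum; apply: eq_bigr => l _.
      by rewrite EhE coefCM muZ mulrC.
    apply/ffunP => m; rewrite ffunE sum_ffunE (bigD1 m) //= !ffunE eqxx big1 ?addr0.
      by rewrite /GRing.scale /= mulr1.
    by move=> l /negPf lm; rewrite !ffunE eq_sym lm scaler0.
  have [|x j js|lam' lam'E] := @fusion_functional_prod K n (init a) (init z) _ c h s.
  - by move=> l i; rewrite size_polyXn.
  - by rewrite fE coef0 (muF _ j) //; apply: rees_Eh.
  exists lam' => x; rewrite lam'E fE.
  have [R rR ER] := @Eh_mod_s K n.+1 a z ('X * x)^:P (- zn *: x)^:P.
  have -> : cf (Eh (Xv z (y x))) s = cf (Eh (Xv z ('X * x)^:P)) s + cf (fun m => 'X * R m) s.
    by apply/ffunP => m; rewrite !ffunE ER coefD.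
  rewrite muD [X in _ + X](_ : _ = 0) ?addr0 //.
  case: (posnP s) => [s0|sp].
    rewrite (_ : cf _ s = 0) ?mu_0 //.
    by apply/ffunP => m; rewrite !ffunE s0 coefXM.
  apply: (@muF s s.-1); first by rewrite prednK.
  rewrite (_ : cf _ s = cf R s.-1) //.
  by apply/ffunP => m; rewrite !ffunE coefXM gtn_eqF.
have [lam' lam'E] := choice step.
pose f v : K^o := \sum_s lam' s v.
have flin : linear f.
  move=> c u v; rewrite /f scaler_sumr -big_split /=; apply: eq_bigr => i _.
  by rewrite linearP.
pose fb := GRing.isLinear.Build K _ K^o *:%R f flin.
exists (HB.pack f fb : {linear fusion (init a) (init z) -> K^o}) => x /=.
by rewrite lamE; apply: eq_bigr => s _; rewrite lam'E.
Qed.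

End Embedding.

Lemma exp_nilp_linear (K : fieldType) (V : vectType K) (T : {linear V -> V}) :
  linear (exp_nilp T).
Proof.
move=> c u v; rewrite /exp_nilp scaler_sumr -big_split /=; apply: eq_bigr => k _.
by rewrite iter_linear scalerDr !scalerA mulrC.
Qed.

Lemma exp_nilpZ (K : fieldType) (V : vectType K) (T : {linear V -> V}) c w :
  exp_nilp T (c *: w) = c *: exp_nilp T w.
Proof.
have := exp_nilp_linear T c w 0; rewrite addr0 => ->.
by rewrite /exp_nilp [X in _ + X]big1 ?addr0 // => k _; rewrite linear0 scaler0.
Qed.

Section Reflection.
Variables (K : numFieldType) (n : nat) (a : 'I_n.+1 -> nat) (z : 'I_n.+1 -> K).

Lemma qpoly_const (c : K) : exists p : {poly %/ ('X^(n.+1) : {poly K})}, (p : {poly K}) = c%:P.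
Proof. by exists (c *: 1); rewrite poly_of_qpolyZ /= alg_polyC. Qed.

(** Translation by c is exp(c e_0), so [A k] is e_0^k / k!. Being polynomial in c, it makes the
    charts polynomial in u_0. *)
Lemma ev_translation :
  exists (M : nat) (A : nat -> {linear fusion a z -> fusion a z}),
    forall c x, ev a z (c%:P + x) = \sum_(k < M) c ^+ k *: A k (ev a z x).
Proof.
have [p1 p1E] := qpoly_const 1.
pose T := fusion_cur (a := a) (z := z) (sl2_e K) p1.
have TZ b w : T (b *: w) = b *: T w by rewrite /T linearZ.
pose Af k w := (k`!%:R^-1) *: iter k T w.
have Alin k : linear (Af k).
  rewrite /Af; by move=> c u v; rewrite iter_linear scalerDr !scalerA mulrC.
pose Ab k := GRing.isLinear.Build K (fusion a z) (fusion a z) *:%R (Af k) (Alin k).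
pose Al k : {linear fusion a z -> fusion a z} := HB.pack (Af k) (Ab k).
exists (\dim {: fusion a z}).+1.
exists Al => c x /=; rewrite /Af.
have [p pE] := qpoly_const c.
rewrite addrC -pE -exp_e_ev; apply: eq_bigr => k _.
rewrite scalerA mulrC -scalerA; congr (_ *: _).
have TE w : fusion_cur (a := a) (z := z) (sl2_e K) p w = c *: T w.
  rewrite /T /fusion_cur scaler_sumr; apply: eq_bigr => j _.
  by rewrite scalerA pE p1E !coefC; case: eqP; rewrite ?mulr1 ?mulr0.
elim: (nat_of_ord k) => [|k' IH]; first by rewrite expr0 scale1r.
by rewrite !iterS IH TE TZ scalerA exprS.
Qed.

(* The Weyl group element exp(e) exp(-f) exp(e) acts by y |-> - 1 / y. *)
Lemma ev_reflection :
  exists S : {linear fusion a z -> fusion a z},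
    forall x y : {poly K}, y`_0 != 0 -> eqlt n.+1 (x * y) (-1) ->
      S (ev a z y) = (- y`_0) ^+ (\sum_i (a i).-1) *: ev a z x.
Proof.
have [p1 p1E] := qpoly_const 1; have [pm pmE] := qpoly_const (-1).
pose T1 := fusion_cur (a := a) (z := z) (sl2_e K) p1.
pose T2 := fusion_cur (a := a) (z := z) (sl2_f K) pm.
pose S w := exp_nilp T1 (exp_nilp T2 (exp_nilp T1 w)).
have Slin : linear S by move=> c u v; rewrite /S !exp_nilp_linear.
pose Sb := GRing.isLinear.Build K (fusion a z) (fusion a z) *:%R S Slin.
exists (HB.pack S Sb : {linear fusion a z -> fusion a z}) => x y y0 xy /=.
rewrite /S /T1 exp_e_ev p1E /T2.
(* The three exponentials take y to y + 1, then to (y + 1) / (- y) = - 1 / y - 1, then to - 1 /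
   y. *)
have kE : 1 + take_poly n.+1 (pm : {poly K}) * (y + 1%:P) = - y.
  rewrite pmE take_poly_id; first by rewrite polyCN mulN1r opprD addrCA subrr addr0.
  by rewrite (leq_trans (size_polyC_leq1 _)).
rewrite (@exp_f_ev _ _ a z pm _ (x - 1)) kE ?coefN ?oppr_eq0 //; last first.
  rewrite mulrBl mul1r mulrN opprK addrC; apply: eqltD => //.
  by move=> j jn; rewrite coefN xy // coefN opprK.
by rewrite exp_nilpZ exp_e_ev p1E subrK.
Qed.

End Reflection.

(** * Functionals given by minors *)

Definition coefmx (K : fieldType) m (h : 'I_m -> {poly K}) : 'M[K]_m := \matrix_(i, j) (h i)`_j.

Section Minors.
Variables (K : fieldType).

(* Evaluating m polynomials at the m points s zeta_j gives a matrix whose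
   determinant is, to leading order in s, a Vandermonde determinant times the
   determinant of the matrix of the coefficients of 1, ..., t^(m - 1). *)
Lemma det_evaluation m (h : 'I_m -> {poly K}) (zeta : 'I_m -> K) (A : 'M[{poly K}]_m) :
  injective zeta -> (forall i j k, (A i j)`_k = (h i)`_k * zeta j ^+ k) ->
  exists q, \det A = (\det (Vandermonde m (\row_j zeta j)))%:P *
     'X^(\sum_(j < m) j) * ((\det (coefmx h))%:P + 'X * q).
Proof.
move=> zinj AE; pose V := Vandermonde m (\row_j zeta j).
have dV : V \in unitmx.
  rewrite unitmxE unitfE det_Vandermonde; apply/prodf_neq0 => i _; apply/prodf_neq0 => j ij.
  by rewrite !mxE subr_eq0; apply: contraL ij => /eqP/zinj ->; rewrite ltnn.
(* The inverse Vandermonde matrix removes from column l every coefficient of s^k with k < m other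
   than k = l; so s^l divides column l, and the quotients have constant terms [coefmx h]. *)
pose C := A *m map_mx polyC (invmx V).
pose D : 'M[{poly K}]_m := \matrix_(i, l) drop_poly l (C i l).
have CE i l k : (C i l)`_k = (h i)`_k * \sum_j zeta j ^+ k * invmx V j l.
  rewrite !mxE coef_sum mulr_sumr; apply: eq_bigr => j _.
  by rewrite mxE coefMC AE mulrA.
have Cm i l (k : 'I_m) : (C i l)`_k = (h i)`_k * (k == l)%:R.
  rewrite CE; congr (_ * _); have /matrixP/(_ k l) := mulmxV dV.
  by rewrite !mxE => <-; apply: eq_bigr => j _; rewrite !mxE.
have CD : C = D *m diag_mx (\row_l 'X^l).
  apply/matrixP => i l; rewrite mul_mx_diag !mxE.
  rewrite -{1}[LHS](poly_take_drop l) (_ : take_poly _ _ = 0) ?add0r ?mxE //.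
  apply/polyP => k; rewrite coef_take_poly coef0; case: ltnP => // kl.
  have := Cm i l (Ordinal (ltn_trans kl (ltn_ord l))); rewrite !mxE /= => ->.
  by rewrite -val_eqE /= ltn_eqF ?mulr0.
have AC : A = C *m map_mx polyC V.
  by rewrite /C -mulmxA -map_mxM mulVmx // map_mx1 mulmx1.
have dD : (\det D)`_0 = \det (coefmx h).
  rewrite -horner_coef0 -[LHS]/(horner_eval 0 _) -det_map_mx; congr (\det _).
  apply/matrixP => i l; rewrite !mxE /= /horner_eval horner_coef0 coef_drop_poly add0n.
  by have := Cm i l l; rewrite !mxE eqxx mulr1.
exists (drop_poly 1 (\det D)).
rewrite AC det_mulmx det_map_mx CD det_mulmx det_diag mulrC -mulrA; congr (_ * _).
rewrite mulrC; congr (_ * _).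
  by rewrite -prodrXr; apply: eq_bigr => l _; rewrite mxE.
rewrite -{1}[\det D](poly_take_drop 1); congr (_ + _); last by rewrite mulrC.
apply/polyP => k; rewrite coef_take_poly coefC -dD; case: k => //.
Qed.

Lemma size_prod_le (R : idomainType) (I : finType) (P : pred I) (F : I -> {poly R}) (k : I -> nat) :
  (forall i, P i -> (size (F i) <= (k i).+1)%N) ->
  (size (\prod_(i | P i) F i)%R <= (\sum_(i | P i) k i).+1)%N.
Proof.
move=> Fk; elim/big_ind2: _ => //; first by rewrite size_polyC leq_b1.
move=> x1 y1 x2 y2 h1 h2; rewrite (leq_trans (size_polyMleq _ _)) //.
by rewrite -subn1 leq_subLR add1n -addSn -addnS leq_add.
Qed.

End Minors.

Section MinorFunctional.
Variables (K : numFieldType) (n : nat) (a : 'I_n -> nat) (z : 'I_n -> K).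
Hypothesis zinj : injective z.
Variables (L : finType) (m : L -> nat) (e : forall r, 'I_(m r) -> 'I_n).
Hypothesis einj : forall r, injective (@e r).
Hypothesis ea : forall i, (#|[pred r | i \in codom (@e r)]| < a i)%N.

(** The r-th family is evaluated at the points z_i s of the factors listed by [e r]. In the expanded
    product of determinants X_i occurs at most once for each r whose list contains i, hence to a
    power less than a_i. The lowest power of s, the sum over r of m_r (m_r - 1) / 2, is the same for
    all x, and its coefficient is the product of minors up to a nonzero Vandermonde constant. *)
Lemma minors_functional (p : forall r, 'I_(m r) -> {poly K} * {poly K}) :
  exists lam : {linear fusion a z -> K^o}, forall x,
    lam (ev a z x) = \prod_r \det (coefmx (fun i => (p r i).2 - x * (p r i).1)).
Proof.
pose A x r : 'M[{poly K}]_(m r) :=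
  \matrix_(i, j) (Xv z (p r i).2^:P (e j) - Xv z x^:P (e j) * Xv z (p r i).1^:P (e j)).
pose T_ r : finType := 'S_(m r).
pose c (s : {dffun forall r, T_ r}) : {poly K} := \prod_r (-1) ^+ (s r).
pose lin r i l : {poly {poly K}} := (Xv z (p r i).2^:P l)%:P - (Xv z (p r i).1^:P l) *: 'X.
pose h (s : {dffun forall r, T_ r}) l : {poly {poly K}} :=
  \prod_r \prod_(i | e (s r i) == l) lin r i l.
have hE x : \prod_r \det (A x r) = \sum_s c s * \prod_l (h s l).[Xv z x^:P l].
  rewrite /determinant (@prod_sum_dffun _ _ T_ (fun r (s : 'S_(m r)) => (-1) ^+ s * \prod_i A x r i (s i))).
  apply: eq_bigr => s _; rewrite big_split /=; congr (_ * _).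
  under [RHS]eq_bigr do rewrite horner_prod.
  rewrite exchange_big /=; apply: eq_bigr => r _.
  rewrite (partition_big (fun i => e (s r i)) xpredT) //=; apply: eq_bigr => l _.
  rewrite horner_prod; apply: eq_bigr => i /eqP <-.
  by rewrite /lin !mxE !hornerE mulrC.
have sz s l : (size (h s l) <= a l)%N.
  apply: leq_trans (ea l); rewrite -sum1_card.
  have -> : (\sum_(r in [pred r | l \in codom (@e r)]) 1 = \sum_r (l \in codom (@e r)))%N.
    by rewrite big_mkcond /=; apply: eq_bigr => r _; rewrite inE; case: ifP.
  apply: size_prod_le => r _.
  have : (size (\prod_(i | e (s r i) == l) lin r i l)%R <= (\sum_(i | e (s r i) == l) 1).+1)%N.
    apply: size_prod_le => i _; rewrite /lin (leq_trans (size_polyD _ _)) // geq_max size_polyN.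
    rewrite (leq_trans (size_polyC_leq1 _)) //=.
    by rewrite (leq_trans (size_scale_leq _ _)) // size_polyX.
  move=> /leq_trans; apply; rewrite ltnS.
  case: (boolP (l \in codom _)) => [_|lne].
    rewrite sum1_card; apply/card_le1_eqP => i j /eqP Ei /eqP Ej.
    by apply: (@perm_inj _ (s r)); apply: einj; apply: val_inj; rewrite /= Ei Ej.
  rewrite big1 // => i /eqP El; case/negP: lne; rewrite -El; exact: codom_f.
pose d := (\sum_r \sum_(j < m r) j)%N.
pose V r := \det (Vandermonde (m r) (\row_j z (e j))).
have V0 r : V r != 0.
  rewrite /V det_Vandermonde; apply/prodf_neq0 => i _; apply/prodf_neq0 => j ij.
  rewrite !mxE subr_eq0; apply: contraL ij => /eqP E.
  by rewrite (einj (zinj E)) ltnn.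
have FE x : exists q, \sum_s c s * \prod_l (h s l).[Xv z x^:P l] =
   'X^d * ((\prod_r V r * \prod_r \det (coefmx (fun i => (p r i).2 - x * (p r i).1)))%:P + 'X * q).
  rewrite -hE /d -prodrXr -big_split /= rmorph_prod /=.
  elim/big_ind3: _ => //.
  - by exists 0; rewrite mulr0 addr0 mulr1.
  - move=> x1 y1 z1 x2 y2 z2 [q1 ->] [q2 ->].
    by exists (x1 * q2 + q1 * x2 + 'X * q1 * q2); ring.
  move=> r _; pose zeta j := z (@e r j).
  have [||q ->] := @det_evaluation K (m r) (fun i => (p r i).2 - x * (p r i).1) zeta (A x r).
  - by move=> j j' /zinj/einj.
  - move=> i j k; rewrite mxE -XvM -rmorphM /= coefB !coef_Xv -mulrBl coefB.
    by rewrite /zeta.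
  exists ((V r)%:P * q); rewrite rmorphM /= -/(V r).
  by rewrite mulrDr !mulrA [_ * 'X]mulrC; ring.
have [||lam lamE] := @fusion_functional_prod K n a z _ c h d.
- by [].
- by move=> x j jd; have [q ->] := FE x; rewrite coefXnM jd coef0.
have Vn0 : \prod_r V r != 0 by apply/prodf_neq0.
pose f v : K^o := (\prod_r V r)^-1 * lam v.
have flin : linear f.
  by move=> b u v; rewrite /f linearP mulrDr /GRing.scale /= mulrCA.
pose fb := GRing.isLinear.Build K (fusion a z) K^o *:%R f flin.
exists (HB.pack f fb : {linear fusion a z -> K^o}) => x /=.
rewrite /f lamE; have [q ->] := FE x.
by rewrite coefXnM ltnn subnn coefD coefC coefXM addr0 mulKf.
Qed.

End MinorFunctional.

(** * Charts *)

Definition fshift T (f : nat -> T) : nat -> T := fun i => f i.+1.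

Definition scons T (c : T) (f : nat -> T) : nat -> T := fun i => if i is j.+1 then f j else c.

Section Charts.
Variable K : numFieldType.
Implicit Types (eps : nat -> bool) (u : nat -> K) (x y q : {poly K}).

(* The chart of index eps: modulo t^n, x = u_0 + t x_1 or x = - 1 / (u_0 + t x_1)
   according to eps_0, and x_1 is in turn given by u_1, u_2, ... modulo t^(n - 1). *)
Fixpoint chart_rel n eps u x : Prop :=
  if n is n'.+1 then
    exists2 y, chart_rel n' (fshift eps) (fshift u) y &
      if eps 0%N then u 0%N != 0 /\ eqlt n (x * ((u 0%N)%:P + 'X * y)) (-1)
      else eqlt n x ((u 0%N)%:P + 'X * y)
  else True.

Lemma chart_rel_ex n eps u : (forall i, eps i -> u i != 0) -> exists x, chart_rel n eps u x.
Proof.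
elim: n eps u => [|n IH] eps u un0; first by exists 0.
have [y yR] := IH (fshift eps) (fshift u) (fun i => un0 i.+1).
case E : (eps 0%N); last by exists ((u 0%N)%:P + 'X * y), y; rewrite ?E.
have Y0 : ((u 0%N)%:P + 'X * y)`_0 != 0.
  by rewrite coefD coefC coefXM addr0 un0.
have [x xE] := eqlt_inv n.+1 (-1) Y0.
by exists x, y; rewrite ?E //; split=> //; apply: un0.
Qed.

(** At each level x is kept if its constant term has norm at most 1; otherwise - 1 / x has a
    constant term of norm less than 1. *)
Lemma chart_rel_cover n x :
  exists eps u, chart_rel n eps u x /\ forall i, `|u i| <= 1.
Proof.
elim: n x => [|n IH] x; first by exists (fun=> false), (fun=> 0); split=> // i; rewrite normr0.
have split0 y : y = (y`_0)%:P + 'X * drop_poly 1 y.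
  rewrite -{1}(poly_take_drop 1 y) mulrC; congr (_ + _).
  by apply/polyP => k; rewrite coef_take_poly coefC; case: k.
have [x0|x0] := real_leP (normr_real x`_0) (real1 K).
  have [eps [u [uR u1]]] := IH (drop_poly 1 x).
  exists (scons false eps), (scons x`_0 u); split; last by case.
  by exists (drop_poly 1 x) => //=; rewrite -split0.
have xn0 : x`_0 != 0 by rewrite -normr_gt0 (lt_trans ltr01).
have [y yE] := eqlt_inv n.+1 (-1) xn0.
have [eps [u [uR u1]]] := IH (drop_poly 1 y).
have y0 : y`_0 = - (x`_0)^-1.
  have := yE 0%N isT; rewrite coef0M coefN coefC /= => /(canRL (mulfK xn0)) ->.
  by rewrite mulN1r.
exists (scons true eps), (scons y`_0 u); split.
  exists (drop_poly 1 y) => //=; rewrite -split0; split; last by rewrite mulrC.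
  by rewrite y0 oppr_eq0 invr_eq0.
case=> //=; rewrite y0 normrN normfV invf_le1 ?normr_gt0 //; exact: ltW.
Qed.

(** Accumulates the scalars of the reflections. It may vanish with an inverted coordinate, so [ev]
    is multiplied by it rather than the polynomial map divided. *)
Fixpoint chart_scale n (a : 'I_n -> nat) eps u : K :=
  match n return ('I_n -> nat) -> K with
  | 0 => fun=> 1
  | n'.+1 => fun a => (if eps 0%N then (- u 0%N) ^+ (\sum_i (a i).-1) else 1) *
      chart_scale (init a) (fshift eps) (fshift u)
  end a.

(** A chart is stored as a finite sum of monomials in u with vector coefficients. One level applies
    the embedding, the translation by u_0, which contributes the new exponent, and the reflection if
    eps_0 holds. *)
Lemma chart_exists n (a : 'I_n -> nat) (z : 'I_n -> K) eps :
  exists (I : finType) (ex : I -> nat -> nat) (w : I -> fusion a z),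
    forall u x, chart_rel n eps u x ->
      \sum_b (\prod_(i < n) u i ^+ ex b i) *: w b = chart_scale a eps u *: ev a z x.
Proof.
elim: n a z eps => [|n IH] a z eps.
  exists 'I_1, (fun _ _ => 0%N), (fun=> ev a z 0) => u x _ /=.
  rewrite big_ord1 big_ord0; congr (_ *: _).
  by apply: ev_congr.
have [I [ex [w wE]]] := IH (init a) (init z) (fshift eps).
have [iota iotaE] := fusion_embedding a z.
have [M [A AE]] := ev_translation a z.
have [S SE] := ev_reflection a z.
pose S' v := if eps 0%N then S v else v.
have S'lin : linear S' by move=> c u v; rewrite /S'; case: ifP => // _; rewrite linearP.
pose Sb := GRing.isLinear.Build K (fusion a z) (fusion a z) *:%R S' S'lin.
pose Sl : {linear fusion a z -> fusion a z} := HB.pack S' Sb.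
have S0 : S' 0 = 0 by exact: (linear0 Sl).
have SZ c v : S' (c *: v) = c *: S' v by rewrite -[c *: v]addr0 S'lin S0 addr0.
have Ssum (J : finType) (G : J -> fusion a z) : S' (\sum_j G j) = \sum_j S' (G j).
  exact: (linear_sum Sl).
exists (I * 'I_M : finType)%type, (fun bk : I * 'I_M => scons (bk.2 : nat) (ex bk.1)),
  (fun bk : I * 'I_M => S' (A bk.2 (iota (w bk.1)))).
move=> u x [y yR xE].
transitivity (S' (\sum_(k < M) u 0%N ^+ k *: A k (iota
    (\sum_b (\prod_(i < n) fshift u i ^+ ex b i) *: w b)))).
  rewrite Ssum -(pair_bigA _ (fun b (k : 'I_M) => (\prod_(i < n.+1) u i ^+ scons (k : nat) (ex b) i) *: S' (A k (iota (w b))))) /=.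
  rewrite exchange_big /=; apply: eq_bigr => k _.
  rewrite SZ !linear_sum /= Ssum scaler_sumr; apply: eq_bigr => b _.
  by rewrite !linearZ SZ /= scalerA big_ord_recl.
rewrite (wE _ y yR) linearZ iotaE /=.
under eq_bigr do rewrite linearZ scalerA mulrC -scalerA.
rewrite -scaler_sumr -AE SZ /= [_ * chart_scale _ _ _]mulrC -[RHS]scalerA; congr (_ *: _).
rewrite /S'; case: ifP xE => _; last by move=> /ev_congr ->; rewrite scale1r.
case=> u0 xE.
have Y0 : ((u 0%N)%:P + 'X * y)`_0 = u 0%N by rewrite coefD coefC coefXM addr0.
by rewrite (SE x) ?Y0.
Qed.

End Charts.

(** * Lattice coordinates, polynomial in the chart parameters *)

Section Coordinates.
Variable K : numFieldType.
Implicit Types (eps : nat -> bool) (u v : nat -> K) (x y : {poly K}) (p q : {poly K} * {poly K}).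

(** If x = - 1 / Y, then r - x q = - (r' - Y q') / Y for (q', r') = (r, - q): up to a unit the swap
    turns a condition on x into the same condition on Y. *)
Definition swap (b : bool) p := if b then (p.2, - p.1) else p.
Definition unswap (b : bool) p := if b then (- p.2, p.1) else p.

Definition co_head b (c : K) p := (swap b p).2 - c *: (swap b p).1.
Definition co_next b c p := ((swap b p).1, drop_poly 1 (co_head b c p)).

(* Linear forms on K[t]^2 whose common kernel for j < m is the lattice
   {(q, r) | r = x q mod t^m} when x is given by u in the chart eps; unlike x,
   they are polynomial in u. *)
Fixpoint co eps u p j : K :=
  if j is j'.+1 then co (fshift eps) (fshift u) (co_next (eps 0%N) (u 0%N) p) j'
  else (co_head (eps 0%N) (u 0%N) p)`_0.

Definition comx m eps u (p : 'I_m -> {poly K} * {poly K}) : 'M[K]_m :=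
  \matrix_(i, j) co eps u (p i) j.

Fixpoint det_scale m eps u : K :=
  if m is m'.+1 then (if eps 0%N then (- u 0%N) ^+ m else 1) *
    det_scale m' (fshift eps) (fshift u) else 1.

Lemma det_coefmxM m y (h : 'I_m -> {poly K}) :
  \det (coefmx (fun i => h i * y)) = y`_0 ^+ m * \det (coefmx h).
Proof.
pose T : 'M[K]_m := \matrix_(i, j) if (j <= i)%N then y`_(i - j) else 0.
have -> : coefmx (fun i => h i * y) = coefmx h *m T^T.
  apply/matrixP => i j; rewrite !mxE coefM.
  rewrite (big_ord_widen _ (fun k => (h i)`_k * y`_(j - k)) (ltn_ord j)) big_mkcond /=.
  by apply: eq_bigr => k _; rewrite !mxE ltnS; case: leqP; rewrite ?mulr0.
rewrite det_mulmx det_tr mulrC det_trig; last first.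
  by apply/is_trig_mxP => i j ij; rewrite mxE leqNgt ij.
rewrite (eq_bigr (fun=> y`_0)) ?prodr_const ?card_ord // => i _.
by rewrite mxE leqnn subnn.
Qed.

Lemma coefmx_eqlt m (h h' : 'I_m -> {poly K}) : (forall i, eqlt m (h i) (h' i)) ->
  coefmx h = coefmx h'.
Proof. by move=> hh; apply/matrixP => i j; rewrite !mxE hh. Qed.

Lemma split_coef0 y : y = (y`_0)%:P + 'X * drop_poly 1 y.
Proof.
rewrite -{1}(poly_take_drop 1 y) mulrC; congr (_ + _).
by apply/polyP => k; rewrite coef_take_poly coefC; case: k.
Qed.

(** Up to the factor - Y, the row polynomial is its constant term, which is [co] at 0, plus t times
    the row polynomial of the next level. Expansion along the first column therefore leaves minors
    to which the induction applies. *)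
Lemma det_coefmx_co m n eps u x (p : 'I_m -> {poly K} * {poly K}) :
  (m <= n)%N -> chart_rel n eps u x ->
  \det (coefmx (fun i => (p i).2 - x * (p i).1)) * det_scale m eps u =
  \det (comx eps u p).
Proof.
elim: m n eps u x p => [|m IH] [|n] eps u x p // mn.
  by move=> _; rewrite !det_mx00 mul1r.
  by move=> _; rewrite !det_mx00 mul1r.
case=> y yR xE; pose b := eps 0%N; pose Y := (u 0%N)%:P + 'X * y.
pose nx i := co_next b (u 0%N) (p i).
pose g i := (co eps u (p i) 0)%:P + 'X * ((nx i).2 - y * (nx i).1).
have gE i : g i = (swap b (p i)).2 - Y * (swap b (p i)).1.
  rewrite /g mulrBr addrA -split_coef0 /Y /co_head /= /nx /=.
  by rewrite -mul_polyC; ring.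
have dg : \det (coefmx g) =
    (if b then (- u 0%N) ^+ m.+1 else 1) * \det (coefmx (fun i => (p i).2 - x * (p i).1)).
  rewrite /b; case: (eps 0%N) xE @b nx g gE => xE b nx g gE.
    have Y0 : (- Y)`_0 = - u 0%N by rewrite coefN coefD coefC coefXM addr0.
    rewrite -Y0 -det_coefmxM; congr (\det _); apply: coefmx_eqlt => i.
    rewrite gE /= (_ : - _ - _ = (p i).2 * - Y + (p i).1 * -1); last by ring.
    have -> : ((p i).2 - x * (p i).1) * - Y = (p i).2 * - Y + (p i).1 * (x * Y) by ring.
    apply: eqltD => //; apply: eqltM => //.
    by apply: eqlt_sym; case: xE => _; apply: eqlt_le.
  rewrite mul1r; congr (\det _); apply: coefmx_eqlt => i; rewrite gE /=.
  apply: eqltD => //; apply: eqltN; apply: eqltM => //; apply: eqlt_sym.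
  exact: eqlt_le xE.
rewrite /= mulrA [\det _ * _]mulrC -/b -dg.
rewrite (expand_det_col _ ord0) [RHS](expand_det_col _ ord0) mulr_suml.
apply: eq_bigr => i _; rewrite !mxE coefD coefC coefXM /= addr0 -mulrA; congr (_ * _).
rewrite /cofactor -mulrA; congr (_ * _).
rewrite (_ : row' i _ = coefmx (fun k => (nx (lift i k)).2 - y * (nx (lift i k)).1)); last first.
  by apply/matrixP => k l; rewrite !mxE /g coefD coefC coefXM /= add0r.
rewrite (IH n _ _ _ (fun k => nx (lift i k)) _ yR) //; congr (\det _).
by apply/matrixP => k l; rewrite !mxE.
Qed.

(** The pairs (i, r) with r < a_i - 1 are counted in two ways. As [a] is nondecreasing, dropping the
    last index lowers every nonzero count by exactly one, which is the recursion of [det_scale]. *)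
Lemma prod_det_scale n (a : 'I_n -> nat) eps u B :
  (forall i, (a i <= B)%N) -> (forall i j : 'I_n, (i <= j)%N -> (a i <= a j)%N) ->
  \prod_(r < B) det_scale #|[pred i | (r < (a i).-1)%N]| eps u = chart_scale a eps u.
Proof.
elim: n a eps u => [|n IH] a eps u aB am /=.
  rewrite big1 // => r _.
  by have := max_card [pred i | (r < (a i).-1)%N]; rewrite card_ord leqn0 => /eqP ->.
rewrite -IH; last first.
- by move=> i j ij; apply: am.
- by move=> i; apply: aB.
have card_init (r : nat) : #|[pred i | (r < (a i).-1)%N]| =
    (#|[pred i | (r < (init a i).-1)%N]| + (r < (a ord_max).-1))%N.
  rewrite -!sum1_card big_mkcond big_ord_recr /= [in RHS]big_mkcond /=; congr (_ + _)%N; by case: (_ < _)%N.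
have fE : (if eps 0%N then (- u 0%N) ^+ (\sum_i (a i).-1) else 1) =
    \prod_(r < B) (if eps 0%N then (- u 0%N) ^+ #|[pred i | (r < (a i).-1)%N]| else 1).
  case: (eps 0%N); last by rewrite big1.
  rewrite prodrXr; congr (_ ^+ _); under [RHS]eq_bigr do rewrite -sum1_card big_mkcond /=.
  rewrite exchange_big /=; apply: eq_bigr => i _.
  rewrite -big_mkcond sum1_card /=.
  have le : ((a i).-1 <= B)%N by rewrite (leq_trans (leq_pred _)).
  rewrite -[LHS]card_ord -sum1_card (big_ord_widen _ (fun=> 1%N) le) sum1_card.
  by apply: eq_card => r.
rewrite fE -big_split; apply: eq_bigr => r _; rewrite card_init.
case: ltnP => rl; first by rewrite addn1.
rewrite eq_card0 /=; first by case: ifP; rewrite ?expr0 mul1r.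
move=> i; rewrite inE; apply/negbTE; rewrite -leqNgt (leq_trans _ rl) //.
have := am (widen_ord (leqnSn n) i) ord_max (ltnW (ltn_ord i)); rewrite /init; lia.
Qed.

End Coordinates.

Lemma eq_pair T U (p q : T * U) : p.1 = q.1 -> p.2 = q.2 -> p = q.
Proof. by case: p q => p1 p2 [q1 q2] /= -> ->. Qed.

Lemma drop1_mulX (K : fieldType) (p : {poly K}) : drop_poly 1 ('X * p) = p.
Proof. by apply/polyP => k; rewrite coef_drop_poly addn1 coefXM. Qed.

Section DualVectors.
Variable K : numFieldType.
Implicit Types (eps : nat -> bool) (u v : nat -> K) (x y : {poly K}) (p q : {poly K} * {poly K}).

Lemma unswapK b : cancel (@unswap K b) (swap b).
Proof. by case: b => -[p1 p2] //=; rewrite /swap /= opprK. Qed.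

(* Inverts the recursion of [co]. *)
Fixpoint lattice_vec m eps u (al be : K) : {poly K} * {poly K} :=
  if m is m'.+1 then
    let q := lattice_vec m' (fshift eps) (fshift u) al be in
    unswap (eps 0%N) (q.1, u 0%N *: q.1 + 'X * q.2)
  else unswap (eps 0%N) (al%:P, be%:P).

Lemma co0 eps u j : co eps u (0, 0) j = 0.
Proof.
elim: j eps u => [|j IH] eps u /=.
  by rewrite /co_head /swap; case: ifP; rewrite /= ?oppr0 scaler0 subr0 coef0.
rewrite (_ : co_next _ _ _ = (0, 0)) //.
by rewrite /co_next /co_head /swap; case: ifP => _; apply: eq_pair;
  rewrite /= ?oppr0 ?scaler0 ?subr0 ?linear0.
Qed.

Lemma co_lattice_vec_lt m eps u al be j : (j < m)%N -> co eps u (lattice_vec m eps u al be) j = 0.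
Proof.
elim: m eps u j => // m IH eps u [|j] jm /=.
  by rewrite /co_head unswapK /= addrAC subrr add0r coefXM.
rewrite (_ : co_next _ _ _ = lattice_vec m (fshift eps) (fshift u) al be) ?IH //.
by rewrite /co_next /co_head unswapK /= addrAC subrr add0r drop1_mulX; apply: eq_pair.
Qed.

(** The vector depends only on the coordinates below m, so v may differ from u from m on, and the
    value is affine in v_m: this is how a coordinate gets read off. *)
Lemma co_lattice_vec m eps u v al be : (forall i, (i < m)%N -> v i = u i) ->
  co eps v (lattice_vec m eps u al be) m = be - v m * al.
Proof.
elim: m eps u v => [|m IH] eps u v vu /=.
  by rewrite /co_head unswapK /= coefB coefZ !coefC.
rewrite (_ : co_next _ _ _ = lattice_vec m (fshift eps) (fshift u) al be) ?IH //.
  by move=> i im; apply: vu.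
rewrite vu // /co_next /co_head unswapK /= addrAC subrr add0r drop1_mulX.
exact: eq_pair.
Qed.

Lemma co_lattice_vec_gt m eps u be j : (m < j)%N -> co eps u (lattice_vec m eps u 0 be) j = 0.
Proof.
elim: m eps u j => [|m IH] eps u [//|j] jm /=.
  rewrite (_ : co_next _ _ _ = (0, 0)) ?co0 //.
  rewrite /co_next /co_head unswapK /= scaler0 subr0; apply: eq_pair => //=.
  by apply/polyP => k; rewrite coef_drop_poly addn1 coefC coef0.
rewrite (_ : co_next _ _ _ = lattice_vec m (fshift eps) (fshift u) 0 be) ?IH //.
by rewrite /co_next /co_head unswapK /= addrAC subrr add0r drop1_mulX; apply: eq_pair.
Qed.

Lemma co_ext eps u v p j : (forall i, (i <= j)%N -> u i = v i) -> co eps u p j = co eps v p j.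
Proof.
elim: j eps u v p => [|j IH] eps u v p uv /=; first by rewrite uv.
by rewrite uv //; apply: IH => i ij; apply: uv.
Qed.

Lemma lattice_vec_ext m eps u v al be : (forall i, (i < m)%N -> u i = v i) ->
  lattice_vec m eps u al be = lattice_vec m eps v al be.
Proof.
elim: m eps u v => [|m IH] eps u v uv //=.
by rewrite uv // (IH _ _ (fshift v)) // => i im; apply: uv.
Qed.

Lemma lattice_vecD m eps u al be : lattice_vec m eps u al be =
  ((lattice_vec m eps u al 0).1 + be *: (lattice_vec m eps u 0 1).1,
   (lattice_vec m eps u al 0).2 + be *: (lattice_vec m eps u 0 1).2).
Proof.
elim: m eps u => [|m IH] eps u /=.
  by rewrite /unswap; case: ifP => _ /=; rewrite ?oppr0 ?addr0 ?add0r -?mul_polyC ?mulr0 ?mulrN ?mulr1 ?addr0 ?add0r.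
by rewrite IH /unswap; case: ifP => _; apply: eq_pair => /=; rewrite -?mul_polyC; ring.
Qed.

Lemma size_lattice_vec m eps u al be :
  (size (lattice_vec m eps u al be).1 <= m.+1)%N /\ (size (lattice_vec m eps u al be).2 <= m.+1)%N.
Proof.
elim: m eps u => [|m IH] eps u /=.
  by rewrite /unswap; case: ifP => _ /=; rewrite ?size_polyN !size_polyC_leq1.
have [s1 s2] := IH (fshift eps) (fshift u).
have s3 : (size (u 0%N *: (lattice_vec m (fshift eps) (fshift u) al be).1 +
    'X * (lattice_vec m (fshift eps) (fshift u) al be).2)%R <= m.+2)%N.
  rewrite (leq_trans (size_polyD _ _)) // geq_max; apply/andP; split.
    by rewrite (leq_trans (size_scale_leq _ _)) // leqW.
  by rewrite mulrC (leq_trans (size_polyMleq _ _)) // size_polyX addn2.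
by rewrite /unswap; case: ifP => _ /=; rewrite ?size_polyN; split => //; apply: leqW.
Qed.

End DualVectors.

(** * Functionals that isolate one chart coordinate *)

Section ChartFunctional.
Variables (K : numFieldType) (n : nat) (a : 'I_n -> nat) (z : 'I_n -> K).
Hypothesis hz : injective z.
Hypothesis ha1 : forall i, (1 < a i)%N.
Hypothesis ha : forall i j : 'I_n, (i < j)%N -> (a i < a j)%N.
Implicit Types (eps : nat -> bool) (u v : nat -> K).

Definition nlayers := (\max_i a i)%N.
(** The conjugate of the partition with parts a_i - 1, indexed from 0. *)
Definition layer (r : nat) := #|[pred i | (r < (a i).-1)%N]|.

Lemma le_nlayers i : (a i <= nlayers)%N.
Proof. exact: leq_bigmax. Qed.

Lemma layer_le r : (layer r <= n)%N.
Proof. by rewrite (leq_trans (max_card _)) ?card_ord. Qed.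

(** Here the a_i have to be distinct and greater than 1. For the index i0 = n - s - 1 and r = a_i0 -
    2, the condition a_i > r + 1 holds exactly for i at least i0, that is for s + 1 indices. *)
Lemma layer_ex s : (s < n)%N -> exists r : 'I_nlayers, layer r = s.+1.
Proof.
move=> sn; have ln : (n - s.+1 < n)%N by lia.
pose i0 := Ordinal ln.
have rB : ((a i0).-1.-1 < nlayers)%N.
  by have := le_nlayers i0; have := ha1 i0; lia.
exists (Ordinal rB); rewrite /layer /=.
have le_a (i j : 'I_n) : (i <= j)%N -> (a i <= a j)%N.
  by rewrite leq_eqVlt => /orP[/eqP/val_inj -> //|/ha/ltnW].
have E i : ((a i0).-1.-1 < (a i).-1)%N = (n - s.+1 <= i)%N.
  case: (leqP (n - s.+1) i) => h.
    by have := le_a i0 i h; have := ha1 i0; lia.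
  by have := @ha i i0 h; have := ha1 i; lia.
rewrite (eq_card (_ : _ =i [pred i : 'I_n | (n - s.+1 <= i)%N])); last by move=> i; rewrite !inE E.
have := cardC [pred i : 'I_n | (i < n - s.+1)%N]; rewrite card_ord.
have -> : #|[pred i : 'I_n | (i < n - s.+1)%N]| = (n - s.+1)%N.
  rewrite -[RHS]card_ord -[in RHS]sum1_card (big_ord_widen _ (fun=> 1%N) (ltnW ln)) sum1_card.
  by apply: eq_card.
rewrite (eq_card (_ : _ =i [pred i : 'I_n | (n - s.+1 <= i)%N])); first by lia.
by move=> i; rewrite !inE -leqNgt.
Qed.

(** By [prod_det_scale] the scalar of the chart is exactly what turns the minors in x into minors of
    [comx]; the value no longer involves x and is polynomial in u. *)
Lemma chart_functional eps (I : finType) (ex : I -> nat -> nat) (w : I -> fusion a z)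
    (p : nat -> nat -> {poly K} * {poly K}) :
  (forall u x, chart_rel n eps u x ->
      \sum_b (\prod_(i < n) u i ^+ ex b i) *: w b = chart_scale a eps u *: ev a z x) ->
  exists lam : {linear fusion a z -> K^o}, forall u x, chart_rel n eps u x ->
    lam (\sum_b (\prod_(i < n) u i ^+ ex b i) *: w b) =
    \prod_(r < nlayers) \det (comx eps u (fun i : 'I_(layer r) => p r i)).
Proof.
move=> wE.
pose e (r : 'I_nlayers) (j : 'I_(layer r)) : 'I_n := enum_val j.
have einj r : injective (@e r) by exact: enum_val_inj.
have ea i : (#|[pred r | i \in codom (@e r)]| < a i)%N.
  apply: (@leq_ltn_trans (a i).-1); last by have := ha1 i; lia.
  have le : ((a i).-1 <= nlayers)%N.
    by have := le_nlayers i; lia.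
  rewrite -[X in (_ <= X)%N]card_ord -[X in (_ <= X)%N]sum1_card.
  rewrite (big_ord_widen _ (fun=> 1%N) le) sum1_card; apply: subset_leq_card.
  apply/fintype.subsetP => r /codomP[j ->]; exact: (enum_valP j).
have [lam lamE] := @minors_functional K n a z hz _ _ _ einj ea (fun r i => p r i).
exists lam => u x xR.
rewrite (wE _ _ xR) linearZ lamE /= -(@prod_det_scale K n a eps u nlayers); last first.
- by move=> i j; rewrite leq_eqVlt => /orP[/eqP/val_inj -> //|/ha/ltnW].
- exact: le_nlayers.
rewrite /GRing.scale /= -big_split /=; apply: eq_bigr => r _.
by rewrite mulrC -(det_coefmx_co _ (layer_le r) xR).
Qed.

Definition std_layer u0 eps (r i : nat) := lattice_vec i eps u0 0 1.

Definition mod_layer u0 eps (r0 s : nat) q (r i : nat) :=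
  if (r == r0) && (i == s) then q else std_layer u0 eps r i.

Definition minors eps (p : nat -> nat -> {poly K} * {poly K}) u :=
  \prod_(r < nlayers) \det (comx eps u (fun i : 'I_(layer r) => p r i)).

Lemma det_std_layer eps u r : \det (comx eps u (fun i : 'I_(layer r) => std_layer u eps r i)) = 1.
Proof.
rewrite (_ : comx _ _ _ = 1%:M) ?det1 //; apply/matrixP => i j; rewrite !mxE /std_layer.
case: (ltngtP j i) => ij.
- by rewrite co_lattice_vec_lt // -val_eqE /= gtn_eqF.
- by rewrite co_lattice_vec_gt // -val_eqE /= ltn_eqF.
by rewrite ij co_lattice_vec // mulr0 subr0 -val_eqE /= ij eqxx.
Qed.

Lemma minors_std eps u : minors eps (std_layer u eps) u = 1.
Proof. by rewrite /minors big1 // => r _; rewrite det_std_layer. Qed.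

Lemma minors_mod0 eps u0 u (r0 : 'I_nlayers) s q : layer r0 = s.+1 ->
  (forall j, (j <= s)%N -> co eps u q j = 0) -> minors eps (mod_layer u0 eps r0 s q) u = 0.
Proof.
move=> r0s q0; rewrite /minors (bigD1 r0) //= (_ : \det _ = 0) ?mul0r //.
have sl : (s < layer r0)%N by rewrite r0s.
rewrite (expand_det_row _ (Ordinal sl)) big1 // => j _; rewrite mxE /mod_layer !eqxx /=.
by rewrite q0 ?mul0r // -ltnS -r0s.
Qed.

(** Since u agrees with u0 below s, the matrix of layer r0 is upper triangular, with diagonal
    entries 1 except for the last, which is the value of [co] on [q]. *)
Lemma minors_mod eps u0 u (r0 : 'I_nlayers) s q : layer r0 = s.+1 ->
  (forall j, (j < s)%N -> u j = u0 j) -> (forall j, (j < s)%N -> co eps u q j = 0) ->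
  minors eps (mod_layer u0 eps r0 s q) u = co eps u q s *
    \prod_(r < nlayers | r != r0) \det (comx eps u (fun i : 'I_(layer r) => std_layer u0 eps r i)).
Proof.
move=> r0s uu0 q0; rewrite /minors (bigD1 r0) //=; congr (_ * _); last first.
  apply: eq_bigr => r /negPf rr0; congr (\det _); apply/matrixP => i j; rewrite !mxE.
  by rewrite /mod_layer -(inj_eq val_inj) in rr0 *; rewrite rr0.
rewrite -det_tr det_trig; last first.
  apply/is_trig_mxP => i j ij; rewrite !mxE /mod_layer eqxx /=.
  have jl : (j <= s)%N by rewrite -ltnS -r0s.
  case: eqP => [js|js]; first by rewrite q0 // -js.
  rewrite /std_layer (@co_ext _ _ _ u0); first by rewrite co_lattice_vec_lt.
  by move=> k ki; rewrite uu0 //; lia.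
have sl : (s < layer r0)%N by rewrite r0s.
rewrite (bigD1 (Ordinal sl)) //= !mxE /mod_layer !eqxx /= big1 ?mulr1 // => i /eqP is_.
rewrite !mxE /=; case: eqP => [E|]; first by case: is_; apply: val_inj.
have il := ltn_ord i; move=> ns; rewrite /std_layer co_lattice_vec ?mulr0 ?subr0 //.
by move=> k ki; rewrite uu0 //; lia.
Qed.

End ChartFunctional.

Local Open Scope classical_set_scope.
Local Open Scope ring_scope.

(** * Topology of the orbit closure *)

Section Continuity.
Variable K : numFieldType.

Lemma continuous_sumr (T : topologicalType) (W : normedModType K) (I : finType) (F : I -> T -> W) :
  (forall i, continuous (F i)) -> continuous (fun t => \sum_i F i t).
Proof. by move=> Fc; apply: continuous_big => //; exact: add_continuous. Qed.

Lemma continuous_prodr (T : topologicalType) (I : finType) (P : pred I) (F : I -> T -> K) :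
  (forall i, P i -> continuous (F i)) -> continuous (fun t => \prod_(i | P i) F i t).
Proof. by move=> Fc; apply: continuous_big => //; exact: mul_continuous. Qed.

Lemma continuous_scale_cst (T : topologicalType) (W : normedModType K) (f : T -> K) (w : W) :
  continuous f -> continuous (fun t => f t *: w).
Proof. by move=> fc t; apply: cvgZr_tmp; exact: fc. Qed.

Lemma continuous_expr (T : topologicalType) (f : T -> K) k :
  continuous f -> continuous (fun t => f t ^+ k).
Proof.
move=> fc; elim: k => [|k IH]; first by under eq_fun do rewrite expr0; move=> t; exact: cvg_cst.
by under eq_fun do rewrite exprS; move=> t; apply: cvgM; [exact: fc | exact: IH].
Qed.

Lemma row_linear_continuous N (W : normedModType K) (f : {linear 'rV[K]_N -> W}) : continuous f.
Proof.
rewrite (_ : (f : _ -> _) = fun w => \sum_i w 0 i *: f (delta_mx 0 i)).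
  by apply: continuous_sumr => i; apply: continuous_scale_cst; exact: coord_continuous.
apply/funext => w; rewrite {1}[w]row_sum_delta linear_sum; apply: eq_bigr => i _.
by rewrite linearZ.
Qed.

Lemma closure_cofinite (s : seq K) : closure [set c | c \notin s] 0.
Proof.
move=> U /nbhs_ballP[e /= e0 eU].
pose f (k : nat) := e / k.+2%:R.
have finj : injective f.
  move=> i j /(mulfI (lt0r_neq0 e0))/invr_inj/eqP.
  by rewrite eqr_nat => /eqP[].
have [k ks] : exists k, f k \notin s.
  apply: contrapT => /forallNP H.
  have sub : {subset [seq f i | i <- iota 0 (size s).+1] <= s}.
    by move=> _ /mapP[i _ ->]; have := H i => /negP; rewrite negbK.
  have := uniq_leq_size (_ : uniq [seq f i | i <- iota 0 (size s).+1]) sub.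
  rewrite map_inj_uniq // iota_uniq size_map size_iota => /(_ isT).
  by rewrite ltnn.
exists (f k); split=> //; apply: eU; rewrite -ball_normE /= sub0r normrN ger0_norm.
  by rewrite ltr_pdivrMr ?ltr0Sn // ltr_pMr // ltr1n.
by rewrite divr_ge0 // ltW.
Qed.

Lemma closed_cofinite (T : topologicalType) (g : K -> T) (Q : set T) (s : seq K) :
  {for 0, continuous g} -> closed Q -> (forall c, c \notin s -> Q (g c)) -> Q (g 0).
Proof.
move=> gc clQ gQ; apply: clQ => U /gc gU.
by have [c [cs gUc]] := @closure_cofinite s _ gU; exists (g c); split=> //; apply: gQ.
Qed.

Lemma closure_sub (T : topologicalType) (A Q : set T) : closed Q -> A `<=` Q -> closure A `<=` Q.
Proof. by move=> clQ AQ x clx; apply: clQ; apply: closure_subset clx. Qed.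

Lemma closure_map (T U : topologicalType) (f : T -> U) (A : set T) (Q : set U) :
  continuous f -> closed Q -> (forall x, A x -> Q (f x)) -> forall x, closure A x -> Q (f x).
Proof.
move=> /continuous_closedP fc clQ AQ x clx.
exact: (closure_sub (fc _ clQ) AQ clx).
Qed.

(* A nonzero multiple of z is recognized by the closed conditions
   w_i z_j = w_j z_i, and projecting along a compact set is closed. *)
Lemma closed_cone N (Z : set 'rV[K]_N) : compact Z -> (forall v, Z v -> v != 0) ->
  closed [set w | exists c v, Z v /\ w = c *: v].
Proof.
move=> /compact_near_coveringP cZ Z0 w clw.
apply: contrapT => nw.
pose P (w' v : 'rV[K]_N) := exists i j, w' 0 i * v 0 j != w' 0 j * v 0 i.
have Pz v : Z v -> P w v.
  move=> Zv; apply: contrapT => nP; apply: nw.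
  have [j vj] : exists j, v 0 j != 0.
    apply: contrapT => /forallNP v0; have := Z0 v Zv; move/negP; apply; apply/eqP/rowP => j.
    by rewrite mxE; apply/eqP; rewrite -[_ == _]negbK; apply/negP; exact: v0.
  exists (w 0 j / v 0 j), v; split=> //; apply/rowP => i; rewrite mxE.
  apply: (mulIf vj); rewrite mulrAC mulfVK //.
  by apply/eqP; apply: contrapT => /negP h; apply: nP; exists i, j.
have c1 i : continuous (fun vw : 'rV[K]_N * 'rV[K]_N => vw.1 0 i).
  move=> vw; apply: (@continuous_comp _ _ _ fst (fun m : 'rV[K]_N => m 0 i)).
    exact: cvg_fst.
  exact: coord_continuous.
have c2 i : continuous (fun vw : 'rV[K]_N * 'rV[K]_N => vw.2 0 i).
  move=> vw; apply: (@continuous_comp _ _ _ snd (fun m : 'rV[K]_N => m 0 i)).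
    exact: cvg_snd.
  exact: coord_continuous.
have nP : \forall w' \near w, Z `<=` P w'.
  apply: (cZ _ (nbhs w)) => v Zv; have [i [j Pij]] := Pz v Zv.
  pose g (vw : 'rV[K]_N * 'rV[K]_N) := vw.2 0 i * vw.1 0 j - vw.2 0 j * vw.1 0 i.
  have gc : continuous g by move=> vw; apply: cvgB; apply: cvgM; first [exact: c1 | exact: c2].
  have : \forall vw \near (v, w), g vw != 0.
    by apply: (cvgr_neq0 _ (gc (v, w))); rewrite subr_eq0.
  apply: filterS => -[v' w'] /=; rewrite /g subr_eq0 /= => h; by exists i, j.
have [w' [[c [v [Zv ->]]] Pw]] := clw _ nP.
have [i [j]] := Pw v Zv.
by rewrite !mxE mulrAC eqxx.
Qed.

End Continuity.

Section Coords.
Variables (K : numFieldType) (V : vectType K).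
Local Notation N := (\dim {:V}).

Definition rv (v : V) : 'rV[K]_N := passmx.rVof (vbasis {:V}) v.

Lemma rv_linear : linear rv. Proof. exact: passmx.rVof_linear. Qed.
HB.instance Definition _ := GRing.isLinear.Build K V 'rV[K]_N *:%R rv rv_linear.

Lemma vec_linear : linear (@vec K V). Proof. exact: passmx.vecof_linear. Qed.
HB.instance Definition _ := GRing.isLinear.Build K 'rV[K]_N V *:%R (@vec K V) vec_linear.

Lemma vecK : cancel (@vec K V) rv. Proof. exact: (passmx.vecofK (vbasisP {:V})). Qed.

Lemma rvK : cancel rv (@vec K V). Proof. exact: (passmx.rVofK (vbasisP {:V})). Qed.

Lemma endo_continuous (f : {linear V -> V}) : continuous (rv \o f \o @vec K V).
Proof. pose g : {linear 'rV[K]_N -> 'rV[K]_N} := ((rv \o f) \o @vec K V). exact: (@row_linear_continuous K N 'rV[K]_N g). Qed.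

Lemma functional_continuous (f : {linear V -> K^o}) :
  continuous ((f : V -> K) \o @vec K V : 'rV[K]_N -> K).
Proof. pose g : {linear 'rV[K]_N -> K^o} := (f \o @vec K V). exact: (@row_linear_continuous K N K^o g). Qed.

(** Cones without the origin are saturated for the quotient map to P(V), so closures can be taken
    upstairs. Allowing c = 0 puts the origin into the cone, hence the condition [w != 0]. *)
Lemma closure_lines (S : set V) (X : set (Defs.proj V)) :
  (forall L, X L <-> exists2 v, S v & val L = <[v]>%VS) ->
  forall L, closure X L <-> exists w, [/\ closure [set w | exists c v, S v /\ w = c *: rv v] w,
    w != 0 & val L = <[vec w]>%VS].
Proof.
move=> XS L; pose Q := closure [set w | exists c v, S v /\ w = c *: rv v].
have QX : closed Q by exact: closed_closure.
have scaleQ c w : Q w -> Q (c *: w).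
  apply: (closure_map (f := fun w : 'rV[K]_N => c *: w)) => //.
    exact: scaler_continuous.
  move=> _ [c' [v [Sv ->]]]; apply: subset_closure; exists (c * c'), v.
  by rewrite scalerA.
have lineE (w w' : 'rV[K]_N) : <[vec w]>%VS = <[vec w']>%VS -> exists c, w = c *: w'.
  move=> E; have : vec w \in <[vec w']>%VS by rewrite -E memv_line.
  by case/vlineP => c /(congr1 rv); rewrite linearZ /= !vecK => ->; exists c.
split=> [clL|[w [Qw w0 Lw]] U].
  pose O : set (Defs.proj V) := [set L | exists w, [/\ ~ Q w, w != 0 & val L = <[vec w]>%VS]].
  have oO : open O.
    change (open (cone O)); rewrite (_ : cone O = ~` Q `&` ~` [set 0]).
      apply: openI; first by rewrite openC.
      apply: closed_openC; exact/accessible_closed_set1/hausdorff_accessible/norm_hausdorff.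
    apply/seteqP; split=> x /=.
      case=> x0 [L' [w [nQw w0 Lw]] Lx]; split; last by apply/eqP.
      move=> Qx; apply: nQw; have [c ->] : exists c, w = c *: x by apply: lineE; rewrite -Lw -Lx.
      exact: scaleQ.
    case=> nQx /eqP x0; split=> //.
    have dx : \dim <[vec x]> == 1%N by rewrite dim_vline vec_neq0.
    by exists (exist (fun L : {vspace V} => is_true (\dim L == 1%N)) _ dx) => //; exists x.
  have [w w0 Lw] : exists2 w : 'rV[K]_N, w != 0 & val L = <[vec w]>%VS.
    have dL := eqP (valP L); pose v := vpick (val L).
    have v0 : v != 0 by rewrite vpick0 -dimv_eq0 dL.
    exists (rv v).
      by apply: contra_neq v0 => /(congr1 (@vec K V)); rewrite rvK linear0.
    apply/esym/eqP; rewrite rvK eqEdim -memvE memv_pick /= dim_vline v0; exact: eq_leq.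
  exists w; split=> //; apply: contrapT => nQw.
  have LO : nbhs L O.
    by apply: open_nbhs_nbhs; split=> //; exists w.
  have [L' [XL' [w' [nQw' w'0 Lw']]]] := clL _ LO.
  have [v Sv Lv] := (XS L').1 XL'.
  apply: nQw'; have [c ->] : exists c, w' = c *: rv v by apply: lineE; rewrite rvK -Lv -Lw'.
  by apply: subset_closure; exists c, v.
rewrite nbhsE => -[B [oB BL] BU].
have : nbhs w (cone B).
  by apply: open_nbhs_nbhs; split=> //; split=> //; exists L.
move=> /Qw[_ [[c [v [Sv ->]]] [cv0 [L' BL' L'E]]]].
exists L'; split; last exact: BU.
apply/XS; exists v => //; rewrite L'E.
have c0 : c != 0 by apply: contra_neq cv0 => ->; rewrite scale0r.
apply/eqP; rewrite linearZ /= rvK eqEsubv; apply/andP; split; rewrite -memvE.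
  by rewrite memvZ ?memv_line.
by rewrite -{1}[v](scalerK c0) memvZ ?memv_line.
Qed.

End Coords.

(** * The orbit closure as the closure of the cell *)

Section Orbit.
Variables (K : numFieldType).

(** Permits the constant term of x to be assumed generic: the vector is continuous in c and 0 is a
    limit of allowed values. *)
Lemma ev_closed n (a : 'I_n -> nat) (z : 'I_n -> K) (Q : set 'rV[K]_(\dim {: fusion a z})) x (s : seq K) :
  closed Q -> (forall c, c \notin s -> Q (rv (ev a z (c%:P + x)))) -> Q (rv (ev a z x)).
Proof.
case: n a z Q => [|n] a z Q clQ Qc.
  have [c [cs _]] := @closure_cofinite K s _ filterT.
  by rewrite (@ev_congr _ _ a z x (c%:P + x)) //; apply: Qc.
have [M [A AE]] := ev_translation a z.
rewrite -[x]add0r -[0]/(0%:P).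
apply: (closed_cofinite (g := fun c => rv (ev a z (c%:P + x))) (s := s)) => //.
rewrite (_ : (fun c => _) = fun c => \sum_(k < M) c ^+ k *: rv (A k (ev a z x))).
  apply: continuous_sumr => k; apply: continuous_scale_cst; apply: continuous_expr => c.
  exact: cvg_id.
by apply/funext => c; rewrite AE linear_sum; apply: eq_bigr => k _; rewrite linearZ.
Qed.

Variables (n : nat) (a : 'I_n -> nat) (z : 'I_n -> K).
Local Notation V := (fusion a z).

Definition cell_cone := closure [set w | exists c v, range (ev a z) v /\ w = c *: rv v].

Lemma fusion_low_ev : fusion_low a z = ev a z 0.
Proof.
rewrite /fusion_low /gr_class0 /ev /expv /cls; congr gr_pi; apply/ffunP => s; rewrite !ffunE.
apply/ffunP => m; rewrite ffunE (_ : Xv _ _ = fun=> 0); last first.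
  by apply/funext => i; rewrite rmorph0 /Xv horner0.
rewrite Eh0 coefC (_ : (nat_of_ord s == 0%N) = (s == ord0)) //.
by case: eqP => _; rewrite !ffunE.
Qed.

Lemma cell_cone_ev c x : cell_cone (c *: rv (ev a z x)).
Proof. by apply: subset_closure; exists c, (ev a z x). Qed.

Lemma cell_coneZ c w : cell_cone w -> cell_cone (c *: w).
Proof.
have cc : continuous (fun w : 'rV[K]_(\dim {: V}) => c *: w) by exact: scaler_continuous.
apply: (closure_map cc); first exact: closed_closure.
by move=> _ [c' [_ [[y _ <-] ->]]]; rewrite scalerA; exact: cell_cone_ev.
Qed.

(** The closed cone over the cell is stable under the generators: exp(e p) preserves the cell, and
    exp(f p) maps its generic points to multiples of points of the cell. *)
Lemma SL2_act_cell g T : SL2_act g T -> cell_cone (rv (T (fusion_low a z))).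
Proof.
have clQ : closed cell_cone by exact: closed_closure.
have stable (f : {linear V -> V}) : (forall x, cell_cone (rv (f (ev a z x)))) ->
    forall v, cell_cone (rv v) -> cell_cone (rv (f v)).
  move=> fQ v Qv; rewrite -(rvK v).
  pose F w := rv (f (vec w)); rewrite -[rv _]/(F (rv v)).
  have Fc : continuous F by exact: endo_continuous.
  apply: (closure_map Fc clQ _ Qv).
  move=> _ [c [_ [[x _ <-] ->]]].
  have -> : F (c *: rv (ev a z x)) = c *: rv (f (ev a z x)).
    by rewrite /F linearZ /= rvK linearZ /= linearZ.
  exact: cell_coneZ.
pose expb x p := GRing.isLinear.Build K V V *:%R _
  (exp_nilp_linear (fusion_cur (a := a) (z := z) x p)).
pose expl x p : {linear V -> V} := HB.pack (exp_nilp (fusion_cur (a := a) (z := z) x p)) (expb x p).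
elim=> {g T} [|p g T _ IH|p g T _ IH].
- by rewrite fusion_low_ev -[ev _ _ _]scale1r linearZ; exact: cell_cone_ev.
- apply: (stable (expl (sl2_e K) p)) IH => x /=.
  by rewrite exp_e_ev -[ev _ _ _]scale1r linearZ; exact: cell_cone_ev.
apply: (stable (expl (sl2_f K) p)) IH => x /=.
pose P := take_poly n (p : {poly K}).
(* The one c for which the constant term of 1 + P (c + x) can vanish; if P_0 = 0 that term is 1. *)
pose bad := [:: - (P`_0)^-1 - x`_0].
pose F (w : 'rV[K]_(\dim {: V})) := rv (expl (sl2_f K) p (vec w)).
have Fc : continuous F by exact: endo_continuous.
have clP : closed (F @^-1` cell_cone) by move/continuous_closedP : Fc; apply.
suff : (F @^-1` cell_cone) (rv (ev a z x)) by rewrite /= /F rvK.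
apply: (ev_closed (s := bad) clP) => c; rewrite inE => cbad; rewrite /= /F rvK /=.
have k0 : (1 + P * (c%:P + x))`_0 != 0.
  rewrite coefD coef1 coef0M coefD coefC /=; apply: contra cbad => /eqP h.
  have P0 : P`_0 != 0.
    by apply/eqP => P0; move/eqP: h; rewrite P0 mul0r addr0 oner_eq0.
  have -> : c = (1 + P`_0 * (c + x`_0)) / P`_0 - (P`_0)^-1 - x`_0 by field.
  by rewrite h mul0r sub0r.
have [y yE] := eqlt_inv n (c%:P + x) k0.
by rewrite (exp_f_ev a z k0 yE) linearZ; exact: cell_cone_ev.
Qed.

Lemma ev_orbit x : exists g T, SL2_act g T /\ ev a z x = T (fusion_low a z).
Proof.
pose p := in_qpoly ('X^n : {poly K}) (take_poly n x).
exists ((1%:M + p *: delta_mx 0 1) *m 1%:M), (exp_nilp (fusion_cur (sl2_e K) p) \o id).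
split; first by apply: SL2_actE; exact: SL2_act1.
rewrite /= fusion_low_ev exp_e_ev add0r; apply: ev_congr => j jn.
rewrite /p in_qpoly_small ?coef_take_poly ?jn // mk_monic_Xn size_polyXn.
by rewrite ltnS (leq_trans (size_take_poly _ _)) // leqSpred.
Qed.

Lemma shP L : sh a z L <->
  exists w, [/\ cell_cone w, w != 0 & val L = <[vec w]>%VS].
Proof.
pose S : set V := [set v | exists g T, SL2_act g T /\ v = T (fusion_low a z)].
have := @closure_lines K V S [set L : Defs.proj V | exists g T, SL2_act g T /\
  val L = <[T (fusion_low a z)]>%VS].
rewrite /sh => -> //; last first.
  move=> L'; split; first by case=> g [T [gT LT]]; exists (T (fusion_low a z)) => //; exists g, T.
  by case=> _ [g [T [gT ->]]] LT; exists g, T.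
suff -> : closure [set w | exists c v, S v /\ w = c *: rv v] = cell_cone by [].
apply/seteqP; split.
  apply: closure_sub; first exact: closed_closure.
  move=> _ [c [_ [[g [T [gT ->]]] ->]]].
  by apply: cell_coneZ; apply: SL2_act_cell gT.
apply: closure_subset => _ [c [_ [[x _ <-] ->]]].
by exists c, (ev a z x); split=> //; exact: ev_orbit.
Qed.

End Orbit.

(** * Density of the chart points and continuity of the lattice coordinates *)

Section Dense.
Variable K : numFieldType.

Lemma hom_continuous (V V' : vectType K) (f : {linear V -> V'}) :
  continuous (fun w => rv (f (vec w))).
Proof.
pose g : {linear 'rV[K]_(\dim {:V}) -> 'rV[K]_(\dim {:V'})} := ((@rv K V' \o f) \o @vec K V).
exact: (@row_linear_continuous K _ 'rV[K]_(\dim {:V'}) g).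
Qed.

Definition chart_pts n (a : 'I_n -> nat) (z : 'I_n -> K) eps : set 'rV[K]_(\dim {: fusion a z}) :=
  [set w | exists u x, chart_rel n eps u x /\ w = rv (ev a z x)].

(** Continuous linear maps carry the density for n factors to n + 1 factors. With a reflection, x is
    made invertible by a generic constant, and the constant term y_0 of y = - 1 / x is kept fixed;
    so the scalar d is constant and d^-1 times translation and reflection is one linear map. *)
Lemma chart_dense n (a : 'I_n -> nat) (z : 'I_n -> K) eps x :
  closure (@chart_pts n a z eps) (rv (ev a z x)).
Proof.
elim: n a z eps x => [|n IH] a z eps x.
  by apply: subset_closure; exists (fun=> 0), x.
have [iota iotaE] := fusion_embedding a z.
have [M [A AE]] := ev_translation a z.
pose T c v := \sum_(k < M) c ^+ k *: A k (iota v).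
have Tlin c : linear (T c).
  move=> b u v; rewrite /T scaler_sumr -big_split /=; apply: eq_bigr => k _.
  by rewrite (linearP iota) (linearP (A k)) scalerDr !scalerA mulrC.
pose Tb c := GRing.isLinear.Build K (fusion (init a) (init z)) (fusion a z) *:%R (T c) (Tlin c).
pose Tl c : {linear fusion (init a) (init z) -> fusion a z} := HB.pack (T c) (Tb c).
have TE c y : T c (ev (init a) (init z) y) = ev a z (c%:P + 'X * y).
  by rewrite AE; apply: eq_bigr => k _; rewrite iotaE.
case E : (eps 0%N); last first.
  pose F w := rv (T x`_0 (vec w)).
  have Fc : continuous F by exact: (@hom_continuous _ _ (Tl x`_0)).
  have FE y : F (rv (ev (init a) (init z) y)) = rv (ev a z ((x`_0)%:P + 'X * y)).
    by rewrite /F rvK TE.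
  rewrite (split_coef0 x) -FE.
  apply: (closure_map Fc _ _ (IH (init a) (init z) (fshift eps) (drop_poly 1 x))).
    exact: closed_closure.
  move=> _ [u [y [yR ->]]]; rewrite FE; apply: subset_closure.
  by exists (scons x`_0 u), ((x`_0)%:P + 'X * y); split=> //=; exists y; rewrite ?E.
have [S SE] := ev_reflection a z.
apply: (ev_closed (s := [:: - x`_0])); first exact: closed_closure.
move=> c; rewrite inE => cx; pose x' := c%:P + x.
have x0 : x'`_0 != 0 by rewrite coefD coefC /= addr_eq0.
rewrite -/x'; clearbody x'; clear c cx x; rename x' into x.
have [y yE] := eqlt_inv n.+1 (-1) x0.
have y0 : y`_0 != 0.
  apply/eqP => y0; have := yE 0%N isT; rewrite coef0M y0 mul0r coefN coefC /= => /eqP.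
  by rewrite eq_sym oppr_eq0 oner_eq0.
pose d := (- y`_0) ^+ (\sum_i (a i).-1).
have d0 : d != 0 by rewrite expf_neq0 // oppr_eq0.
pose G v := d^-1 *: S (T y`_0 v).
have Glin : linear G.
  by move=> b u v; rewrite /G Tlin (linearP S) scalerDr !scalerA mulrC.
pose Gb := GRing.isLinear.Build K (fusion (init a) (init z)) (fusion a z) *:%R G Glin.
pose Gl : {linear fusion (init a) (init z) -> fusion a z} := HB.pack G Gb.
pose F w := rv (G (vec w)).
have Fc : continuous F by exact: (@hom_continuous _ _ Gl).
have c0 y' : ((y`_0)%:P + 'X * y')`_0 = y`_0 by rewrite coefD coefC coefXM addr0.
have FE x' y' : eqlt n.+1 (x' * ((y`_0)%:P + 'X * y')) (-1) ->
    F (rv (ev (init a) (init z) y')) = rv (ev a z x').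
  move=> xy; rewrite /F /G rvK TE (SE x') ?c0 // scalerA mulVf ?scale1r //.
rewrite -(FE x (drop_poly 1 y)); last by rewrite -split_coef0 mulrC.
apply: (closure_map Fc _ _ (IH (init a) (init z) (fshift eps) (drop_poly 1 y))).
  exact: closed_closure.
move=> _ [u [y' [yR ->]]].
have Y0 : ((y`_0)%:P + 'X * y')`_0 != 0 by rewrite c0.
have [x' x'E] := eqlt_inv n.+1 (-1) Y0.
rewrite (FE x') //; apply: subset_closure.
by exists (scons y`_0 u), x'; split=> //=; exists y'; rewrite ?E.
Qed.

Variables (T : topologicalType).

Definition coef_continuous (g : T -> {poly K}) := forall l, continuous (fun t => (g t)`_l : K).

Lemma coef_continuous_cst q : coef_continuous (fun=> q).
Proof. by move=> l t; exact: cvg_cst. Qed.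

Lemma coef_continuousD g h : coef_continuous g -> coef_continuous h ->
  coef_continuous (fun t => g t + h t).
Proof.
move=> gc hc l; under eq_fun do rewrite coefD.
by move=> t; apply: cvgD; [exact: gc | exact: hc].
Qed.

Lemma coef_continuousN g : coef_continuous g -> coef_continuous (fun t => - g t).
Proof. by move=> gc l; under eq_fun do rewrite coefN; move=> t; apply: cvgN; exact: gc. Qed.

Lemma coef_continuousZ (c : T -> K) g : continuous c -> coef_continuous g ->
  coef_continuous (fun t => c t *: g t).
Proof.
move=> cc gc l; under eq_fun do rewrite coefZ.
by move=> t; apply: cvgM; [exact: cc | exact: gc].
Qed.

Lemma coef_continuous_mulX g : coef_continuous g -> coef_continuous (fun t => 'X * g t).
Proof.
move=> gc [|l]; under eq_fun do rewrite coefXM /=; last exact: gc.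
by move=> t; exact: cvg_cst.
Qed.

Lemma coef_continuous_drop g : coef_continuous g -> coef_continuous (fun t => drop_poly 1 (g t)).
Proof. by move=> gc l; under eq_fun do rewrite coef_drop_poly; exact: gc. Qed.

Lemma co_continuous (f : nat -> T -> K) eps (p : T -> {poly K} * {poly K}) j :
  (forall i, continuous (f i)) ->
  coef_continuous (fun t => (p t).1) -> coef_continuous (fun t => (p t).2) ->
  continuous (fun t => co eps (fun i => f i t) (p t) j).
Proof.
move=> fc.
have head b c q : continuous c -> coef_continuous (fun t => (q t).1) ->
    coef_continuous (fun t => (q t).2) -> coef_continuous (fun t => (swap b (q t)).1) /\
    coef_continuous (fun t => co_head b (c t) (q t)).
  move=> cc q1 q2; rewrite /co_head /swap; case: b => /=; split=> //.
    apply: coef_continuousD; first exact: coef_continuousN.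
    by apply: coef_continuousN; exact: coef_continuousZ.
  by apply: coef_continuousD => //; apply: coef_continuousN; exact: coef_continuousZ.
elim: j eps f p fc => [|j IH] eps f p fc p1 p2 /=.
  exact: (head _ _ _ (fc 0%N) p1 p2).2.
have [h1 h2] := head (eps 0%N) _ _ (fc 0%N) p1 p2.
apply: (IH _ (fun i => f i.+1) (fun t => co_next (eps 0%N) (f 0%N t) (p t))) => //=.
exact: coef_continuous_drop.
Qed.

Lemma lattice_vec_continuous (f : nat -> T -> K) eps m al be :
  (forall i, continuous (f i)) ->
  coef_continuous (fun t => (lattice_vec m eps (fun i => f i t) al be).1) /\
  coef_continuous (fun t => (lattice_vec m eps (fun i => f i t) al be).2).
Proof.
elim: m eps f => [|m IH] eps f fc /=.
  by rewrite /unswap; case: (eps 0%N) => /=; split; exact: coef_continuous_cst.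
have [h1 h2] := IH (fshift eps) (fun i => f i.+1) (fun i => fc i.+1).
have h3 : coef_continuous (fun t =>
    f 0%N t *: (lattice_vec m (fshift eps) (fun i => f i.+1 t) al be).1 +
    'X * (lattice_vec m (fshift eps) (fun i => f i.+1 t) al be).2).
  by apply: coef_continuousD; [exact: coef_continuousZ | exact: coef_continuous_mulX].
by rewrite /unswap; case: (eps 0%N) => /=; split=> //; exact: coef_continuousN.
Qed.

End Dense.

Section CoLinear.
Variable K : numFieldType.

Lemma co_linear eps (u : nat -> K) c (p q : {poly K} * {poly K}) j :
  co eps u (c *: p.1 + q.1, c *: p.2 + q.2) j = c * co eps u p j + co eps u q j.
Proof.
have hE (b : bool) d (r r' : {poly K} * {poly K}) :
    co_head b d (c *: r.1 + r'.1, c *: r.2 + r'.2) = c *: co_head b d r + co_head b d r'.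
  by rewrite /co_head /swap; case: b => /=; rewrite -!mul_polyC; ring.
elim: j eps u p q => [|j IH] eps u p q /=; first by rewrite hE coefD coefZ.
rewrite -IH; congr (co _ _ _ _).
rewrite /co_next hE; apply: eq_pair; last by rewrite /= linearP.
by rewrite /swap; case: (eps 0%N) => //=; rewrite opprD scalerN.
Qed.

Lemma co_expand eps (u : nat -> K) (q : {poly K} * {poly K}) j D :
  (size q.1 <= D)%N -> (size q.2 <= D)%N ->
  co eps u q j = \sum_(l < D) (q.1`_l * co eps u ('X^l, 0) j + q.2`_l * co eps u (0, 'X^l) j).
Proof.
move=> s1 s2.
have E (f : {poly K}) : (size f <= D)%N -> f = \sum_(l < D) f`_l *: 'X^l :> {poly K}.
  by move=> sf; rewrite -poly_def; apply/polyP => k; rewrite coef_poly;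
    case: ltnP => // h; rewrite nth_default // (leq_trans sf h).
have qE : q = (\sum_(l < D) q.1`_l *: 'X^l, \sum_(l < D) q.2`_l *: 'X^l).
  by apply: eq_pair; exact: E.
have step (f g : nat -> K) : co eps u (\sum_(l < D) f l *: 'X^l, \sum_(l < D) g l *: 'X^l) j =
    \sum_(l < D) (f l * co eps u ('X^l, 0) j + g l * co eps u (0, 'X^l) j).
  elim: D {s1 s2 E qE} => [|D IH]; first by rewrite !big_ord0 co0.
  rewrite !big_ord_recr /= -IH.
  pose A := (\sum_(i < D) f i *: 'X^i, \sum_(i < D) g i *: 'X^i) : {poly K} * {poly K}.
  pose B := ('X^D, 0) : {poly K} * {poly K}; pose C := (0, 'X^D) : {poly K} * {poly K}.
  rewrite -/A -/B -/C [RHS]addrC -[RHS]addrA -(co_linear eps u (g D)) -(co_linear eps u (f D)).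
  congr (co _ _ _ _); apply: eq_pair; rewrite /= scaler0 ?add0r.
    by rewrite addrC.
  by rewrite addrC.
by rewrite {1}qE (step (fun l => q.1`_l) (fun l => q.2`_l)).
Qed.

End CoLinear.

Lemma chart_rel_ext (K : numFieldType) n eps (u v : nat -> K) x :
  (forall i, (i < n)%N -> u i = v i) -> chart_rel n eps u x -> chart_rel n eps v x.
Proof.
elim: n u v eps x => // n IH u v eps x uv [y yR xE]; exists y.
  by apply: IH yR => i im; apply: uv.
by rewrite -uv.
Qed.

Lemma chart_rel_scale (K : numFieldType) n (a : 'I_n -> nat) eps (u : nat -> K) x :
  chart_rel n eps u x -> chart_scale a eps u != 0.
Proof.
elim: n a u eps x => [|n IH] a u eps x /=; first by rewrite oner_neq0.
case=> y /IH yR xE; rewrite mulf_neq0 ?yR //.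
by case: ifP xE => _; [case=> u0 _; rewrite expf_neq0 // oppr_eq0 | rewrite oner_neq0].
Qed.

(** * A single chart: immersion, injectivity and properness *)

Section Chart.
Variables (K : numFieldType) (n : nat) (a : 'I_n -> nat) (z : 'I_n -> K).
Hypothesis hz : injective z.
Hypothesis ha1 : forall i, (1 < a i)%N.
Hypothesis ha : forall i j : 'I_n, (i < j)%N -> (a i < a j)%N.
Variables (eps : nat -> bool) (I : finType) (ex : I -> nat -> nat) (w : I -> fusion a z).
Hypothesis wE : forall u x, chart_rel n eps u x ->
  \sum_b (\prod_(i < n) u i ^+ ex b i) *: w b = chart_scale a eps u *: ev a z x.
Local Notation V := (fusion a z).
Local Notation N := (\dim {: V}).

(* With default value 1, [row_fun u i != 0] only constrains i < n. *)
Definition row_fun (u : 'rV[K]_n) (i : nat) : K := if insub i is Some k then u 0 k else 1.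

Definition phi (u : 'rV[K]_n) : 'rV[K]_N :=
  \sum_b (\prod_(i < n) u 0 i ^+ ex b i) *: rv (w b).

Lemma row_funE u (i : 'I_n) : row_fun u i = u 0 i.
Proof. by rewrite /row_fun valK. Qed.

Lemma row_fun_continuous i : continuous (row_fun^~ i).
Proof.
rewrite /row_fun; case: insub => [k|]; first exact: coord_continuous.
exact: cst_continuous.
Qed.

Lemma phiE u : phi u = rv (\sum_b (\prod_(i < n) row_fun u i ^+ ex b i) *: w b).
Proof.
rewrite linear_sum; apply: eq_bigr => b _; rewrite linearZ /=; congr (_ *: _).
by apply: eq_bigr => i _; rewrite row_funE.
Qed.

Lemma phi_differentiable u : differentiable phi u.
Proof.
have dpow (i : 'I_n) k : differentiable (fun u : 'rV[K]_n => u 0 i ^+ k : K) u.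
  elim: k => [|k IH]; first exact: differentiable_cst.
  rewrite (_ : (fun _ => _) = (fun v : 'rV[K]_n => v 0 i : K) * (fun v => v 0 i ^+ k)).
    by apply: differentiableM => //; exact: differentiable_coord.
  by apply/funext => v; rewrite exprS.
have dprod (r : seq 'I_n) (k : 'I_n -> nat) :
    differentiable (fun u : 'rV[K]_n => \prod_(i <- r) u 0 i ^+ k i : K) u.
  elim: r => [|i r IH].
    rewrite (_ : (fun _ => _) = cst 1); first exact: differentiable_cst.
    by apply/funext => v; rewrite big_nil.
  rewrite (_ : (fun _ => _) = (fun v : 'rV[K]_n => v 0 i ^+ k i) * (fun v => \prod_(i <- r) v 0 i ^+ k i)).
    by apply: differentiableM => //; exact: dpow.
  by apply/funext => v; rewrite big_cons.
have dsum (r : seq I) : differentiable (fun u : 'rV[K]_n =>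
    \sum_(b <- r) (\prod_(i < n) u 0 i ^+ ex b i) *: rv (w b)) u.
  elim: r => [|b r IH].
    rewrite (_ : (fun _ => _) = cst 0); first exact: differentiable_cst.
    by apply/funext => v; rewrite big_nil.
  rewrite (_ : (fun _ => _) = (fun v : 'rV[K]_n => (\prod_(i < n) v 0 i ^+ ex b i) *: rv (w b)) +
     (fun v => \sum_(b <- r) (\prod_(i < n) v 0 i ^+ ex b i) *: rv (w b))).
    by apply: differentiableD => //; apply: differentiableZl; exact: dprod.
  by apply/funext => v; rewrite big_cons.
exact: dsum.
Qed.

Lemma phi_continuous : continuous phi.
Proof. by move=> u; exact/differentiable_continuous/phi_differentiable. Qed.

Lemma generic_dense u (Q : 'rV[K]_n -> Prop) : closed [set u | Q u] ->
  (forall u, (forall i, row_fun u i != 0) -> Q u) -> Q u.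
Proof.
move=> clQ gQ; pose g (c : K) := u + c *: const_mx 1 : 'rV[K]_n.
have gc : continuous g.
  have ec : continuous (fun c : K => c *: const_mx 1 : 'rV[K]_n).
    by apply: (@continuous_scale_cst K K _ id) => d; exact: cvg_id.
  by move=> c; apply: (@cvgD _ _ _ (nbhs c) _ (cst u) (fun c => c *: const_mx 1 : 'rV[K]_n) _ _ _ (ec c)); exact: cvg_cst.
have g0 : g 0 = u by rewrite /g scale0r addr0.
rewrite -g0; apply: (closed_cofinite (g := g) (s := [seq - u 0 i | i <- enum 'I_n]) (gc 0) clQ).
move=> c cu; apply: gQ => i; rewrite /row_fun; case: insub => [k|]; last exact: oner_neq0.
rewrite !mxE mulr1; apply: contra cu; rewrite addrC addr_eq0 => /eqP ->.
by apply/mapP; exists k; rewrite ?mem_enum.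
Qed.

Lemma det_comx_continuous m (p : 'I_m -> {poly K} * {poly K}) :
  continuous (fun u => \det (comx eps (row_fun u) p)).
Proof.
rewrite /determinant.
apply: continuous_sumr => s u; apply: (@cvgM _ _ (nbhs u) _ (cst _)); first exact: cvg_cst.
apply: continuous_prodr => i _.
rewrite (_ : (fun t => _) = fun t => co eps (fun k => row_fun t k) (p i) (s i)).
  by apply: co_continuous; [exact: row_fun_continuous | exact: coef_continuous_cst | exact: coef_continuous_cst].
by apply/funext => t; rewrite mxE.
Qed.

Lemma minors_continuous p : continuous (fun u => minors a eps p (row_fun u)).
Proof. by apply: continuous_prodr => r _; exact: (@det_comx_continuous (layer a r)). Qed.

(** Both sides are continuous in u and agree if no u_i is zero, because then some x has the code
    u. *)
Lemma phi_functional p :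
  exists lam : {linear V -> K^o}, forall u, lam (vec (phi u)) = minors a eps p (row_fun u).
Proof.
have [lam lamE] := chart_functional hz ha1 ha p wE.
exists lam => u.
pose g u : K := lam (vec (phi u)) - minors a eps p (row_fun u).
suff : g u = 0 by move/eqP; rewrite subr_eq0 => /eqP.
apply: (@generic_dense u (fun u => g u = 0)).
  have gc : continuous g.
    have lc v : {for v, continuous (fun v => lam (vec (phi v)) : K)}.
      exact: (continuous_comp (@phi_continuous v) (@functional_continuous K V lam (phi v))).
    by move=> v; apply: (cvgB (lc v)); exact: minors_continuous.
  apply: (closed_comp (f := g) (D := [set 0])) => [v _ |]; first exact: gc.
  exact/accessible_closed_set1/hausdorff_accessible/norm_hausdorff.
move=> v v0; apply/eqP; rewrite subr_eq0; apply/eqP.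
have [x xR] := @chart_rel_ex K n eps (row_fun v) (fun i _ => v0 i).
by rewrite phiE rvK (lamE _ x xR).
Qed.

Lemma phi_cell u : @cell_cone K n a z (phi u).
Proof.
apply: (@generic_dense u (fun u => @cell_cone K n a z (phi u))).
  by move/continuous_closedP: phi_continuous; apply; exact: closed_closure.
move=> v v0; have [x xR] := @chart_rel_ex K n eps (row_fun v) (fun i _ => v0 i).
by rewrite phiE (wE xR) linearZ; exact: cell_cone_ev.
Qed.

Lemma phi_neq0 u : phi u != 0.
Proof.
have [lam lamE] := phi_functional (std_layer (row_fun u) eps).
apply/eqP => u0; have := lamE u; rewrite minors_std u0 !linear0 => /eqP.
by rewrite eq_sym oner_eq0.
Qed.

Lemma cell_cone_phi v : @cell_cone K n a z v -> closure [set v | exists c u, v = c *: phi u] v.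
Proof.
apply: closure_sub; first exact: closed_closure.
move=> _ [c [_ [[x _ <-] ->]]].
have cc : continuous (fun w : 'rV[K]_N => c *: w) by exact: scaler_continuous.
apply: (closure_map cc _ _ (@chart_dense K n a z eps x)); first exact: closed_closure.
move=> _ [u [y [yR ->]]]; apply: subset_closure.
pose u' : 'rV[K]_n := \row_i u i.
have yR' : chart_rel n eps (row_fun u') y.
  apply: chart_rel_ext yR => i im.
  by have /= -> := row_funE u' (Ordinal im); rewrite mxE.
have d0 := chart_rel_scale a yR'.
exists (c / chart_scale a eps (row_fun u')), u'.
by rewrite phiE (wE yR') linearZ scalerA mulfVK.
Qed.

Lemma minors_row (r0 : 'I_(nlayers a)) s (u0 u : nat -> K) : layer a r0 = s.+1 ->
  exists C : 'I_(layer a r0) -> K, forall q,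
    minors a eps (mod_layer u0 eps r0 s q) u = \sum_(j < layer a r0) co eps u q j * C j.
Proof.
move=> r0s; have sl : (s < layer a r0)%N by rewrite r0s.
pose A q := comx eps u (fun i : 'I_(layer a r0) => mod_layer u0 eps r0 s q r0 i).
pose rest := \prod_(r < nlayers a | r != r0) \det (comx eps u (fun i : 'I_(layer a r) => std_layer u0 eps r i)).
exists (fun j => cofactor (A (0, 0)) (Ordinal sl) j * rest) => q.
rewrite /minors (bigD1 r0) //= (expand_det_row _ (Ordinal sl)) mulr_suml.
apply: eq_bigr => j _; rewrite -mulrA mxE /mod_layer !eqxx /=; congr (_ * (_ * _)).
  congr (_ * \det _); apply/matrixP => i k; rewrite !mxE /mod_layer eqxx /=.
  case: eqP => // E; have := neq_lift (Ordinal sl) i; rewrite -val_eqE /= => /eqP; case.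
  by rewrite E.
apply: eq_bigr => r /negPf rr0; congr (\det _); apply/matrixP => i k; rewrite !mxE.
by rewrite -val_eqE /= in rr0; rewrite rr0.
Qed.

(** The row [q] that isolates u_s depends on u, whereas a functional on M^A needs fixed data. By
    linearity in this row only finitely many fixed functionals, those of the monomial rows, are
    needed; the dependence on u moves into their coefficients. *)
Lemma minors_expand (r0 : 'I_(nlayers a)) s (u0 u : nat -> K) (q : {poly K} * {poly K}) D :
  layer a r0 = s.+1 -> (size q.1 <= D)%N -> (size q.2 <= D)%N ->
  minors a eps (mod_layer u0 eps r0 s q) u =
  \sum_(l < D) (q.1`_l * minors a eps (mod_layer u0 eps r0 s ('X^l, 0)) u +
                q.2`_l * minors a eps (mod_layer u0 eps r0 s (0, 'X^l)) u).
Proof.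
move=> r0s s1 s2; have [C CE] := minors_row u0 u r0s; rewrite CE.
under eq_bigr do rewrite (co_expand eps u _ s1 s2) mulr_suml.
rewrite exchange_big /=; apply: eq_bigr => l _; rewrite !CE !mulr_sumr -big_split /=.
by apply: eq_bigr => j _; rewrite mulrDl !mulrA.
Qed.

(** Let s be the first index with h_s nonzero. On the line u + t h the coordinates below s are
    constant, so the functional with [q] in layer s + 1 takes the value - t h_s G, where G is
    continuous and equals 1 at t = 0. It vanishes at phi(u) and has derivative - h_s there, which is
    impossible if the tangent vector lies in the line of phi(u). *)
Lemma phi_immersion (u h : 'rV[K]_n) : 'd phi u h \in <[phi u]>%VS -> h = 0.
Proof.
move=> dh; apply: contrapT => /eqP h0.
have exs : exists s, (s < n)%N && (if insub s is Some i then h 0 i != 0 else false).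
  have [i hi] : exists i, h 0 i != 0.
    apply: contrapT => /forallNP H; case/eqP: h0; apply/rowP => i; rewrite mxE.
    by apply/eqP; have := H i => /negP; rewrite negbK.
  by exists i; rewrite ltn_ord valK.
case: (ex_minnP exs) => s /andP[sn]; rewrite insubT /= => hs smin.
have hlt (i : 'I_n) : (i < s)%N -> h 0 i = 0.
  move=> is_; apply/eqP; apply: contraTT is_ => hi.
  by rewrite -leqNgt; apply: smin; rewrite ltn_ord valK.
have [r0 r0s] := layer_ex ha1 ha sn.
pose q := lattice_vec s eps (row_fun u) 1 (row_fun u s).
have [lam lamE] := phi_functional (mod_layer (row_fun u) eps r0 s q).
pose g (t : K) : 'rV[K]_n := t *: h + u.
pose G (v : 'rV[K]_n) := \prod_(r < nlayers a | r != r0)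
   \det (comx eps (row_fun v) (fun i : 'I_(layer a r) => std_layer (row_fun u) eps r i)).
have gt t k : (k < s)%N -> row_fun (g t) k = row_fun u k.
  move=> ks; rewrite -[k]/(nat_of_ord (Ordinal (ltn_trans ks sn))).
  by rewrite !row_funE !mxE hlt // mulr0 add0r.
have lamg t : lam (vec (phi (g t))) = - (t * h 0 (Ordinal sn)) * G (g t).
  have qE : q = lattice_vec s eps (row_fun (g t)) 1 (row_fun u s).
    by apply: lattice_vec_ext => i /gt.
  have q0 j : (j < s)%N -> co eps (row_fun (g t)) q j = 0.
    by move=> js; rewrite qE co_lattice_vec_lt.
  rewrite lamE (minors_mod r0s (gt t) q0) co_lattice_vec; last by move=> i /gt ->.
  congr (_ * _); rewrite mulr1 -[s]/(nat_of_ord (Ordinal sn)) !row_funE !mxE.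
  by rewrite opprD addrCA subrr addr0.
have gc : continuous g.
  have ec : continuous (fun t : K => t *: h) by apply: (@continuous_scale_cst K K _ id) => d; exact: cvg_id.
  by move=> t; apply: (cvgD (ec t)); exact: cvg_cst.
have Gc : continuous G.
  apply: continuous_prodr => r _; exact: (det_comx_continuous (m := layer a r)).
have g0 : g 0 = u by rewrite /g scale0r add0r.
have G0 : G (g 0) = 1 by rewrite g0 /G big1 // => r _; rewrite det_std_layer.
have lam0 : lam (vec (phi u)) = 0 by rewrite -g0 lamg mul0r oppr0 mul0r.
have lamd : lam (vec ('d phi u h)) = 0.
  by case/vlineP: dh => c ->; rewrite !linearZ /= lam0 scaler0.
have := diff_derivable (v := h) (phi_differentiable u).
move=> /cvg_ex[l lE].
have ld : l = 'd phi u h.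
  rewrite -deriveE; last exact: phi_differentiable.
  by apply/esym/cvg_lim => //; exact: norm_hausdorff.
have lc := @functional_continuous K V lam l.
have lam1 : lam (vec (t^-1 *: ((phi \o shift u) (t *: h) - phi u))) @[t --> 0^'] --> (0 : K).
  by have := cvg_comp _ _ lE lc; rewrite /= ld lamd.
have lam2 : lam (vec (t^-1 *: ((phi \o shift u) (t *: h) - phi u))) @[t --> 0^'] -->
    (- h 0 (Ordinal sn) : K).
  have c2 : - h 0 (Ordinal sn) * G (g t) @[t --> 0^'] --> - h 0 (Ordinal sn) * G (g 0).
    apply: (@cvgM _ _ _ _ (cst _)); first exact: cvg_cst.
    apply: cvg_within_filter; exact: (continuous_comp (gc 0) (Gc (g 0))).
  rewrite G0 mulr1 in c2; apply: cvg_trans c2; apply: near_eq_cvg.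
  near=> t; have t0 : t != 0 by near: t; exact: nbhs_dnbhs_neq.
  rewrite /= -/(g t). rewrite !linearZ /= !linearB /= lam0 scaler0 subr0 lamg.
  by rewrite /GRing.scale /= !mulNr mulrN !mulrA mulVf // mul1r.
have : - h 0 (Ordinal sn) = 0.
  by apply: (cvg_unique _ lam2 lam1); exact: norm_hausdorff.
by move/eqP; rewrite oppr_eq0; apply/negP; exact: hs.
Unshelve. all: by end_near.
Qed.

(* Given w = c phi(u), the coordinate u_s solves a linear equation whose
   coefficients are continuous in w and u_0, ..., u_(s-1). *)
Lemma phi_proper_lt (u0 : 'rV[K]_n) s : (s <= n)%N -> forall e : K, 0 < e ->
  \forall v \near phi u0, forall u c, v = c *: phi u ->
    forall i : 'I_n, (i < s)%N -> `|u0 0 i - u 0 i| < e.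
Proof.
elim: s => [|s IH] sn e e0; first by apply: filterE.
have [r0 r0s] := layer_ex ha1 ha sn.
have /choice[l1 l1E] : forall l : nat, exists lam : {linear V -> K^o}, forall u,
    lam (vec (phi u)) = minors a eps (mod_layer (row_fun u0) eps r0 s ('X^l, 0)) (row_fun u).
  by move=> l; exact: (phi_functional).
have /choice[l2 l2E] : forall l : nat, exists lam : {linear V -> K^o}, forall u,
    lam (vec (phi u)) = minors a eps (mod_layer (row_fun u0) eps r0 s (0, 'X^l)) (row_fun u).
  by move=> l; exact: (phi_functional).
pose F (q : {poly K} * {poly K}) (v : 'rV[K]_N) : K :=
  \sum_(l < s.+1) (q.1`_l * l1 l (vec v) + q.2`_l * l2 l (vec v)).
have FE (q : {poly K} * {poly K}) c u : (size q.1 <= s.+1)%N -> (size q.2 <= s.+1)%N ->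
    F q (c *: phi u) = c * minors a eps (mod_layer (row_fun u0) eps r0 s q) (row_fun u).
  move=> s1 s2; rewrite (minors_expand _ _ r0s s1 s2) mulr_sumr; apply: eq_bigr => l _.
  by rewrite !linearZ /= l1E l2E /GRing.scale /=; ring.
(* The equation for u_s is [D 1 0 + u_s * D 0 1 = 0]; it can be solved near (phi u0, u0) because
   [D 0 1] equals 1 there. *)
pose D al be (p : 'rV[K]_N * 'rV[K]_n) := F (lattice_vec s eps (row_fun p.2) al be) p.1.
have Dc al be : continuous (D al be).
  have fc i : continuous (fun p : 'rV[K]_N * 'rV[K]_n => row_fun p.2 i).
    by move=> p; apply: (@continuous_comp _ _ _ snd (fun v => row_fun v i)); [exact: cvg_snd | exact: row_fun_continuous].
  have lc (lam : {linear V -> K^o}) : continuous (fun p : 'rV[K]_N * 'rV[K]_n => lam (vec p.1) : K).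
    by move=> p; apply: (@continuous_comp _ _ _ fst (lam \o @vec K V)); [exact: cvg_fst | exact: functional_continuous].
  have [h1 h2] := @lattice_vec_continuous K _ _ eps s al be fc.
  apply: continuous_sumr => l p.
  by apply: cvgD; apply: cvgM; [exact: h1 | exact: lc | exact: h2 | exact: lc].
have DE al be : D al be (phi u0, u0) = be - row_fun u0 s * al.
  have [s1 s2] := size_lattice_vec s eps (row_fun u0) al be.
  have q0 j : (j < s)%N -> co eps (row_fun u0) (lattice_vec s eps (row_fun u0) al be) j = 0.
    by move=> js; rewrite co_lattice_vec_lt.
  rewrite /D /= -[phi u0]scale1r FE // mul1r (minors_mod r0s (fun=> fun=> erefl) q0).
  by rewrite co_lattice_vec // big1 => [|r _]; rewrite ?det_std_layer // mulr1.
have D2 : D 0 1 (phi u0, u0) = 1 by rewrite DE mulr0 subr0.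
pose H p := D 1 0 p / D 0 1 p + row_fun u0 s.
have H0 : H (phi u0, u0) = 0 by rewrite /H D2 DE divr1 mulr1 sub0r addNr.
have Hc : H p @[p --> (phi u0, u0)] --> (0 : K).
  rewrite -H0; apply: (@cvgD _ _ _ _ _ _ (cst _)); last exact: cvg_cst.
  apply: (@cvgM _ _ _ _ _ _ _ _ (Dc 1 0 _)); apply: cvgV (Dc 0 1 _).
  by rewrite D2 oner_eq0.
have D2c : D 0 1 p @[p --> (phi u0, u0)] --> (1 : K) by have := Dc 0 1 (phi u0, u0); rewrite /continuous_at D2.
have /cvgrPdist_lt/(_ _ e0) HN := Hc.
have /cvgrPdist_lt/(_ _ ltr01) D2N := D2c.
have [[A B] /= [nA nB] AB] := filterI HN D2N.
have /nbhs_ballP[e1 /= e10 eB] := nB.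
near=> v => u c vE i.
have IHe : forall j : 'I_n, (j < s)%N -> `|u0 0 j - u 0 j| < e.
  by move: u c vE {i}; near: v; exact: IH (ltnW sn) _ e0.
have IHe1 : forall j : 'I_n, (j < s)%N -> `|u0 0 j - u 0 j| < e1.
  by move: u c vE {i IHe}; near: v; exact: IH (ltnW sn) _ e10.
rewrite ltnS leq_eqVlt => /orP[/eqP is_|]; last exact: IHe.
(* Nothing is known yet about u_j for j at least s. Replacing these entries by those of u0 makes r
   close to u0 and leaves [lattice_vec s] unchanged. *)
pose r : 'rV[K]_n := \row_j if (j < s)%N then u 0 j else u0 0 j.
have Br : B r.
  apply: eB; split=> // k j; rewrite ord1 mxE; case: ifP => js; first exact: IHe1.
  exact: ballxx.
have ru k : (k < s)%N -> row_fun r k = row_fun u k.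
  move=> ks; rewrite -[k]/(nat_of_ord (Ordinal (ltn_trans ks sn))) !row_funE mxE.
  by rewrite /= ks.
have Av : A v by near: v.
have [/=] := AB (v, r) (conj Av Br).
rewrite /H /D /= (lattice_vec_ext eps 1 0 ru) (lattice_vec_ext eps 0 1 ru) sub0r.
set D10 := F _ _; set D01 := F _ _ => He H1.
have D01n0 : D01 != 0.
  by apply: contraTneq H1 => ->; rewrite subr0 normr1 ltxx.
have [s1 s2] := size_lattice_vec s eps (row_fun u) 1 (row_fun u s).
have q0 j : (j <= s)%N -> co eps (row_fun u) (lattice_vec s eps (row_fun u) 1 (row_fun u s)) j = 0.
  rewrite leq_eqVlt => /orP[/eqP ->|js]; last by rewrite co_lattice_vec_lt.
  by rewrite co_lattice_vec // mulr1 subrr.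
have := FE _ c u s1 s2; rewrite -vE (minors_mod0 _ r0s q0) mulr0 lattice_vecD.
have -> : F ((lattice_vec s eps (row_fun u) 1 0).1 + row_fun u s *: (lattice_vec s eps (row_fun u) 0 1).1,
    (lattice_vec s eps (row_fun u) 1 0).2 + row_fun u s *: (lattice_vec s eps (row_fun u) 0 1).2) v =
    D10 + row_fun u s * D01.
  rewrite /D10 /D01 /F mulr_sumr -big_split /=; apply: eq_bigr => l _.
  by rewrite !coefD !coefZ; ring.
move=> /eqP; rewrite addr_eq0 => /eqP D10E; move: He.
by rewrite D10E mulNr mulfK // opprD opprK -is_ !row_funE distrC.
Unshelve. all: by end_near.
Qed.

(** A vector lies in each of its neighbourhoods, so the estimate at phi(u) applies to phi(u) itself,
    with e equal to the supposed difference of the coordinates. *)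
Lemma phi_inj (u v : 'rV[K]_n) : <[phi u]>%VS = <[phi v]>%VS -> u = v.
Proof.
move=> uv; have : phi u \in <[phi v]>%VS by rewrite -uv memv_line.
case/vlineP => c cE; apply/rowP => i; apply/eqP; rewrite -subr_eq0; apply: contraT => uvi.
have e0 : 0 < `|u 0 i - v 0 i| by rewrite normr_gt0.
by have /nbhs_singleton/(_ v c cE i (ltn_ord i)) := phi_proper_lt u (leqnn n) e0; rewrite ltxx.
Qed.

End Chart.

Lemma chart_rel_eps (K : numFieldType) n eps eps' (u : nat -> K) x :
  (forall i, (i < n)%N -> eps i = eps' i) -> chart_rel n eps u x -> chart_rel n eps' u x.
Proof.
elim: n eps eps' u x => // n IH eps eps' u x ee [y yR xE]; exists y.
  by apply: IH yR => i im; apply: ee.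
by rewrite -ee.
Qed.

(** * Covering the orbit closure by the charts *)

Section Submanifold.
Variables (K : numFieldType) (n : nat) (a : 'I_n -> nat) (z : 'I_n -> K).
Hypothesis hz : injective z.
Hypothesis ha1 : forall i, (1 < a i)%N.
Hypothesis ha : forall i j : 'I_n, (i < j)%N -> (a i < a j)%N.
Hypothesis disc_compact : compact [set c : K | `|c| <= 1].
Local Notation V := (fusion a z).
Local Notation N := (\dim {: V}).

(** Indexing the charts by a finite type makes the union of their closed cones a finite one. *)
Definition ffun_nat (g : {ffun 'I_n -> bool}) (i : nat) : bool :=
  if insub i is Some k then g k else false.

Lemma chart_map (g : {ffun 'I_n -> bool}) : exists phi : 'rV[K]_n -> 'rV[K]_N,
  [/\ forall u, phi u != 0 /\ differentiable phi u,
      forall u h : 'rV[K]_n, 'd phi u h \in <[phi u]>%VS -> h = 0,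
      forall u v, <[phi u]>%VS = <[phi v]>%VS -> u = v,
      forall u0 (e : K), 0 < e -> \forall v \near phi u0, forall u c, v = c *: phi u ->
        forall i, `|u0 0 i - u 0 i| < e &
      [/\ forall u, @cell_cone K n a z (phi u),
          @cell_cone K n a z `<=` closure [set v | exists c u, v = c *: phi u] &
          forall u x, chart_rel n (ffun_nat g) (row_fun u) x ->
            exists c, rv (ev a z x) = c *: phi u]].
Proof.
have [I [ex [w wE]]] := chart_exists a z (ffun_nat g).
exists (phi ex w); split.
- by move=> u; split; [exact: (phi_neq0 hz ha1 ha wE) | exact: phi_differentiable].
- exact: (phi_immersion hz ha1 ha wE).
- exact: (phi_inj hz ha1 ha wE).
- move=> u0 e e0; have := phi_proper_lt hz ha1 ha wE u0 (leqnn n) e0.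
  by apply: filterS => v vP u c vE i; exact: (vP u c vE i (ltn_ord i)).
split; first exact: (phi_cell wE).
  exact: (cell_cone_phi wE).
move=> u x xR; exists (chart_scale a (ffun_nat g) (row_fun u))^-1.
by rewrite phiE (wE _ _ xR) linearZ scalerK ?(chart_rel_scale _ xR).
Qed.

Definition box (u0 : 'rV[K]_n) e : set 'rV[K]_n := [set u | forall i, `|u0 0 i - u 0 i| <= e].

Lemma box_compact u0 e : 0 < e -> compact (box u0 e).
Proof.
move=> e0; apply: (@rV_compact _ n (fun i => [set x : K | `|u0 0 i - x| <= e])) => i.
pose f (c : K) : K := u0 0 i + e * c.
rewrite (_ : [set x | _] = f @` [set c | `|c| <= 1]); last first.
  apply/seteqP; split=> [x /= xe|_ [c /= c1 <-]].
    exists ((x - u0 0 i) / e); last by rewrite /f mulrCA mulfV ?gt_eqF // mulr1 addrC subrK.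
    by rewrite /= normrM distrC normfV (gtr0_norm e0) ler_pdivrMr ?mul1r.
  by rewrite /f opprD addrA subrr sub0r normrN normrM gtr0_norm // ler_piMr // ltW.
apply: continuous_compact disc_compact; apply: continuous_subspaceT => c.
apply: (@cvgD _ _ _ (nbhs c) _ (cst _)); first exact: cvg_cst.
by apply: (@cvgM _ _ (nbhs c) _ (cst _)); first exact: cvg_cst.
Qed.

Lemma box_cone_closed (phi : 'rV[K]_n -> 'rV[K]_N) u0 e : 0 < e ->
  (forall u, phi u != 0 /\ differentiable phi u) ->
  closed [set w | exists c v, (phi @` box u0 e) v /\ w = c *: v].
Proof.
move=> e0 phiP; apply: closed_cone; last by move=> _ [u _ <-]; case: (phiP u).
apply: (@continuous_compact 'rV[K]_n 'rV[K]_N phi _ _ (@box_compact u0 e e0)); apply: continuous_subspaceT => u.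
exact/differentiable_continuous/(phiP u).2.
Qed.

Lemma nbhs_box (u0 : 'rV[K]_n) D : open D -> D u0 -> exists2 e, 0 < e & box u0 e `<=` D.
Proof.
move=> oD Du0; have /nbhs_ballP[e /= e0 eD] : nbhs u0 D by apply: open_nbhs_nbhs.
exists (e / 2); first by rewrite divr_gt0.
move=> u uB; apply: eD; split=> // k i; rewrite ord1.
apply: le_lt_trans (uB i) _; rewrite ltr_pdivrMr // ltr_pMr // ltr1n //.
Qed.

Lemma line_eq (w w' : 'rV[K]_N) : w != 0 -> <[vec w]>%VS = <[vec w']>%VS ->
  exists2 c, c != 0 & w = c *: w'.
Proof.
move=> w0 E; have : vec w \in <[vec w']>%VS by rewrite -E memv_line.
case/vlineP => c /(congr1 (@rv K V)); rewrite linearZ /= !vecK => wE; exists c => //.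
by apply: contra_neq w0 => c0; rewrite wE c0 scale0r.
Qed.

Lemma vec_lineZ c (w : 'rV[K]_N) : c != 0 -> <[vec (c *: w)]>%VS = <[vec w]>%VS.
Proof.
move=> c0; apply/eqP; rewrite linearZ /= eqEsubv -!memvE memvZ ?memv_line //=.
by rewrite -{1}[vec w](scalerK c0) memvZ ?memv_line.
Qed.

Theorem sh_submanifold : submanifold n (sh a z).
Proof.
have /choice[phi phiP] := chart_map.
(* The cones over the closed unit polydiscs are closed and finite in number; by [chart_rel_cover]
   they contain the cell, hence also its closure. *)
have cover w : @cell_cone K n a z w -> exists g u c, w = c *: phi g u.
  move=> wC; pose C g := [set w | exists c v, (phi g @` box 0 1) v /\ w = c *: v].
  suff [g _ [c [_ [[u _ <-] ->]]]] : (\bigcup_(g in setT) C g) w by exists g, u, c.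
  apply: closure_sub wC.
    apply: closed_bigcup => [|g _]; first exact: finite_finset.
    by apply: box_cone_closed => // u; case: (phiP g).
  move=> _ [c [_ [[x _ <-] ->]]].
  have [eps [u [uR u1]]] := chart_rel_cover n x.
  exists [ffun i : 'I_n => eps i] => //.
  pose u' : 'rV[K]_n := \row_i u i.
  have [_ _ _ _ [_ _ H]] := phiP [ffun i : 'I_n => eps i].
  have [|c' ->] := H u' x; last first.
    exists (c * c'), (phi [ffun i : 'I_n => eps i] u'); split; last by rewrite scalerA.
    by exists u' => // i; rewrite !mxE sub0r normrN.
  apply: (@chart_rel_eps _ _ eps) => [k kn|].
    by rewrite /ffun_nat insubT ffunE.
  apply: chart_rel_ext uR => k kn.
  by have /= -> := row_funE u' (Ordinal kn); rewrite mxE.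
move=> L /shP[w [wC w0 LE]].
have [g [u0 [c wE]]] := cover w wC.
have c0 : c != 0 by apply: contra_neq w0 => c0; rewrite wE c0 scale0r.
have [phi1 phi2 phi3 proper [phi_in phi_dense _]] := phiP g.
exists setT, (phi g); split=> [|//|u h _|u v _ _|D' oD' _].
- by split; [exact: openT | exists u0 => //; rewrite LE wE vec_lineZ].
- exact: phi2.
- exact: phi3.
(* All chart parameters of a vector in [S u e] lie in the box. Properness makes this set a
   neighbourhood of phi(u), and the interiors for boxes inside D' give the open set of lines. *)
pose S u e : set 'rV[K]_N := [set w | forall v c, w = c *: phi g v -> box u e v].
pose W := \bigcup_(ue in [set ue : 'rV[K]_n * K | 0 < ue.2 /\ box ue.1 ue.2 `<=` D']) (S ue.1 ue.2)°.
have oW : open W by apply: bigcup_open => ue _; exact: open_interior.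
pose O : set (Defs.proj V) := [set L | exists w, [/\ W w, w != 0 & val L = <[vec w]>%VS]].
exists O.
  change (open (cone O)).
  rewrite (_ : cone O = ~` [set 0] `&` \bigcup_(c in [set c : K | c != 0]) ((fun w => c *: w) @^-1` W)).
    apply: openI; first exact/closed_openC/accessible_closed_set1/hausdorff_accessible/norm_hausdorff.
    apply: bigcup_open => d _; apply: open_comp oW => x _; exact: scaler_continuous.
  apply/seteqP; split=> [x [x0 [L' [y [Wy y0 L'E]] L'x]]|x [/eqP x0 [d /= d0 Wd]]].
    split; first exact/eqP.
    have [d d0 yE] := line_eq y0 (etrans (esym L'E) L'x).
    by exists d => //=; rewrite -yE.
  split=> //.
  have dx : \dim <[vec x]> == 1%N by rewrite dim_vline vec_neq0.
  exists (exist (fun L : {vspace V} => is_true (\dim L == 1%N)) _ dx) => //.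
  exists (d *: x); split=> //; first by rewrite scaler_eq0 negb_or d0.
  by rewrite vec_lineZ.
apply/seteqP; split=> [L' [u D'u L'E]|L' [/shP[w' [w'C w'0 L'w']] [w1 [[[u e] /= [e0 eD'] w1S] w10 L'w1]]]].
  split; first by apply/shP; exists (phi g u); split=> //; exact: (phi1 u).1.
  exists (phi g u); split=> //; last exact: (phi1 u).1.
  have [e e0 eD'] := nbhs_box oD' D'u.
  exists (u, e) => //=; apply: filterS (proper u e e0) => v vP u' c' vE i.
  exact/ltW/(vP u' c' vE).
have [d d0 w1E] := line_eq w10 (etrans (esym L'w1) L'w').
have w1C : @cell_cone K n a z w1 by rewrite w1E; exact: cell_coneZ.
have [c' [_ [[v /eD' D'v <-] w1v]]] : [set w | exists c v, (phi g @` box u e) v /\ w = c *: v] w1.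
  (* Near w1 there are multiples of vectors phi(v) by density, and v lies in the box because w1 is
     interior to [S u e]. So w1 is a limit of points of the cone over the box, which is closed. *)
  have cC := @box_cone_closed (phi g) u e e0 phi1; apply: cC => B nB.
  have [y [[d' [v yE]] [By Sy]]] := phi_dense w1 w1C _ (filterI nB w1S).
  exists y; split=> //; exists d', (phi g v); split=> //; exists v => //.
  exact: Sy yE.
exists v => //; rewrite [LHS]L'w1 w1v vec_lineZ //.
by apply: contra_neq w10 => c'0; rewrite w1v c'0 scale0r.
Qed.

End Submanifold.

(** The disc is a closed subset of the image of the real square with sides from -1 to 1 under (x, y)
    |-> x + i y. *)
Lemma complex_disc_compact (R : realType) : compact [set c : (R[i] : numFieldType) | `|c| <= 1].
Proof.
pose f (p : R * R) : (R[i] : numFieldType) := (p.1 +i* p.2)%C.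
have normE (r : R) : `|r%:C%C| = `|r|%:C%C.
  by rewrite normc_def /= expr0n addr0 sqrtr_sqr.
have normi : `|'i%C : R[i]| = 1 by rewrite normc_def /= expr0n add0r expr1n sqrtr1.
have fc : continuous f.
  move=> p; apply/cvgrPdist_lt => e e0.
  have /andP[er0 /eqP ei0] : (0 < complex.Re e) && (complex.Im e == 0).
    by move: e0; rewrite ltcE /= => /andP[-> ->].
  have eE : e = (complex.Re e)%:C%C by case: e ei0 {e0 er0} => x y /= ->.
  have e20 : 0 < complex.Re e / 2 by rewrite divr_gt0.
  have nb : \forall q \near p, ball p (complex.Re e / 2) q by exact: nbhsx_ballx.
  near=> q; have [q1 q2] : ball p (complex.Re e / 2) q by near: q.
  have -> : f p - f q = (p.1 - q.1)%:C%C + 'i%C * (p.2 - q.2)%:C%C.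
    by apply/eqP; rewrite eq_complex /= !mul0r !mulr0 !mul1r !subr0 !add0r !addr0 !eqxx.
  apply: le_lt_trans (ler_normD _ _) _.
  rewrite normrM normi mul1r !normE eE -rmorphD ltcR.
  by rewrite [complex.Re e]splitr ltrD.
apply: (@subclosed_compact _ _ (f @` (`[-1, 1] `*` `[-1, 1]))).
- move=> x clx; rewrite /= real_leNgt ?normr_real ?real1 //; apply/negP => x1.
  have [y [/= y1 xy]] := clx _ (nbhsx_ballx x (`|x| - 1) ltac:(by rewrite subr_gt0)).
  have xE : `|x| <= `|y| + `|x - y| by rewrite -{1}(subrKC y x) ler_normD.
  by have := le_lt_trans xE (ler_ltD y1 xy); rewrite subrKC ltxx.
- apply: continuous_compact; first exact: continuous_subspaceT.
  by apply: compact_setX; exact: segment_compact.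
move=> [x y] /=; rewrite normc_def /= lecR => h.
have {}h : x ^+ 2 + y ^+ 2 <= 1 by rewrite -(ler_sqrt _ ler01) sqrtr1.
by exists (x, y) => //; split; rewrite /= in_itv /=; apply/andP; split; nra.
Unshelve. all: by end_near.
Qed.

(* With a_1 = 1 the factor C^{a_1} is trivial and sh_A has dimension n - 1 (a
   point for A = (1)), hence the hypothesis 1 < a i. *)
Theorem corollary1p1 (R : realType) (n : nat) (a : 'I_n -> nat)
    (z : 'I_n -> R[i]) (hz : injective z)
    (ha1 : forall i, (1 < a i)%N)
    (ha : forall i j : 'I_n, (i < j)%N -> (a i < a j)%N) :
  submanifold n (sh a z).
Proof. exact: sh_submanifold hz ha1 ha (@complex_disc_compact R). Qed.
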